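(* Let $L,k_\eta,\gamma,\Lambda,\varphi>0$ be constants. Let $\omega:[0,\infty)\to\mathbb{R}$ be continuous and piecewise $C^1$, with $\omega_{\min}\le|\omega(t)|\le\omega_{\max}$ for all $t\ge 0$ for some positive scalars $\omega_{\min},\omega_{\max}$, and with $|D^+\omega(t)|$ existing and bounded over $t\ge0$. Set $\chi(t)=\varphi|\omega(t)|$ and $\xi=\operatorname{sgn}(\omega)/\varphi$ (a nonzero constant). For $\varepsilon>0$ consider the hybrid error system $\mathcal{H}_\varepsilon$ with inputs $\chi(\cdot),D^+\chi(\cdot)$ and state $(x_{\mathrm f},x_{\mathrm s})$, where $x_{\mathrm f}\in\mathbb{R}^4$ and $x_{\mathrm s}=(\eta,\tilde\xi,\rho)\in\mathbb{S}^1\times\mathbb{R}\times[0,1]$, as defined in the context. Denote its solutions by $(\psi_{\mathrm f}(\cdot),\psi_{\mathrm s}(\cdot))$, with initial conditions $(x_{\mathrm f,0},x_{\mathrm s,0})$, and let $\rho_0$ be the initial value of the clock $\rho$. Let $\mathcal{A}_0=\{(1,0)^T\}\times\{0\}\times[0,1]\subset\mathbb{S}^1\times\mathbb{R}^2$. Then the set $\{0_{4\times1}\}\times\mathcal{A}_0$ is semiglobally practically asymptotically stable as $\varepsilon\to0^+$, that is: there exist a proper indicator function $\sigma_{\mathrm s}$ of $\mathcal{A}_0$ in $\mathbb{S}^1\times\mathbb{R}^2$ and a class $\mathcal{KL}$ function $\beta_{\mathrm s}$ such that, for any positive scalars $\Delta_{\mathrm f},\Delta_{\mathrm s},\delta$,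 there exists $\varepsilon^*>0$ such that, for all $0<\varepsilon\le\varepsilon^*$ and all solutions $(\psi_{\mathrm f}(\cdot),\psi_{\mathrm s}(\cdot))$ of $\mathcal{H}_\varepsilon$ satisfying $\rho_0=0$, $|x_{\mathrm f,0}|\le\Delta_{\mathrm f}$ and $\sigma_{\mathrm s}(x_{\mathrm s,0})\le\Delta_{\mathrm s}$, the following bounds hold for all $(t,j)\in\operatorname{dom}(\psi_{\mathrm f}(\cdot),\psi_{\mathrm s}(\cdot))$: $$|\psi_{\mathrm f}(t,j)|\le \exp(-t/\varepsilon)\,|x_{\mathrm f,0}|+\delta,$$ $$\sigma_{\mathrm s}(\psi_{\mathrm s}(t,j))\le\beta_{\mathrm s}\big(\sigma_{\mathrm s}(x_{\mathrm s,0}),\,t+j\big)+\delta.$$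
   Context: Notation. $\mathbb{S}^1\subset\mathbb{R}^2$ is the unit circle; $\mathcal{J}=\begin{pmatrix} 0 & -1 \\ 1 & 0 \end{pmatrix}$; for $\zeta=(c,s)^T\in\mathbb{S}^1$, $\mathcal{C}[\zeta]=\begin{pmatrix} c & -s \\ s & c \end{pmatrix}$. $D^+$ is the upper right Dini derivative. $|\cdot|$ is the Euclidean norm. $I_2$ is the $2\times2$ identity. Hybrid systems. Solutions are hybrid arcs in the sense of Goebel–Sanfelice–Teel, defined on hybrid time domains of pairs $(t,j)$ starting at $(0,0)$: locally absolutely continuous in $t$ for fixed $j$, satisfying the flow equation for almost all $t$ while in the flow set, and satisfying the jump inclusion at jumps, which occur from the jump set. The inputs $\chi,D^+\chi$ are evaluated at ordinary time $t$. A proper indicator function of a compact set $\mathcal{A}$ in a closed set $X\subset\mathbb{R}^n$ is a continuous function $\sigma:X\to[0,\infty)$ with $\sigma(x)=0$ if and only if $x\in\mathcal{A}$, and $\sigma(x)\to\infty$ as $|x|\to\infty$, $x\in X$. Origin of the system. It is the estimation error system of a hybrid observer for a permanent magnets synchronous machine: $h=-\chi\mathcal{J}\eta$ is the back-EMF, $\hat h$ its estimate, $\tilde h=h-\hat h$, $\tilde\imath$ the current estimation error, $\hat\xi=\xi-\tilde\xi$ the estimate of $\xi$, $\hat\zeta_\chi\in\mathbb{S}^1$ the estimate of the frame $\zeta_\chi\in\mathbb{S}^1$, $\eta=\mathcal{C}^T[\hat\zeta_\chi]\zeta_\chi$, and $x_{\mathrm f}=(\varepsilon^{-1}\tilde\imath,\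 L^{-1}\tilde h-\varepsilon^{-1}\tilde\imath)$. Definition of $\mathcal{H}_\varepsilon$. Write $x_{\mathrm f}=(x_{\mathrm f}^1,x_{\mathrm f}^2)$ with $x_{\mathrm f}^1,x_{\mathrm f}^2\in\mathbb{R}^2$, and $\eta=(\eta_1,\eta_2)^T$. Define the functions of $(x_{\mathrm f},\chi,x_{\mathrm s})$ $$h=-\chi\mathcal{J}\eta,\quad \tilde h=L(x_{\mathrm f}^1+x_{\mathrm f}^2),\quad \hat h=(\hat h_1,\hat h_2)^T=h-\tilde h,\quad \hat\xi=\xi-\tilde\xi,\quad \hat\omega_\chi=|\hat h|\hat\xi+k_\eta\hat h_1,$$ $$f_h=-(D^+\chi)\mathcal{J}\eta+\chi(\chi\xi-\hat\omega_\chi)\eta$$ ($f_h$ is $D^+h$ along flows). Flows, for $x_{\mathrm s}\in C_{\mathrm s}=\mathbb{S}^1\times\mathbb{R}\times[0,1]$: $$D^+x_{\mathrm f}=\varepsilon^{-1}\begin{pmatrix} -I_2 & I_2 \\ -I_2 & -I_2 \end{pmatrix}x_{\mathrm f}+\begin{pmatrix} 0_{2\times2} \\ L^{-1}I_2 \end{pmatrix}f_h,\qquad \dot\eta=(\chi\xi-\hat\omega_\chi)\mathcal{J}\eta,\qquad \dot{\tilde\xi}=-\gamma\hat h_1,\qquad \dot\rho=\Lambda.$$ Jumps, for $x_{\mathrm s}\in D_{\mathrm s}=\mathbb{S}^1\times\mathbb{R}\times\{1\}$: $$x_{\mathrm f}^+=\operatorname{diag}\{G,G\}\,x_{\mathrm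 f},\qquad \eta^+=G\eta,\qquad \tilde\xi^+=\tilde\xi,\qquad \rho^+=0,\qquad\text{for some } G\in G_{\mathrm f}(\hat h),$$ with the same matrix $G$ used in all components. Here $G_{\mathrm f}$ is the set of matrices $\mathcal{C}^T[\zeta^+]\mathcal{C}[\hat\zeta_\chi]$ with $\zeta^+\in G_\zeta(\hat h,\hat\zeta_\chi)$, where $G_\zeta$ is the jump map of the estimate $\hat\zeta_\chi$: $$G_\zeta(\hat h,\hat\zeta_\chi)=\begin{cases} -\mathcal{C}^T[\hat\zeta_\chi]\begin{pmatrix} \cos 2\theta_\chi \\ \sin 2\theta_\chi \end{pmatrix} & \text{if }\hat h_2\ge0, \\ \hat\zeta_\chi & \text{otherwise,} \end{cases}\qquad \theta_\chi\in\operatorname{atan2}(y_\chi,x_\chi),\quad\begin{pmatrix} x_\chi \\ y_\chi \end{pmatrix}=\mathcal{C}[\hat\zeta_\chi]\mathcal{J}\hat h,$$ where $\operatorname{atan2}(y,x)\subset[-\pi,\pi]$ is the set-valued angle of $(x,y)$, with $\operatorname{atan2}(0,0)=[-\pi,\pi]$ and $\operatorname{atan2}(0,x)=\{-\pi,\pi\}$ for $x<0$. The set $G_{\mathrm f}$ does not depend on $\hat\zeta_\chi$. Explicitly: $G_{\mathrm f}(\hat h)=\{I_2\}$ if $\hat h_2<0$; $G_{\mathrm f}(\hat h)=\{-(\mathcal{C}^T[\mathcal{J}\hat h/|\hat h|])^2\}$ if $\hat h_2\ge0$ and $\hat h\neq0$; $G_{\mathrm f}(0)$ is the set of all planar rotation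 matrices. *)

(* Defs.v *)
(* MathComp-Analysis world: all real numbers live in an abstract R : realType. *)
From mathcomp Require Import all_boot all_order all_algebra.
From mathcomp Require Import all_classical all_reals all_analysis.
Set Implicit Arguments.
Unset Strict Implicit.
Unset Printing Implicit Defensive.
Import Order.TTheory GRing.Theory Num.Theory.
Import numFieldNormedType.Exports.
Local Open Scope classical_set_scope.
Local Open Scope ring_scope.

(* Euclidean norm; the library's norm `|v| on matrices is the sup norm. *)
Definition enorm (R : realType) (n : nat) (v : 'cV[R]_n) : R :=
  Num.sqrt (\sum_(i < n) v i 0 ^+ 2).

Definition col2 (R : realType) (a b : R) : 'cV[R]_2 :=
  \col_(i < 2) (if i == 0 then a else b).

Definition unit_circle (R : realType) : set 'cV[R]_2 := [set z | enorm z = 1].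

Definition mx2 (R : realType) (a b c d : R) : 'M[R]_2 :=
  \matrix_(i < 2, j < 2)
    (if i == 0 then if j == 0 then a else b else if j == 0 then c else d).

Definition Jmx (R : realType) : 'M[R]_2 := mx2 0 (-1) 1 0.

Definition Cmx (R : realType) (z : 'cV[R]_2) : 'M[R]_2 :=
  mx2 (z 0 0) (- z 1 0) (z 1 0) (z 0 0).

Definition upper_right_dini (R : realType) (f : R -> R) (t : R) : \bar R :=
  limf_esup (fun s : R => ((f (t + s) - f t) / s)%:E) (0 : R)^'+.

(* Piecewise C^1 on [0, +oo[: continuously differentiable off a set of         *)
(* breakpoints that is finite on every bounded interval. No one-sided limit of *)
(* the derivative is required at the breakpoints.                              *)
Definition piecewise_C1 (R : realType) (f : R -> R) : Prop :=
  exists B : set R,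
    (forall T : R, finite_set (B `&` `[0, T])) /\
    (forall t : R, 0 < t -> ~ B t ->
       derivable f t 1 /\ {for t, continuous (derive1 f)}).

Definition class_KL (R : realType) (beta : R -> R -> R) : Prop :=
  [/\ {within [set p : R * R | 0 <= p.1 /\ 0 <= p.2],
         continuous (fun p : R * R => beta p.1 p.2)},
      (forall s, 0 <= s -> beta 0 s = 0),
      (forall s, 0 <= s -> {in `[0, +oo[ &, {homo beta ^~ s : r r' / r < r'}}),
      (forall r, 0 <= r ->
         {in `[0, +oo[ &, {homo beta r : s s' / s <= s' >-> s' <= s}}) &
      (forall r, 0 <= r -> beta r s @[s --> +oo] --> (0 : R))].

(* The values of sigma outside X are irrelevant. *)
Definition proper_indicator (R : realType) (n : nat) (X A : set 'cV[R]_n)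
    (sigma : 'cV[R]_n -> R) : Prop :=
  [/\ {within X, continuous sigma},
      (forall x, X x -> 0 <= sigma x),
      (forall x, X x -> (sigma x = 0 <-> A x)) &
      (forall M : R, exists r : R,
         forall x, X x -> r <= enorm x -> M <= sigma x)].

Definition abs_continuous (R : realType) (n : nat) (a b : R)
    (f : R -> 'cV[R]_n) : Prop :=
  forall e : R, 0 < e -> exists2 d : R, 0 < d &
    forall (m : nat) (u v : 'I_m -> R),
      (forall i, [/\ a <= u i, u i <= v i & v i <= b]) ->
      (forall i k, i != k -> v i <= u k \/ v k <= u i) ->
      \sum_(i < m) (v i - u i) < d ->
      \sum_(i < m) enorm (f (v i) - f (u i)) < e.

Definition locally_abs_continuous (R : realType) (n : nat) (I : set R)
    (f : R -> 'cV[R]_n) : Prop :=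
  forall a b : R, a <= b -> `[a, b] `<=` I -> abs_continuous a b f.

Definition compact_hybrid_time_domain (R : realType) (E : set (R * nat)) : Prop :=
  exists (K : nat) (t : nat -> R),
    [/\ t 0%N = 0,
        (forall i, (i < K)%N -> t i <= t i.+1) &
        E = [set p | (p.2 < K)%N /\ t p.2 <= p.1 <= t p.2.+1]].

Definition hybrid_time_domain (R : realType) (E : set (R * nat)) : Prop :=
  [/\ (forall p, E p -> 0 <= p.1),
      E (0, 0%N) &
      (forall T J, E (T, J) ->
         compact_hybrid_time_domain
           (E `&` [set p | 0 <= p.1 <= T /\ (p.2 <= J)%N]))].

Definition flow_times (R : realType) (E : set (R * nat)) (j : nat) : set R :=
  [set t | E (t, j)].

(* The slow state x_s = (eta, xi~, rho) is a vector of R^4 with first block    *)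
(* eta : R^2 and second block (xi~, rho); likewise x_f = (x_f^1, x_f^2).       *)
Definition eta (R : realType) (xs : 'cV[R]_(2 + 2)) : 'cV[R]_2 := usubmx xs.
Definition xi_err (R : realType) (xs : 'cV[R]_(2 + 2)) : R := dsubmx xs 0 0.
Definition clock (R : realType) (xs : 'cV[R]_(2 + 2)) : R := dsubmx xs 1 0.

Definition slow_space (R : realType) : set 'cV[R]_(2 + 2) :=
  [set xs | unit_circle (eta xs)].
Definition slow_flow_set (R : realType) : set 'cV[R]_(2 + 2) :=
  [set xs | unit_circle (eta xs) /\ 0 <= clock xs <= 1].
Definition slow_jump_set (R : realType) : set 'cV[R]_(2 + 2) :=
  [set xs | unit_circle (eta xs) /\ clock xs = 1].
Definition slow_attractor (R : realType) : set 'cV[R]_(2 + 2) :=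
  [set xs | [/\ eta xs = col2 1 0, xi_err xs = 0 & 0 <= clock xs <= 1]].

Definition hat_h (R : realType) (L chi : R) (xf xs : 'cV[R]_(2 + 2)) : 'cV[R]_2 :=
  - (chi *: (Jmx R *m eta xs)) - L *: (usubmx xf + dsubmx xf).

Definition hat_omega (R : realType) (L k_eta xi chi : R)
    (xf xs : 'cV[R]_(2 + 2)) : R :=
  enorm (hat_h L chi xf xs) * (xi - xi_err xs)
  + k_eta * hat_h L chi xf xs 0 0.

(* dchi stands for the current value of D^+ chi. *)
Definition f_h (R : realType) (L k_eta xi chi dchi : R)
    (xf xs : 'cV[R]_(2 + 2)) : 'cV[R]_2 :=
  - (dchi *: (Jmx R *m eta xs))
  + (chi * (chi * xi - hat_omega L k_eta xi chi xf xs)) *: eta xs.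

Definition fast_flow (R : realType) (L k_eta xi eps chi dchi : R)
    (xf xs : 'cV[R]_(2 + 2)) : 'cV[R]_(2 + 2) :=
  eps^-1 *: (block_mx (- 1%:M) 1%:M (- 1%:M) (- 1%:M) *m xf)
  + col_mx 0 (L^-1 *: 1%:M) *m f_h L k_eta xi chi dchi xf xs.

Definition slow_flow (R : realType) (L k_eta gamma Lambda xi chi : R)
    (xf xs : 'cV[R]_(2 + 2)) : 'cV[R]_(2 + 2) :=
  col_mx ((chi * xi - hat_omega L k_eta xi chi xf xs) *: (Jmx R *m eta xs))
         (col2 (- (gamma * hat_h L chi xf xs 0 0)) Lambda).

(* Set-valued angle: at (0, 0) both equations are void and every angle of      *)
(* [-pi, pi] qualifies; on the negative x-axis both -pi and pi do.             *)
Definition atan2 (R : realType) (y x : R) : set R :=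
  [set th | [/\ - pi <= th <= pi,
                x = enorm (col2 x y) * cos th &
                y = enorm (col2 x y) * sin th]].

Definition G_zeta (R : realType) (hh zeta : 'cV[R]_2) : set 'cV[R]_2 :=
  let p := Cmx zeta *m (Jmx R *m hh) in
  [set zp | if 0 <= hh 1 0
            then exists2 th, atan2 (p 1 0) (p 0 0) th &
                   zp = - ((Cmx zeta)^T *m col2 (cos (th *+ 2)) (sin (th *+ 2)))
            else zp = zeta].

(* The set of matrices C^T[zp] C[zeta] does not depend on zeta in the unit     *)
(* circle, so that the union over zeta is the set obtained from any one zeta.  *)
Definition G_f (R : realType) (hh : 'cV[R]_2) : set 'M[R]_2 :=
  [set G | exists zeta zp : 'cV[R]_2,
     [/\ unit_circle zeta, G_zeta hh zeta zp & G = (Cmx zp)^T *m Cmx zeta]].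

(* Solutions (psi_f, psi_s), with common domain E, of the error system with    *)
(* inputs chi and D^+ chi; both arcs are total functions whose values off E    *)
(* are irrelevant. The derivatives at the endpoints of an interval of flow,    *)
(* which do see such values, concern a negligible set of times.                *)
Record error_solution (R : realType) (L k_eta gamma Lambda xi eps : R)
    (chi : R -> R) (E : set (R * nat))
    (psif psis : R -> nat -> 'cV[R]_(2 + 2)) : Prop := ErrorSolution {
  sol_domain : hybrid_time_domain E ;
  sol_arc_f : forall j,
    locally_abs_continuous (flow_times E j) (psif ^~ j) ;
  sol_arc_s : forall j,
    locally_abs_continuous (flow_times E j) (psis ^~ j) ;
  sol_init : slow_flow_set (psis 0 0%N) \/ slow_jump_set (psis 0 0%N) ;
  sol_flow_set : forall j t, (flow_times E j)° t -> slow_flow_set (psis t j) ;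
  sol_flow_f : forall j, {ae lebesgue_measure, forall t : R, flow_times E j t ->
    forall i, upper_right_dini (fun s => psif s j i 0) t =
      (fast_flow L k_eta xi eps (chi t) (fine (upper_right_dini chi t))
         (psif t j) (psis t j) i 0)%:E} ;
  sol_flow_s : forall j, {ae lebesgue_measure, forall t : R, flow_times E j t ->
    is_derive t (1 : R) (psis ^~ j)
      (slow_flow L k_eta gamma Lambda xi (chi t) (psif t j) (psis t j))} ;
  sol_jump : forall j t, E (t, j) -> E (t, j.+1) ->
    slow_jump_set (psis t j) /\
    exists G : 'M[R]_2,
      [/\ G_f (hat_h L (chi t) (psif t j) (psis t j)) G,
          psif t j.+1 = block_mx G 0 0 G *m psif t j &
          psis t j.+1 =
            col_mx (G *m eta (psis t j)) (col2 (xi_err (psis t j)) 0)]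
}.

(* Main.v *)
Require Import Defs.
From mathcomp Require Import all_boot all_order all_algebra.
From mathcomp Require Import all_classical all_reals all_analysis.
From mathcomp Require Import measurable_realfun ring lra.
Set Implicit Arguments.
Unset Strict Implicit.
Unset Printing Implicit Defensive.
Import Order.TTheory GRing.Theory Num.Theory.
Import numFieldNormedType.Exports.
Local Open Scope classical_set_scope.
Local Open Scope ring_scope.

(* Write V = 1 - eta_1 + xi~^2 / (2 gamma).  With x_f = 0 one has              *)
(* V' = - k_eta chi eta_2^2 on flows, and a jump replaces eta_1 by |eta_1|, so *)
(* V does not increase; it is made strict by                                   *)
(*   U = V - mu eta_1 eta_2 xi~ - mu (1 - rho) eta_1 (1 - eta_1).              *)
(* The cross term yields a negative multiple of xi~^2, and the clock-weighted  *)
(* term converts the gain of the next jump into a decrease during the flow     *)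
(* near the spurious equilibrium eta = (-1, 0).  For mu of the order of        *)
(* 1 / (1 + R) this gives U' <= - lam U on {V <= R}, with lam proportional to  *)
(* mu, whence the explicit beta (r, s) = 3 r exp (- q s / (5 + 3 r)).          *)
(* The fast state satisfies |x_f|' <= - |x_f| / eps + M1 as long as the slow   *)
(* state is bounded, and perturbs U by O(|x_f|), both on flows and at jumps    *)
(* (which occur at times >= 1 / Lambda because rho starts at 0).  The two      *)
(* bounds are propagated jointly by a barrier argument.  Since the equations   *)
(* hold almost everywhere and partly in the sense of Dini derivatives, they    *)
(* are first upgraded to classical derivatives off the breakpoints of omega.   *)

(** * Absolutely continuous functions and barriers *)

(** The argument is a quantitative two-time-scale one. The matrix driving [x_f] has symmetric part
    minus the identity, so at rate [1 / eps] the fast state enters a ball of radius O(eps), as long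
    as its input [f_h] stays bounded ([fast_pointwise], [fast_input_bound]). With zero back-EMF
    error, [lyap] decreases strictly along flows ([lyap_rate_nominal]) and does not increase at
    jumps; the true system differs from this ideal one by terms linear in the back-EMF error
    ([lyap_rate_perturb], [jump_estimate]).

    Each of the two estimates presupposes the bound supplied by the other. [joint_barrier] resolves
    the circularity: the bounds are written as [g <= 0] and [h <= 0], and each derivative has to be
    nonpositive only where both functions lie below a fixed positive slack. [barriers_flow] applies
    this on an interval of flow, [tuned_inv_jump] crosses a jump, and [hybrid_induction] chains the
    two.

    Jumps perturb [lyap] by O(eps): as the clock starts at 0, no jump occurs before time
    [1 / Lambda], when the transient [exp (- t / eps)] is already O(eps). These errors do not
    accumulate, because the term [kap * rho] builds up a reserve of [kap] during each clock period
    and spends it at the reset. The clock also gives [j + rho <= Lambda * t], which turns decay in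
    [t] into decay in [t + j].

    The weight [mu] is a function of the initial energy only, so the class KL bound does not depend
    on the radii of the initial set; only [eps_star] does ([tuned_exists]). *)

Section RealAnalysis.
Variable R : realType.
Implicit Types (a b c t s u v x e d : R) (f g h : R -> R).

(** Continuous induction: the supremum of the points satisfying [P] satisfies [P] by closedness from
    the left, and openness to the right forces it to be [b]. [P] need not hold on all of [[a, b]],
    only at points accumulating from the left. *)
Lemma sup_induction a b (P : R -> Prop) :
  a <= b -> P a ->
  (forall t, a < t <= b ->
     (forall d, 0 < d -> exists s, [/\ a <= s, t - d < s, s < t & P s]) ->
     P t) ->
  (forall t, a <= t < b -> P t -> exists s, t < s <= b /\ P s) ->
  P b.
Proof.
move=> ab Pa Pcl Pop.
pose A := [set t | a <= t <= b /\ P t].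
have A0 : A !=set0 by exists a; split => //; rewrite lexx.
have Aub : ubound A b by move=> t [/andP[]].
have hsA : has_sup A by split => //; exists b.
set s := sup A.
have as_ : a <= s by apply: ub_le_sup; [exists b|split => //; rewrite lexx].
have sb : s <= b by exact: ge_sup.
have As : P s.
  have [->//|sa] := eqVneq s a.
  have lt_as : a < s by rewrite lt_neqAle eq_sym sa.
  apply: contrapT => nPs; apply: (nPs); apply: Pcl; first by rewrite lt_as sb.
  move=> d d0; have [u [/andP[au ub] Pu] su] := sup_adherent d0 hsA.
  exists u; split => //; rewrite lt_neqAle; apply/andP; split.
    by apply/eqP => us; apply: nPs; rewrite -us.
  by apply: ub_le_sup; [exists b|split => //; rewrite au ub].
have [<-//|neq] := eqVneq s b.
have lt_sb : s < b by rewrite lt_neqAle neq.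
have sab : a <= s < b by rewrite as_ lt_sb.
have [u [/andP[su ub] Pu]] := Pop s sab As.
suff : u <= s by rewrite leNgt su.
apply: ub_le_sup; first by exists b.
by split => //; rewrite ub (le_trans as_ (ltW su)).
Qed.

(** Scalar form of [abs_continuous]; [abs_continuous_acr] passes to it coordinate by coordinate. *)
Definition acr a b f := forall e, 0 < e -> exists2 d, 0 < d &
  forall (m : nat) (u v : 'I_m -> R),
    (forall i, [/\ a <= u i, u i <= v i & v i <= b]) ->
    (forall i k, i != k -> v i <= u k \/ v k <= u i) ->
    \sum_(i < m) (v i - u i) < d ->
    \sum_(i < m) `|f (v i) - f (u i)| < e.

(** Families are lists rather than functions on ['I_m], so that one more interval can be added by a
    cons. *)
Definition intervals_in (U : set R) a t (l : seq (R * R)) :=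
  [/\ (forall p, p \in l -> [/\ a <= p.1, p.1 <= p.2, p.2 <= t &
          `[p.1, p.2] `<=` U]) &
      pairwise (fun p q : R * R => (p.2 <= q.1) || (q.2 <= p.1)) l].

(** The intervals may share endpoints, but their interiors are disjoint and have the same lengths,
    so the sum is the measure of a subset of [U]. *)
Lemma intervals_in_length U a t l : open U -> intervals_in U a t l ->
  ((\sum_(p <- l) (p.2 - p.1))%:E <= lebesgue_measure U)%E.
Proof.
move=> oU [lU pl].
pose B (l : seq (R * R)) := \big[setU/set0]_(p <- l) (`]p.1, p.2[%classic : set R).
have mB k : measurable (B k).
  by rewrite /B; apply: bigsetU_measurable => p _; exact: measurable_itv.
have -> : ((\sum_(p <- l) (p.2 - p.1))%:E = lebesgue_measure (B l))%E.
  elim: l lU pl => [|p l IH] lU pl.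
    by rewrite /B !big_nil measure0.
  have [_ pp _ _] := lU p (mem_head _ _).
  move: pl; rewrite /= => /andP[/allP pq pl].
  rewrite /B !big_cons measureU //; last 2 first.
  - exact: mB.
  - apply/seteqP; split => // x [] /=.
    rewrite in_itv /= => /andP[px xp]; rewrite -bigcup_seq.
    move=> -[q /= ql]; rewrite in_itv /= => /andP[qx xq].
    have /orP[/= H|/= H] := pq q ql.
      by have := lt_trans (lt_le_trans xp H) qx; rewrite ltxx.
    by have := lt_trans (lt_le_trans xq H) px; rewrite ltxx.
  have E : (lebesgue_measure (`]p.1, p.2[%classic : set R) = (p.2 - p.1)%:E)%E.
    rewrite lebesgue_measure_itv /= lte_fin.
    have [//|] := ltP p.1 p.2.
    move=> pp2; have -> : p.1 = p.2 by apply/eqP; rewrite eq_le pp pp2.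
    by rewrite subrr.
  rewrite EFinD IH //; first by congr (_ + _)%E; exact: esym E.
  by move=> q ql; apply: lU; rewrite inE ql orbT.
apply: le_measure; rewrite ?inE //.
- exact: mB.
- exact: open_measurable.
- move=> x; rewrite /B -bigcup_seq => -[q /= ql].
  rewrite in_itv /= => /andP[qx xq].
  have [_ _ _] := lU q ql; apply; rewrite /= in_itv /=.
  by rewrite !ltW.
Qed.

Lemma acr_intervals a b f : acr a b f -> forall e, 0 < e ->
  exists2 d, 0 < d & forall U t l, open U -> (lebesgue_measure U < d%:E)%E ->
    t <= b -> intervals_in U a t l -> \sum_(p <- l) `|f p.2 - f p.1| < e.
Proof.
move=> acf e e0; have [d d0 H] := acf e e0; exists d => //.
move=> U t l oU Ud tb lU; have := le_lt_trans (intervals_in_length oU lU) Ud.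
rewrite lte_fin !(big_nth (0, 0)) !big_mkord => /H; apply.
- move=> i; have [lUi _] := lU.
  have [//|? ? it _] := lUi (nth (0, 0) l i); first exact: mem_nth.
  by split => //; exact: le_trans it tb.
- move=> i k ik; have [_ /(pairwiseP (0, 0)) pl] := lU.
  move: ik; rewrite neq_ltn => /orP[ik|ki].
    have := pl i k; rewrite !inE !ltn_ord => /(_ isT isT ik).
    by case/orP; [left|right].
  have := pl k i; rewrite !inE !ltn_ord => /(_ isT isT ki).
  by case/orP; [right|left].
Qed.

Lemma acr_continuous a b f e : acr a b f -> 0 < e -> exists2 d, 0 < d &
  forall u v, a <= u -> u <= v -> v <= b -> v - u < d -> `|f v - f u| < e.
Proof.
move=> acf e0; have [d d0 H] := acf e e0; exists d => // u v au uv vb uvd.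
have := H 1%N (fun=> u) (fun=> v).
rewrite !big_ord1; apply => // i k; by rewrite !ord1.
Qed.

(* The variation [v t] of [g] over the intervals of [a, t] inside a small open *)
(* neighbourhood of the exceptional set [N] is at most [e], and dominates the  *)
(* increments of [g] from the points of [N].                                   *)
Lemma acr_nonincreasing a b g (N : set R) :
  a <= b -> acr a b g -> lebesgue_measure.-negligible N ->
  (forall t, a <= t < b -> ~ N t -> forall e d, 0 < e -> 0 < d ->
     exists s, [/\ 0 < s, s < d & g (t + s) - g t <= e * s]) ->
  g b <= g a.
Proof.
move=> ab acg nN Hg; rewrite -subr_le0.
apply/ler_addgt0Pr => e0 e0_gt0; rewrite add0r.
(* The error [e0] is shared out as [e * (b - a)] for slopes at good points and [e] for the variation
   inside [U]. *)
pose e := e0 / (b - a + 1).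
have ba1 : 0 < b - a + 1 by lra.
have e_gt0 : 0 < e by rewrite divr_gt0.
have -> : e0 = e * (b - a + 1) by rewrite /e divfK // gt_eqF.
have [d d0 Hd] := acr_intervals acg e_gt0.
have [U [oU NU Ud]] : exists U : set R, [/\ open U, N `<=` U &
    (lebesgue_measure U < d%:E)%E].
  have [A [mA A0 NA]] := nN.
  have [] := @lebesgue_regularity_outer R A d mA _ d0.
    by rewrite [X in (X < _)%E]A0.
  move=> U [oU AU Ud]; exists U; split => //; first exact: subset_trans AU.
  have mU := open_measurable oU.
  have -> : U = A `|` (U `\` A) by rewrite setDUK.
  rewrite measureU //=; last 2 first.
  - exact: measurableD.
  - by rewrite setDIK.
  by rewrite [X in (X + _)%E]A0 add0e.
pose S t := [set x | exists2 l, intervals_in U a t l &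
                       x = \sum_(p <- l) `|g p.2 - g p.1|].
pose v t := sup (S t).
have S0 t : S t 0 by exists [::]; [split|rewrite big_nil].
have Sub t : t <= b -> ubound (S t) e.
  by move=> tb x [l lU ->]; apply/ltW/(Hd U t).
have vge t x : t <= b -> S t x -> x <= v t.
  by move=> tb Sx; apply: ub_le_sup => //; exists e; exact: Sub.
have vle t : t <= b -> v t <= e.
  by move=> tb; apply: ge_sup; [exists 0|exact: Sub].
have vmono t s : t <= s -> s <= b -> v t <= v s.
  move=> ts sb; apply: ge_sup; first by exists 0.
  move=> x [l [lU pl] ->]; apply: vge => //; exists l => //; split => //.
  by move=> p /lU[? ? pt ?]; split => //; exact: le_trans pt ts.
have vinc t s : a <= t -> t <= s -> s <= b -> `[t, s] `<=` U ->
    v t + `|g s - g t| <= v s.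
  move=> at_ ts sb tsU; rewrite -lerBrDr; apply: ge_sup; first by exists 0.
  move=> x [l [lU pl] ->]; rewrite lerBrDr; apply: vge => //.
  exists ((t, s) :: l); last by rewrite big_cons addrC.
  split.
    move=> p; rewrite inE => /predU1P[->//|/lU[? ? pt ?]]; split => //.
    exact: le_trans pt ts.
  rewrite /= pl andbT; apply/allP => q /lU[_ _ qt _] /=.
  by rewrite qt orbT.
suff H : g b - g a <= e * (b - a) + v b.
  by have := vle b (lexx _); rewrite mulrDr mulr1 => ?; lra.
apply: (@sup_induction a b (fun t => g t - g a <= e * (t - a) + v t)) => //.
- by rewrite !subrr mulr0 add0r vge.
- move=> t /andP[at_ tb] Ht; apply/ler_addgt0Pr => z z0.
  have [r r0 Hr] := acr_continuous acg z0.
  have [s [as_ ts st Ps]] := Ht r r0.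
  have tsr : t - s < r by lra.
  have := Hr s t as_ (ltW st) tb tsr; rewrite ltr_norml => /andP[_ H1].
  have H2 := vmono s t (ltW st) tb.
  have : e * (s - a) <= e * (t - a) by rewrite ler_wpM2l ?lerB // ltW.
  lra.
- move=> t /andP[at_ tb] Ht.
  (* At a point of [N] a short interval to the right lies in [U] and its increment is charged to
     [v]; elsewhere the slope hypothesis provides the step. *)
  have [Nt|Nt] := pselect (N t).
    have [/= r r0 Hr] := (@nbhs_ballP _ R t U).1 (open_nbhs_nbhs (conj oU (NU t Nt))).
    pose s := t + Num.min (r / 2) (b - t).
    have ms : 0 < Num.min (r / 2) (b - t) by rewrite lt_min divr_gt0 // subr_gt0.
    have ts : t < s by rewrite ltrDl.
    have sb : s <= b by rewrite -lerBrDl ge_min lexx orbT.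
    exists s; rewrite ts sb; split => //.
    have : v t + `|g s - g t| <= v s.
      apply: vinc => //; first exact: ltW.
      move=> x /=; rewrite in_itv /= => /andP[tx xs]; apply: Hr.
      rewrite /ball /= ler0_norm ?subr_le0 // opprB.
      apply: (@le_lt_trans _ _ (r / 2)); last by rewrite gtr_pMr // invf_lt1 // ltr1n.
      by rewrite lerBlDl (le_trans xs) // lerD2l ge_min lexx.
    have := ler_norm (g s - g t) => H1 H2.
    have : e * (t - a) <= e * (s - a) by rewrite ler_wpM2l ?lerB // ltW.
    lra.
  have [s [s0 sd H]] := Hg t ltac:(by rewrite at_ tb) Nt e (b - t) e_gt0
    ltac:(by rewrite subr_gt0).
  have sb : t + s <= b by rewrite -lerBrDl ltW.
  exists (t + s); rewrite ltrDl s0 sb; split => //.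
  have := vmono t (t + s) ltac:(by rewrite lerDl ltW) sb.
  have -> : e * (t + s - a) = e * (t - a) + e * s by ring.
  lra.
Qed.

Lemma acr_subr_lin a b f c : acr a b f -> acr a b (fun t => f t - c * t).
Proof.
move=> acf e e0; have [d d0 H] := acf (e / 2) ltac:(by rewrite divr_gt0).
have c1 : 0 < `|c| + 1 by rewrite ltr_wpDl.
exists (Num.min d (e / (2 * (`|c| + 1)))).
  by rewrite lt_min d0 divr_gt0 // mulr_gt0.
move=> m u v uv duv; rewrite lt_min => /andP[/(H m u v uv duv) H1 H2].
apply: (@le_lt_trans _ _ (\sum_(i < m) `|f (v i) - f (u i)| +
                          `|c| * \sum_(i < m) (v i - u i))).
  rewrite mulr_sumr -big_split /=; apply: ler_sum => i _.
  have [_ ui _] := uv i.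
  have -> : f (v i) - c * v i - (f (u i) - c * u i) =
            (f (v i) - f (u i)) - c * (v i - u i) by ring.
  apply: (le_trans (ler_normB _ _)); rewrite lerD2l normrM.
  by rewrite [X in _ * X]ger0_norm ?subr_ge0.
have -> : e = e / 2 + e / 2 by lra.
apply: ltr_leD => //.
apply: (@le_trans _ _ ((`|c| + 1) * (e / (2 * (`|c| + 1))))).
  apply: ler_pM => //; last exact: ltW; last by rewrite lerDl.
  by apply: sumr_ge0 => i _; rewrite subr_ge0; have [] := uv i.
by rewrite le_eqVlt; apply/orP; left; apply/eqP; field; rewrite gt_eqF.
Qed.

Lemma acr_increment_le a b c g (N : set R) :
  a <= b -> acr a b g -> lebesgue_measure.-negligible N ->
  (forall t, a <= t < b -> ~ N t -> forall e d, 0 < e -> 0 < d ->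
     exists s, [/\ 0 < s, s < d & g (t + s) - g t <= (c + e) * s]) ->
  g b - g a <= c * (b - a).
Proof.
move=> ab acg nN Hg.
have : g b - c * b <= g a - c * a.
  apply: (@acr_nonincreasing a b (fun t => g t - c * t) N) => //.
    exact: acr_subr_lin.
  move=> t atb Nt e d e0 d0; have [s [s0 sd H]] := Hg t atb Nt e d e0 d0.
  by exists s; split => //; lra.
by move=> ?; lra.
Qed.

Lemma acrN a b f : acr a b f -> acr a b (fun t => - f t).
Proof.
move=> acf e e0; have [d d0 H] := acf e e0; exists d => // m u v uv duv luv.
under eq_bigr do rewrite -opprD normrN; exact: H.
Qed.

Lemma acr_sub a b a' b' f : a <= a' -> b' <= b -> acr a b f -> acr a' b' f.
Proof.
move=> aa bb acf e e0; have [d d0 H] := acf e e0; exists d => // m u v uv.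
apply: H => i; have [? ? ?] := uv i.
by split => //; [exact: le_trans aa _|exact: le_trans bb].
Qed.

(** A limsup equal to [c] bounds the quotients above for all small [s], but below only for some
    arbitrarily small [s]. One such [s] is all that [acr_nonincreasing] asks for, so the Dini
    equation can be used for both [g] and [- g]. *)
Lemma upper_right_dini_freq f t c e d :
  upper_right_dini f t = c%:E -> 0 < e -> 0 < d ->
  (exists s, [/\ 0 < s, s < d & f (t + s) - f t <= (c + e) * s]) /\
  (exists s, [/\ 0 < s, s < d & (c - e) * s <= f (t + s) - f t]).
Proof.
rewrite /upper_right_dini limf_esupE => fc e0 d0; split.
  have : (ereal_inf [set ereal_sup ((fun s : R => ((f (t + s) - f t) / s)%:E) @` V) |
     V in (0 : R)^'+] < (c + e)%:E)%E by rewrite fc lte_fin ltrDl.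
  move/ereal_inf_lt => [_ /= [V V0 <-] Vce].
  have /filter_ex[s [[Vs s0] sd]] : (0 : R)^'+ (V `&` [set s | 0 < s] `&` [set s | s < d]).
    apply: filterI; first apply: filterI => //.
      exact: nbhs_right_gt.
    exact: nbhs_right_lt.
  exists s; split => //; rewrite -ler_pdivrMr // -lee_fin.
  apply: le_trans (ltW Vce); apply: ereal_sup_ubound.
  by exists s.
apply: contrapT => /forallNP H.
have : (ereal_inf [set ereal_sup ((fun s : R => ((f (t + s) - f t) / s)%:E) @` V) |
     V in (0 : R)^'+] <= (c - e)%:E)%E.
  apply: (@le_trans _ _ (ereal_sup ((fun s : R => ((f (t + s) - f t) / s)%:E) @`
     ([set s | 0 < s] `&` [set s | s < d])))).
    apply: ereal_inf_lbound; exists ([set s | 0 < s] `&` [set s | s < d]) => //.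
    apply: filterI; [exact: nbhs_right_gt|exact: nbhs_right_lt].
  apply: ge_ereal_sup => _ [s [/= s0 sd] <-].
  rewrite lee_fin ler_pdivrMr // leNgt; apply/negP => K.
  by apply: (H s); split => //; exact: ltW.
by rewrite fc lee_fin lerBrDr gerDl leNgt e0.
Qed.

Lemma is_derive_eps f t c :
  (forall e, 0 < e -> exists2 d, 0 < d & forall s, `|s| < d ->
     `|f (t + s) - f t - c * s| <= e * `|s|) ->
  is_derive t (1 : R) f c.
Proof.
move=> H.
have K : (fun h : R => h^-1 *: ((f \o shift t) (h *: (1 : R)) - f t)) @ 0^' --> c.
  apply/cvgrPdist_le => /= e e0; have [d d0 Hd] := H e e0.
  exists d => //= s; rewrite /ball /= sub0r normrN => sd s0.
  rewrite distrC -(ler_pM2r (_ : 0 < `|s|)) ?normr_gt0 //.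
  apply: le_trans (Hd s sd); rewrite -normrM /shift /= [s *: 1]mulr1 /GRing.scale /=.
  rewrite le_eqVlt; apply/orP; left; apply/eqP; congr `|_|.
  by rewrite [s + t]addrC; field.
apply: DeriveDef; first by apply/cvg_ex; exists c.
exact/cvg_lim.
Qed.

Lemma is_deriveP f t c : is_derive t (1 : R) f c ->
  forall e, 0 < e -> exists2 d, 0 < d & forall s, `|s| < d ->
     `|f (t + s) - f t - c * s| <= e * `|s|.
Proof.
move=> [dfl dfc] e e0.
have : (fun h : R => h^-1 *: ((f \o shift t) (h *: (1 : R)) - f t)) @ 0^' --> c.
  by move/cvg_ex : dfl => [l Hl]; rewrite -dfc /derive (cvg_lim _ Hl).
move/cvgrPdist_le => /(_ e e0)[d /= d0 Hd]; exists d => // s sd.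
have [->|s0] := eqVneq s 0; first by rewrite addr0 subrr mulr0 subrr normr0 mulr0.
have := Hd s; rewrite /ball /= sub0r normrN => /(_ sd s0).
rewrite distrC -(ler_pM2r (_ : 0 < `|s|)) ?normr_gt0 //.
rewrite -normrM /shift /= [s *: 1]mulr1 /GRing.scale /=.
apply: le_trans; rewrite le_eqVlt; apply/orP; left; apply/eqP; congr `|_|.
by rewrite [s + t]addrC; field.
Qed.

Lemma upper_right_dini_derive f t c :
  is_derive t (1 : R) f c -> upper_right_dini f t = c%:E.
Proof.
move=> /is_deriveP fc; rewrite /upper_right_dini limf_esupE.
apply/eqP; rewrite eq_le; apply/andP; split.
  apply/lee_addgt0Pr => e e0; have [d d0 H] := fc e e0.
  apply: (@le_trans _ _ (ereal_sup ((fun s : R => ((f (t + s) - f t) / s)%:E) @`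
     ([set s | 0 < s] `&` [set s | s < d])))).
    apply: ereal_inf_lbound; exists ([set s | 0 < s] `&` [set s | s < d]) => //.
    apply: filterI; [exact: nbhs_right_gt|exact: nbhs_right_lt].
  apply: ge_ereal_sup => _ [s [/= s0 sd] <-].
  rewrite -EFinD lee_fin ler_pdivrMr //.
  have := H s; rewrite gtr0_norm // => /(_ sd); rewrite ler_norml => /andP[_].
  lra.
apply: le_ereal_inf_tmp => _ [V V0 <-].
apply/lee_addgt0Pr => e e0; have [d d0 H] := fc e e0.
have /filter_ex[s [[Vs s0] sd]] : (0 : R)^'+ (V `&` [set s | 0 < s] `&` [set s | s < d]).
  apply: filterI; first apply: filterI => //.
    exact: nbhs_right_gt.
  exact: nbhs_right_lt.
rewrite -leeBlDr //; apply: (@le_trans _ _ ((f (t + s) - f t) / s)%:E); last first.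
  by apply: ereal_sup_ubound; exists s.
rewrite -EFinB lee_fin ler_pdivlMr //.
have := H s; rewrite gtr0_norm // => /(_ sd); rewrite ler_norml => /andP[+ _].
lra.
Qed.

(* Upgrades the almost everywhere one-sided equations to classical ones.       *)
Lemma acr_is_derive a b g (F : R -> R) (N : set R) t :
  acr a b g -> lebesgue_measure.-negligible N ->
  (forall s, a < s < b -> ~ N s -> upper_right_dini g s = (F s)%:E) ->
  a < t < b -> {for t, continuous F} -> is_derive t (1 : R) g (F t).
Proof.
move=> acg nN HF /andP[at_ tb] cF; apply: is_derive_eps => e e0.
move/cvgrPdist_le : cF => /(_ e e0)[r /= r0 Hr].
pose d := Num.min r (Num.min (t - a) (b - t)).
have d0 : 0 < d by rewrite !lt_min r0 !subr_gt0 at_.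
have main u v : t - d < u -> u <= v -> v < t + d ->
    `|g v - g u - F t * (v - u)| <= e * (v - u).
  move=> tu uv vt.
  have dr : d <= r by rewrite /d ge_min lexx.
  have da : d <= t - a by rewrite /d !ge_min lexx !orbT.
  have db : d <= b - t by rewrite /d !ge_min lexx !orbT.
  have acuv : acr u v g by apply: acr_sub acg; lra.
  have Fs s : u <= s < v -> F t - e <= F s <= F t + e.
    move=> /andP[us sv]; have := Hr s; rewrite /ball /=.
    have -> : `|t - s| < r by rewrite ltr_norml; apply/andP; split; lra.
    by move=> /(_ isT); rewrite ler_distlC; lra.
  rewrite ler_norml; apply/andP; split.
    have : - g v - (- g u) <= (- (F t - e)) * (v - u).
      apply: (@acr_increment_le u v _ (fun t => - g t) N) => //; first exact: acrN.
      move=> s suv Ns e1 d1 e10 d10.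
      have [_ [w [w0 wd H]]] :=
        upper_right_dini_freq (HF s ltac:(lra) Ns) e10 d10.
      exists w; split => //.
      have /andP[H1 _] := Fs s suv.
      have : (F t - e) * w <= F s * w by rewrite ler_wpM2r // ltW.
      lra.
    lra.
  have : g v - g u <= (F t + e) * (v - u).
    apply: (@acr_increment_le u v _ g N) => //.
    move=> s suv Ns e1 d1 e10 d10.
    have [[w [w0 wd H]] _] :=
      upper_right_dini_freq (HF s ltac:(lra) Ns) e10 d10.
    exists w; split => //.
    have /andP[_ H1] := Fs s suv.
    have : F s * w <= (F t + e) * w by rewrite ler_wpM2r // ltW.
    lra.
  lra.
exists d => // s; rewrite ltr_norml => /andP[ds sd].
have [s0|s0] := leP 0 s.
  have := main t (t + s) ltac:(lra) ltac:(lra) ltac:(lra).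
  by rewrite (_ : t + s - t = s) ?(ger0_norm s0) //; ring.
have := main (t + s) t ltac:(lra) ltac:(lra) ltac:(lra).
rewrite (ltr0_norm s0) (_ : t - (t + s) = - s); last by ring.
by rewrite -normrN (_ : - (_ - _) = g (t + s) - g t - F t * s) //; ring.
Qed.

Lemma within_itv_dist a b f t (z : R) :
  {within `[a, b], continuous f} -> a <= t <= b -> 0 < z ->
  exists2 d, 0 < d & forall s, a <= s <= b -> `|s - t| < d -> `|f s - f t| < z.
Proof.
move=> cf atb z0.
have := (@subspace_continuousP R `[a, b]%classic R f).1 cf t.
rewrite /= in_itv /= => /(_ atb) /cvgrPdist_lt /(_ z z0).
rewrite near_withinE => /nbhs_ballP[d /= d0 Hd]; exists d => // s asb std.
rewrite distrC; apply: Hd; first by rewrite /ball /= distrC.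
by rewrite /= in_itv.
Qed.

Lemma acr_within_continuous a b f :
  acr a b f -> {within `[a, b], continuous f}.
Proof.
move=> acf; apply/(@subspace_continuousP R `[a, b]%classic R f) => t.
rewrite /= in_itv /= => atb; apply/cvgrPdist_lt => z z0.
have [d d0 H] := acr_continuous acf z0.
rewrite near_withinE; apply/nbhs_ballP; exists d => //= s.
rewrite /ball /= ltr_norml in_itv /= => std asb.
have [ts|st] := leP t s; last by apply: H; lra.
by rewrite distrC; apply: H; lra.
Qed.

Lemma within_itv_le0 a b f : a < b -> {within `[a, b], continuous f} ->
  (forall t, a < t < b -> f t <= 0) -> forall t, a <= t <= b -> f t <= 0.
Proof.
move=> ab cf fle t atb; apply/ler_addgt0Pr => z z0; rewrite add0r.
have [d d0 H] := within_itv_dist cf atb z0.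
suff [s [asb std]] : exists s, a < s < b /\ `|s - t| < d.
  have := H s ltac:(lra) std; rewrite ltr_norml => /andP[].
  by have := fle s asb; lra.
pose w := Num.min (d / 2) ((b - a) / 4).
have w0 : 0 < w by rewrite lt_min; apply/andP; split; lra.
have wd : w <= d / 2 by rewrite ge_min lexx.
have wb : w <= (b - a) / 4 by rewrite ge_min lexx orbT.
have [tm|tm] := leP t ((a + b) / 2).
  by exists (t + w); rewrite ltr_norml; lra.
by exists (t - w); rewrite ltr_norml; lra.
Qed.

(* Breakpoints [B] are absorbed by letting the bound jump by [e] at each. *)
Lemma joint_barrier a b (B : seq R) g h (e0 : R) :
  a <= b -> 0 < e0 ->
  {within `[a, b], continuous g} -> {within `[a, b], continuous h} ->
  g a <= 0 -> h a <= 0 ->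
  (forall t, a < t < b -> t \notin B -> g t <= e0 -> h t <= e0 ->
     exists2 g', is_derive t (1 : R) g g' & g' <= 0) ->
  (forall t, a < t < b -> t \notin B -> g t <= e0 -> h t <= e0 ->
     exists2 h', is_derive t (1 : R) h h' & h' <= 0) ->
  g b <= 0 /\ h b <= 0.
Proof.
move=> ab e00 cg ch ga ha Hg Hh.
(* The derivative hypotheses hold on the open interval, so the starting point is treated as one more
   breakpoint. *)
pose B' := a :: B.
pose M := (b - a) + (size B').+1%:R.
have M0 : 0 < M by rewrite ltr_wpDl // subr_ge0.
suff key e : 0 < e -> e * M <= e0 -> g b <= e * M /\ h b <= e * M.
  have K x : (forall e, 0 < e -> e * M <= e0 -> x <= e * M) -> x <= 0.
    move=> Hx; apply/ler_addgt0Pr => z z0; rewrite add0r.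
    apply: (@le_trans _ _ (Num.min z e0 / M * M)); last first.
      by rewrite divfK ?gt_eqF // ge_min lexx.
    apply: Hx; first by rewrite divr_gt0 // lt_min z0.
    by rewrite divfK ?gt_eqF // ge_min lexx orbT.
  by split; apply: K => e p q; have [] := key e p q.
move=> e_gt0 eM.
(* The slope [e] makes room for derivatives that are merely nonpositive, and the jump of [e] just
   after a breakpoint makes room for continuity alone. Since [v <= e * M <= e0], the guarded
   hypotheses apply as long as both functions stay below [v]. *)
pose v t := e * ((t - a) + (count (fun x : R => (x < t)%R) B')%:R).
have count_mono t s : t <= s ->
    (count (fun x : R => (x < t)%R) B' <= count (fun x : R => (x < s)%R) B')%N.
  by move=> ts; apply: sub_count => x /= xt; exact: lt_le_trans xt ts.
have vmono t s : t <= s -> v t <= v s - e * (s - t).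
  move=> ts; rewrite /v.
  have := count_mono _ _ ts; rewrite -(ler_nat R) => H.
  have : e * (count (fun x : R => (x < t)%R) B')%:R <= e * (count (fun x : R => (x < s)%R) B')%:R.
    by rewrite ler_wpM2l // ltW.
  lra.
have vM t : t <= b -> v t <= e * M.
  move=> tb; rewrite /v ler_wpM2l //; first exact: ltW.
  apply: lerD; first by lra.
  by rewrite ler_nat (leq_trans (count_size _ _)).
have vjump t s : t < s -> t \in B' -> v t + e <= v s.
  move=> ts tB; rewrite /v.
  have H : ((count (fun x : R => (x < t)%R) B').+1 <= count (fun x : R => (x < s)%R) B')%N.
    elim: (B') tB => // y l IH; rewrite inE => /predU1P[<-|tl] /=.
      rewrite ltxx ts add0n add1n ltnS; apply: sub_count => x /= xt.
      exact: lt_trans xt ts.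
    rewrite -addnS; apply: leq_add; last exact: IH.
    by have [yt|//] := ltP y t; rewrite (lt_trans yt ts).
  move: H; rewrite -(ler_nat R) -natr1 => H.
  have : e * ((count (fun x : R => (x < t)%R) B')%:R + 1) <=
         e * (count (fun x : R => (x < s)%R) B')%:R by rewrite ler_wpM2l // ltW.
  have : e * t <= e * s by rewrite ler_wpM2l // ltW.
  lra.
have hold f t : {within `[a, b], continuous f} -> a < t <= b ->
    (forall d, 0 < d -> exists s, [/\ a <= s, t - d < s, s < t & f s <= v s]) ->
    f t <= v t.
  move=> cf atb H; apply/ler_addgt0Pr => z z0.
  have atb' : a <= t <= b by lra.
  have [d d0 Hd] := within_itv_dist cf atb' z0.
  have [s [as_ ds st fs]] := H d d0.
  have := Hd s ltac:(lra) ltac:(by rewrite ltr_norml; lra).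
  rewrite ltr_norml => /andP[fst _].
  have := vmono s t ltac:(lra).
  have : 0 <= e * (t - s) by rewrite mulr_ge0 //; lra.
  lra.
have step f (f' : R) t : is_derive t (1 : R) f f' -> f' <= 0 -> f t <= v t ->
    exists2 d, 0 < d & forall s, t <= s -> s < t + d -> f s <= v s.
  move=> df f'0 ft; have [d d0 Hd] := is_deriveP df e_gt0.
  exists d => // s ts sd.
  have := Hd (s - t); rewrite (ger0_norm (_ : 0 <= s - t)); last by lra.
  rewrite (_ : t + (s - t) = s); last by ring.
  move=> /(_ ltac:(lra)); rewrite ler_norml => /andP[_].
  have := vmono t s ts.
  have : f' * (s - t) <= 0 by rewrite mulr_le0_ge0 //; lra.
  lra.
have jump f t : {within `[a, b], continuous f} -> a <= t <= b -> t \in B' ->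
    f t <= v t -> exists2 d, 0 < d & forall s, t <= s -> s < t + d -> s <= b -> f s <= v s.
  move=> cf atb tB ft; have [d d0 Hd] := within_itv_dist cf atb e_gt0.
  exists d => // s ts sd sb; have [->//|nst] := eqVneq s t.
  have lts : t < s by rewrite lt_neqAle eq_sym nst.
  have := Hd s ltac:(lra) ltac:(by rewrite ltr_norml; lra).
  rewrite ltr_norml => /andP[_ fst].
  have := vjump t s lts tB.
  lra.
have [gb hb] : g b <= v b /\ h b <= v b; last first.
  by have := vM b (lexx _); split; lra.
apply: (@sup_induction a b (fun t => g t <= v t /\ h t <= v t)) => //.
- have va : 0 <= v a by rewrite /v subrr add0r mulr_ge0 // ltW.
  by split; lra.
- move=> t atb H; split; apply: hold => // d d0.
    by have [s [? ? ? []]] := H d d0; exists s.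
  by have [s [? ? ? []]] := H d d0; exists s.
- move=> t atb [gt_ ht].
  suff [d d0 Hd] : exists2 d, 0 < d & forall s, t <= s -> s < t + d -> s <= b ->
      g s <= v s /\ h s <= v s.
    pose w := Num.min (d / 2) (b - t).
    have w0 : 0 < w by rewrite lt_min; apply/andP; split; lra.
    have wd : w <= d / 2 by rewrite ge_min lexx.
    have wb : w <= b - t by rewrite ge_min lexx orbT.
    by exists (t + w); split; [lra|apply: Hd; lra].
  have [tB|tB] := boolP (t \in B').
    have [d1 d10 H1] := jump g t cg ltac:(lra) tB gt_.
    have [d2 d20 H2] := jump h t ch ltac:(lra) tB ht.
    exists (Num.min d1 d2); first by rewrite lt_min d10.
    move=> s ts; rewrite -ltrBlDl lt_min => /andP[s1 s2] sb.
    by split; [apply: H1|apply: H2] => //; lra.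
  move: tB; rewrite inE negb_or => /andP[ta tB].
  have ht' : a < t < b by rewrite lt_neqAle eq_sym ta; lra.
  have vt := vM t ltac:(lra).
  have [g' dg g'0] := Hg t ht' tB ltac:(lra) ltac:(lra).
  have [h' dh h'0] := Hh t ht' tB ltac:(lra) ltac:(lra).
  have [d1 d10 H1] := step g g' t dg g'0 gt_.
  have [d2 d20 H2] := step h h' t dh h'0 ht.
  exists (Num.min d1 d2); first by rewrite lt_min d10.
  move=> s ts; rewrite -ltrBlDl lt_min => /andP[s1 s2] sb.
  by split; [apply: H1|apply: H2] => //; lra.
Qed.

End RealAnalysis.

(** * The Lyapunov function *)

Section Lyapunov.
Variable R : realType.
Implicit Types (gamma k Lambda mu chi chim e z rho d W Z f w u n om dz D A a b lam x y : R).

Definition energy gamma e1 z := 1 - e1 + z ^+ 2 / (2 * gamma).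

Definition lyap gamma mu e1 e2 z rho :=
  energy gamma e1 z - mu * (e1 * e2 * z) - mu * ((1 - rho) * (e1 * (1 - e1))).

(** The derivative of [lyap] when [eta] rotates at speed [om], [z] has derivative [dz] and [rho] has
    slope [Lambda]; see [lyap_is_derive]. *)
Definition lyap_rate gamma Lambda mu e1 e2 z rho om dz :=
  om * e2 + z * dz / gamma - mu * ((e1 ^+ 2 - e2 ^+ 2) * om * z + e1 * e2 * dz)
  + mu * (Lambda * (e1 * (1 - e1)) + (1 - rho) * (1 - 2 * e1) * (om * e2)).

Lemma unit_coord_le1 e1 e2 : e1 ^+ 2 + e2 ^+ 2 = 1 -> -1 <= e1 <= 1.
Proof.
move=> e; have := sqr_ge0 e2 => H.
by apply/andP; split; nra.
Qed.

Lemma energy_ge gamma e1 e2 z : 0 < gamma -> e1 ^+ 2 + e2 ^+ 2 = 1 ->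
  0 <= 1 - e1 <= energy gamma e1 z /\ z ^+ 2 <= 2 * gamma * energy gamma e1 z.
Proof.
move=> g0 /unit_coord_le1 /andP[e1a e1b]; rewrite /energy.
have := sqr_ge0 z => z2.
have H : 0 <= z ^+ 2 / (2 * gamma) by rewrite divr_ge0 // mulr_ge0 // ltW.
split; first by apply/andP; split; lra.
have -> : 2 * gamma * (1 - e1 + z ^+ 2 / (2 * gamma)) =
  z ^+ 2 + 2 * gamma * (1 - e1) by field; rewrite gt_eqF.
by rewrite lerDl mulr_ge0 ?mulr_ge0 ?subr_ge0 // ltW.
Qed.

(** The two correction terms are at most [mu * (1 + gamma)] and [mu] times the energy, using
    [e2 ^+ 2 <= 2 * (1 - e1)]; the smallness of [mu] makes their sum at most half the energy. *)
Lemma lyap_energy gamma mu e1 e2 z rho :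
  0 < gamma -> 0 <= mu -> mu * (2 + gamma) <= 1 / 2 ->
  e1 ^+ 2 + e2 ^+ 2 = 1 -> 0 <= rho <= 1 ->
  energy gamma e1 z <= 2 * lyap gamma mu e1 e2 z rho /\
  2 * lyap gamma mu e1 e2 z rho <= 3 * energy gamma e1 z.
Proof.
move=> g0 mu0 mug e rho01.
have [/andP[a0 aV] zV] := energy_ge z g0 e.
rewrite /lyap; set V := energy gamma e1 z in aV zV *.
have /andP[e1a e1b] := unit_coord_le1 e.
have H1 : `|e1 * e2 * z| <= (1 + gamma) * V.
  rewrite -mulrA normrM.
  have A : `|e1| <= 1 by rewrite ler_norml e1a.
  have B : `|e2 * z| <= (1 + gamma) * V.
    rewrite ler_norml; have := sqr_ge0 (e2 + z); have := sqr_ge0 (e2 - z).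
    have : e2 ^+ 2 <= 2 * (1 - e1) by nra.
    rewrite !expr2 => *; apply/andP; split; lra.
  by rewrite -[leRHS]mul1r ler_pM.
have H2 : `|(1 - rho) * (e1 * (1 - e1))| <= V.
  rewrite !normrM [X in _ * (_ * X)]ger0_norm //.
  have A : `|e1| <= 1 by rewrite ler_norml e1a.
  have B : `|1 - rho| <= 1 by rewrite ler_norml; lra.
  apply: le_trans aV; rewrite -[leRHS]mul1r ler_pM //.
    by rewrite mulr_ge0.
  by rewrite -[leRHS]mul1r ler_pM.
have V0 : 0 <= V by exact: le_trans aV.
have K1 : `|mu * (e1 * e2 * z)| <= mu * ((1 + gamma) * V).
  by rewrite normrM (ger0_norm mu0) ler_wpM2l.
have K2 : `|mu * ((1 - rho) * (e1 * (1 - e1)))| <= mu * V.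
  by rewrite normrM (ger0_norm mu0) ler_wpM2l.
have K3 : mu * (2 + gamma) * V <= 1 / 2 * V by rewrite ler_wpM2r.
move: K1 K2; rewrite !ler_norml => /andP[? ?] /andP[? ?].
split; lra.
Qed.

(** The energy alone yields only [- k * chi * e2 ^+ 2]. The cross term adds a negative multiple of
    [z ^+ 2] and the clock term a negative multiple of [1 - e1]; both leave remainders in [e2 ^+ 2],
    which the first term absorbs for small [mu]. *)
Lemma lyap_rate_nominal gamma k Lambda mu chi chim e1 e2 z rho lam :
  0 < gamma -> 0 < k -> 0 < Lambda -> 0 <= mu -> 0 < chim -> chim <= chi ->
  e1 ^+ 2 + e2 ^+ 2 = 1 -> 0 <= rho <= 1 ->
  mu * (2 * z ^+ 2 + k ^+ 2 + gamma + 9 + k) <= k / 2 ->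
  mu * Lambda <= chim * k / 2 ->
  2 * lam <= mu * Lambda -> 2 * lam <= mu * (chim * gamma) ->
  lyap_rate gamma Lambda mu e1 e2 z rho (chi * (z - k * e2)) (- (gamma * chi * e2))
    <= - (2 * lam) * energy gamma e1 z.
Proof.
move=> g0 k0 L0 mu0 cm0 cmc e rho01 muk muL lL lg.
have /andP[e1a e1b] := unit_coord_le1 e.
have e22 := sqr_ge0 e2; have z2 := sqr_ge0 z.
pose q := (1 - rho) * (1 - 2 * e1).
have q3 : -1 <= q <= 3 by rewrite /q; apply/andP; split; nra.
(* The part of the rate proportional to [chi], divided by [chi]: once it is bounded by a nonpositive
   quantity, [chi] can be replaced by its lower bound [chim]. *)
pose T := - k * e2 ^+ 2
  + mu * (- (e1 ^+ 2 - e2 ^+ 2) * (z ^+ 2 - k * (e2 * z)) + gamma * e1 * e2 ^+ 2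
          + q * (e2 * z - k * e2 ^+ 2)).
have -> : lyap_rate gamma Lambda mu e1 e2 z rho (chi * (z - k * e2))
    (- (gamma * chi * e2)) = chi * T + mu * Lambda * (e1 * (1 - e1)).
  by rewrite /lyap_rate /T /q; field; rewrite gt_eqF.
have HT : T <= - (k / 2) * e2 ^+ 2 - mu / 2 * z ^+ 2.
  have E : e1 ^+ 2 = 1 - e2 ^+ 2 by lra.
  have h1 : (e1 ^+ 2 - e2 ^+ 2) * (k * (e2 * z)) <= k ^+ 2 * e2 ^+ 2 + z ^+ 2 / 4.
    have c1 : -1 <= e1 ^+ 2 - e2 ^+ 2 <= 1.
      by have := sqr_ge0 e1; lra.
    have H1 := sqr_ge0 (k * e2 - z / 2); have H2 := sqr_ge0 (k * e2 + z / 2).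
    set c := e1 ^+ 2 - e2 ^+ 2 in c1 *; set y := k * (e2 * z).
    have : c * y <= `|y|.
      apply: (le_trans (ler_norm _)); rewrite normrM -[leRHS]mul1r ler_pM //.
      by rewrite ler_norml.
    have : `|y| <= k ^+ 2 * e2 ^+ 2 + z ^+ 2 / 4.
      by rewrite ler_norml /y; apply/andP; split; nra.
    by move=> yy cy; exact: le_trans cy yy.
  have h2 : q * (e2 * z) <= 9 * e2 ^+ 2 + z ^+ 2 / 4.
    have H1 := sqr_ge0 (3 * e2 - z / 2); have H2 := sqr_ge0 (3 * e2 + z / 2).
    have [y0|y0] := leP 0 (e2 * z); first by nra.
    by nra.
  have h3 : - q * (k * e2 ^+ 2) <= k * e2 ^+ 2.
    rewrite -[leRHS]mul1r ler_wpM2r //; last by lra.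
    by rewrite mulr_ge0 // ltW.
  have h4 : gamma * e1 * e2 ^+ 2 <= gamma * e2 ^+ 2.
    by rewrite ler_wpM2r // ger_pMr.
  have h5 : - (e1 ^+ 2 - e2 ^+ 2) * z ^+ 2 = - z ^+ 2 + 2 * z ^+ 2 * e2 ^+ 2.
    by rewrite E; ring.
  have h6 : - (e1 ^+ 2 - e2 ^+ 2) * (z ^+ 2 - k * (e2 * z)) + gamma * e1 * e2 ^+ 2
          + q * (e2 * z - k * e2 ^+ 2) <=
      (2 * z ^+ 2 + k ^+ 2 + gamma + 9 + k) * e2 ^+ 2 - z ^+ 2 / 2.
    rewrite !mulrBr h5; lra.
  have h7 := ler_wpM2l mu0 h6.
  have h8 := ler_wpM2r e22 muk.
  rewrite /T; lra.
have chi0 : 0 < chi by exact: lt_le_trans cmc.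
have S0 : 0 <= k / 2 * e2 ^+ 2 + mu / 2 * z ^+ 2.
  by rewrite addr_ge0 // mulr_ge0 // ?divr_ge0 // ltW.
have H1 := ler_wpM2l (ltW chi0) HT.
have H2 := ler_wpM2r S0 cmc.
have H3 := ler_wpM2r e22 muL.
have e1' : 0 <= 1 - e1 by lra.
have H4 := ler_wpM2r e1' lL.
have H5 : 2 * lam * (z ^+ 2 / (2 * gamma)) <= mu * (chim * gamma) * (z ^+ 2 / (2 * gamma)).
  by rewrite ler_wpM2r // divr_ge0 // mulr_ge0 // ltW.
have H6 : mu * (chim * gamma) * (z ^+ 2 / (2 * gamma)) = chim * (mu / 2 * z ^+ 2).
  by field; rewrite gt_eqF.
(* The source of decay at the spurious equilibrium [(-1, 0)], where [e2] vanishes while [1 - e1]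
   equals 2. *)
have H7 : mu * Lambda * (e1 * (1 - e1)) = mu * Lambda * e2 ^+ 2 - mu * Lambda * (1 - e1).
  have -> : e2 ^+ 2 = 1 - e1 ^+ 2 by lra.
  by ring.
rewrite /energy; lra.
Qed.

(** The rate is affine in [om] and [dz], with coefficients bounded by [4 + Z] and
    [Z / gamma + 1]. *)
Lemma lyap_rate_perturb gamma Lambda mu e1 e2 z rho om dz d1 d2 D1 D2 Z :
  0 < gamma -> 0 <= mu <= 1 -> e1 ^+ 2 + e2 ^+ 2 = 1 -> 0 <= rho <= 1 ->
  `|z| <= Z -> `|d1| <= D1 -> `|d2| <= D2 ->
  lyap_rate gamma Lambda mu e1 e2 z rho (om + d1) (dz + d2) <=
  lyap_rate gamma Lambda mu e1 e2 z rho om dz + D1 * (4 + Z) + D2 * (Z / gamma + 1).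
Proof.
move=> g0 /andP[mu0 mu1] e rho01 zZ dD1 dD2.
have /andP[e1a e1b] := unit_coord_le1 e.
have /andP[e2a e2b] : -1 <= e2 <= 1 by apply: (@unit_coord_le1 _ e1); rewrite addrC.
have -> : lyap_rate gamma Lambda mu e1 e2 z rho (om + d1) (dz + d2) =
  lyap_rate gamma Lambda mu e1 e2 z rho om dz
  + d1 * (e2 - mu * ((e1 ^+ 2 - e2 ^+ 2) * z) + mu * ((1 - rho) * (1 - 2 * e1) * e2))
  + d2 * (z / gamma - mu * (e1 * e2)).
  by rewrite /lyap_rate; field; rewrite gt_eqF.
have n1 x y (X Y : R) : `|x| <= X -> `|y| <= Y -> `|x * y| <= X * Y.
  by move=> hx hy; rewrite normrM ler_pM.
have Ne1 : `|e1| <= 1 by rewrite ler_norml e1a.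
have Ne2 : `|e2| <= 1 by rewrite ler_norml e2a.
have Nmu : `|mu| <= 1 by rewrite ger0_norm.
have Nr : `|1 - rho| <= 1 by rewrite ler_norml; lra.
have Nd : `|e1 ^+ 2 - e2 ^+ 2| <= 1.
  by rewrite ler_norml; have := sqr_ge0 e1; have := sqr_ge0 e2; lra.
have N3 : `|1 - 2 * e1| <= 3 by rewrite ler_norml; lra.
have B1 : `|e2 - mu * ((e1 ^+ 2 - e2 ^+ 2) * z) + mu * ((1 - rho) * (1 - 2 * e1) * e2)|
    <= 4 + Z.
  apply: (le_trans (ler_normD _ _)).
  have := ler_normB e2 (mu * ((e1 ^+ 2 - e2 ^+ 2) * z)).
  have := n1 _ _ _ _ Nmu (n1 _ _ _ _ Nd zZ).
  have := n1 _ _ _ _ Nmu (n1 _ _ _ _ (n1 _ _ _ _ Nr N3) Ne2).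
  lra.
have B2 : `|z / gamma - mu * (e1 * e2)| <= Z / gamma + 1.
  apply: (le_trans (ler_normB _ _)).
  have := n1 _ _ _ _ Nmu (n1 _ _ _ _ Ne1 Ne2).
  have : `|z / gamma| <= Z / gamma.
    by rewrite normrM [`|gamma^-1|]gtr0_norm ?invr_gt0 // ler_pM2r ?invr_gt0.
  lra.
have := le_trans (ler_norm _) (n1 _ _ _ _ dD1 B1).
have := le_trans (ler_norm _) (n1 _ _ _ _ dD2 B2).
lra.
Qed.

(** A jump that leaves [eta] unchanged only switches on the clock term, which has the wrong sign for
    negative [e1], hence by O(W). *)
Lemma lyap_jump_id gamma mu e1 e2 z W : 0 <= mu <= 1 ->
  e1 ^+ 2 + e2 ^+ 2 = 1 -> 0 <= W -> - W <= e1 ->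
  lyap gamma mu e1 e2 z 0 <= lyap gamma mu e1 e2 z 1 + 2 * W.
Proof.
move=> /andP[mu0 mu1] /unit_coord_le1 /andP[e1a e1b] W0 We1; rewrite /lyap.
suff : - (mu * (e1 * (1 - e1))) <= 2 * W by lra.
have [e10|e10] := leP 0 e1.
  have : 0 <= mu * (e1 * (1 - e1)) by rewrite !mulr_ge0 // subr_ge0.
  lra.
have : mu * (- e1 * (1 - e1)) <= 1 * (- e1 * (1 - e1)).
  by rewrite ler_wpM2r // mulr_ge0 //; lra.
have : - e1 * (1 - e1) <= - e1 * 2 by rewrite ler_wpM2l //; lra.
lra.
Qed.

(** For the exact reflection [f = (- e1, e2)] the change is [e1] times a factor between 1 and 5,
    hence at most [5 * W]; the deviations [a] and [b] from the reflection cost at most [5 * A]. *)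
Lemma lyap_jump_flip gamma mu e1 e2 f1 f2 z W A : 0 <= mu <= 1 ->
  e1 ^+ 2 + e2 ^+ 2 = 1 -> f1 ^+ 2 + f2 ^+ 2 = 1 -> mu * `|z| <= 1 / 2 ->
  0 <= W -> e1 <= W -> `|f1 + e1| <= A -> `|f2 - e2| <= A ->
  lyap gamma mu f1 f2 z 0 <= lyap gamma mu e1 e2 z 1 + 5 * W + 5 * A.
Proof.
move=> /andP[mu0 mu1] e f muz W0 We1 aA bA.
have /andP[e1a e1b] := unit_coord_le1 e.
have /andP[e2a e2b] : -1 <= e2 <= 1 by apply: (@unit_coord_le1 _ e1); rewrite addrC.
have /andP[f1a f1b] := unit_coord_le1 f.
have /andP[f2a f2b] : -1 <= f2 <= 1 by apply: (@unit_coord_le1 _ f1); rewrite addrC.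
pose a := f1 + e1; pose b := f2 - e2.
have -> : lyap gamma mu f1 f2 z 0 = lyap gamma mu e1 e2 z 1
   + e1 * (2 + 2 * (mu * z * e2) + mu * (1 + e1))
   - a - mu * z * (a * f2 - e1 * b) - mu * (a * (1 + e1 - f1)).
  by rewrite /lyap /energy /a /b; ring.
have n1 x y (X Y : R) : `|x| <= X -> `|y| <= Y -> `|x * y| <= X * Y.
  by move=> hx hy; rewrite normrM ler_pM.
have Nmz : `|mu * z| <= 1 / 2 by rewrite normrM (ger0_norm mu0).
have Nmu : `|mu| <= 1 by rewrite ger0_norm.
have Ne2 : `|e2| <= 1 by rewrite ler_norml e2a.
have Ne1 : `|e1| <= 1 by rewrite ler_norml e1a.
have Nf2 : `|f2| <= 1 by rewrite ler_norml f2a.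
have A0 : 0 <= A by exact: le_trans aA.
have T1 : e1 * (2 + 2 * (mu * z * e2) + mu * (1 + e1)) <= 5 * W.
  have := n1 _ _ _ _ Nmz Ne2; rewrite ler_norml => /andP[p1 p2].
  have q1 : 0 <= mu * (1 + e1) by rewrite mulr_ge0 //; lra.
  have q2 : mu * (1 + e1) <= 1 * 2 by rewrite ler_pM //; lra.
  have [e10|e10] := leP 0 e1.
    by rewrite [leRHS]mulrC ler_pM //; lra.
  have : e1 * (2 + 2 * (mu * z * e2) + mu * (1 + e1)) <= 0.
    by rewrite mulr_le0_ge0 //; lra.
  lra.
have N1 : `|a * f2 - e1 * b| <= 2 * A.
  apply: (le_trans (ler_normB _ _)).
  have := n1 _ _ _ _ aA Nf2; have := n1 _ _ _ _ Ne1 bA.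
  by rewrite /a /b; lra.
have := n1 _ _ _ _ Nmz N1; rewrite ler_norml => /andP[p1 p2].
have N2 : `|1 + e1 - f1| <= 3 by rewrite ler_norml; lra.
have := n1 _ _ _ _ Nmu (n1 _ _ _ _ aA N2); rewrite ler_norml -/a => /andP[p3 p4].
move: aA; rewrite ler_norml -/a => /andP[p5 p6].
lra.
Qed.

(* Read the planar vectors as complex numbers: [n u = conj(i hh)] with         *)
(* [hh = - i chi eta - w], so that [u] is close to [conj eta] and the new      *)
(* state [- u^2 eta] is close to [- conj eta].                                 *)
Lemma flip_estimate chi e1 e2 w1 w2 n u1 u2 W :
  0 < chi -> 0 <= n -> e1 ^+ 2 + e2 ^+ 2 = 1 -> u1 ^+ 2 + u2 ^+ 2 = 1 ->
  n * u1 = chi * e1 + w2 -> n * u2 = w1 - chi * e2 ->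
  w1 ^+ 2 + w2 ^+ 2 <= W ^+ 2 -> 0 <= W ->
  let f1 := - ((u1 ^+ 2 - u2 ^+ 2) * e1 - 2 * u1 * u2 * e2) in
  let f2 := - ((u1 ^+ 2 - u2 ^+ 2) * e2 + 2 * u1 * u2 * e1) in
  [/\ f1 ^+ 2 + f2 ^+ 2 = 1, `|f1 + e1| <= 4 * W / chi & `|f2 - e2| <= 4 * W / chi].
Proof.
move=> chi0 n0 e u E1 E2 w W0 f1 f2.
have w2E : w2 = n * u1 - chi * e1 by rewrite E1; ring.
have w1E : w1 = n * u2 + chi * e2 by rewrite E2; ring.
have nchi : (n - chi) ^+ 2 <= W ^+ 2.
  apply: le_trans w; rewrite w1E w2E.
  have -> : (n * u2 + chi * e2) ^+ 2 + (n * u1 - chi * e1) ^+ 2 =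
    n ^+ 2 * (u1 ^+ 2 + u2 ^+ 2) + chi ^+ 2 * (e1 ^+ 2 + e2 ^+ 2)
    - 2 * (n * chi) * (u1 * e1 - u2 * e2) by ring.
  rewrite u e.
  have c1 : u1 * e1 - u2 * e2 <= 1.
    by have := sqr_ge0 (u1 - e1); have := sqr_ge0 (u2 + e2); nra.
  have := ler_wpM2l (mulr_ge0 n0 (ltW chi0)) c1; lra.
have p2 : chi ^+ 2 * ((u1 - e1) ^+ 2 + (u2 + e2) ^+ 2) <= 4 * W ^+ 2.
  have -> : chi ^+ 2 * ((u1 - e1) ^+ 2 + (u2 + e2) ^+ 2) =
    2 * (n - chi) ^+ 2 * (u1 ^+ 2 + u2 ^+ 2) + 2 * (w1 ^+ 2 + w2 ^+ 2)
    - (((chi - n) * u1 - w2) ^+ 2 + ((chi - n) * u2 - w1) ^+ 2).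
    by rewrite w1E w2E; ring.
  rewrite u; have := sqr_ge0 ((chi - n) * u1 - w2).
  have := sqr_ge0 ((chi - n) * u2 - w1); lra.
have fu : f1 ^+ 2 + f2 ^+ 2 = 1.
  have -> : f1 ^+ 2 + f2 ^+ 2 = (u1 ^+ 2 + u2 ^+ 2) ^+ 2 * (e1 ^+ 2 + e2 ^+ 2).
    by rewrite /f1 /f2; ring.
  by rewrite u e expr1n mulr1.
(* For unit [e], the modulus of [f + conj e] is that of [(u - conj e) * (u + conj e)]: the first
   factor is at most [2 * W / chi] by [p2], the second at most 2. *)
have fe : chi ^+ 2 * ((f1 + e1) ^+ 2 + (f2 - e2) ^+ 2) <= (4 * W) ^+ 2.
  have -> : (f1 + e1) ^+ 2 + (f2 - e2) ^+ 2 =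
    ((u1 - e1) ^+ 2 + (u2 + e2) ^+ 2) * ((u1 + e1) ^+ 2 + (u2 - e2) ^+ 2).
    have -> : (f1 + e1) ^+ 2 + (f2 - e2) ^+ 2 =
      (f1 + e1 * (e1 ^+ 2 + e2 ^+ 2)) ^+ 2 + (f2 - e2 * (e1 ^+ 2 + e2 ^+ 2)) ^+ 2.
      by rewrite e !mulr1.
    transitivity (((u1 - e1) ^+ 2 + (u2 + e2) ^+ 2) *
      ((u1 + e1) ^+ 2 + (u2 - e2) ^+ 2) * (e1 ^+ 2 + e2 ^+ 2)).
      by rewrite /f1 /f2; ring.
    by rewrite e mulr1.
  have s4 : (u1 + e1) ^+ 2 + (u2 - e2) ^+ 2 <= 4.
    have := sqr_ge0 (u1 - e1); have := sqr_ge0 (u2 + e2); lra.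
  rewrite mulrA; apply: (@le_trans _ _ (4 * W ^+ 2 * 4)); last by lra.
  apply: ler_pM => //; last by rewrite addr_ge0 ?sqr_ge0.
  by rewrite mulr_ge0 ?sqr_ge0 // addr_ge0 ?sqr_ge0.
have main x : chi ^+ 2 * x ^+ 2 <= (4 * W) ^+ 2 -> `|x| <= 4 * W / chi.
  move=> H; rewrite ler_pdivlMr // -(ger0_norm (ltW chi0)) -normrM.
  have W4 : 0 <= 4 * W by rewrite mulr_ge0.
  rewrite -(ger0_norm W4) -ler_sqr ?nnegrE // !real_normK ?num_real //.
  by rewrite exprMn mulrC.
split => //; apply: main; apply: le_trans fe; rewrite ler_wpM2l ?sqr_ge0 //.
  by rewrite lerDl sqr_ge0.
by rewrite lerDr sqr_ge0.
Qed.

End Lyapunov.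

(** * Estimates along flows *)

Section Pointwise.
Variable R : realType.
Implicit Types (gamma k Lambda mu chi chim e z rho d W Z f w u n om dz D A a b lam x y : R).

(** The speed [chi * xi - hat_omega] of [eta], as a function of the back-EMF error [w]; see
    [frame_rateE]. *)
Definition frame_rate k xi chi e1 e2 z w1 w2 : R :=
  chi * xi - (Num.sqrt ((chi * e2 - w1) ^+ 2 + (- (chi * e1) - w2) ^+ 2) * (xi - z)
              + k * (chi * e2 - w1)).

Lemma normr_le_sqr x y : 0 <= y -> x ^+ 2 <= y ^+ 2 -> `|x| <= y.
Proof.
move=> y0 H; rewrite -(ger0_norm y0) -ler_sqr ?nnegrE //.
by rewrite !real_normK ?num_real.
Qed.

(** Reverse triangle inequality: the true back-EMF has norm [chi] and its estimate differs from it
    by [w]. *)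
Lemma sqrt_dist_le chi e1 e2 w1 w2 W : 0 <= chi -> 0 <= W ->
  e1 ^+ 2 + e2 ^+ 2 = 1 -> w1 ^+ 2 + w2 ^+ 2 <= W ^+ 2 ->
  `|chi - Num.sqrt ((chi * e2 - w1) ^+ 2 + (- (chi * e1) - w2) ^+ 2)| <= W.
Proof.
move=> chi0 W0 e w; apply: normr_le_sqr => //; apply: le_trans w.
set h1 := chi * e2 - w1; set h2 := - (chi * e1) - w2.
have S0 : 0 <= h1 ^+ 2 + h2 ^+ 2 by rewrite addr_ge0 ?sqr_ge0.
set n := Num.sqrt _; have n0 : 0 <= n by exact: sqrtr_ge0.
have n2 : n ^+ 2 = h1 ^+ 2 + h2 ^+ 2 by rewrite sqr_sqrtr.
have dot : e2 * h1 - e1 * h2 <= n.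
  apply: (le_trans (ler_norm _)); apply: normr_le_sqr => //.
  rewrite n2 -[leRHS]mul1r -e.
  have := sqr_ge0 (e2 * h2 + e1 * h1); rewrite -subr_ge0 => H.
  rewrite -subr_ge0.
  have -> : (e1 ^+ 2 + e2 ^+ 2) * (h1 ^+ 2 + h2 ^+ 2) - (e2 * h1 - e1 * h2) ^+ 2 =
    (e2 * h2 + e1 * h1) ^+ 2 by ring.
  exact: sqr_ge0.
have -> : w1 ^+ 2 + w2 ^+ 2 = n ^+ 2 + chi ^+ 2 * (e1 ^+ 2 + e2 ^+ 2)
    - 2 * (chi * (e2 * h1 - e1 * h2)).
  by rewrite n2 /h1 /h2; ring.
rewrite e; have := ler_wpM2l chi0 dot; lra.
Qed.

Lemma frame_rate_dist k xi chi e1 e2 z w1 w2 W Z : 0 < k -> 0 <= chi -> 0 <= W ->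
  e1 ^+ 2 + e2 ^+ 2 = 1 -> w1 ^+ 2 + w2 ^+ 2 <= W ^+ 2 -> `|z| <= Z ->
  exists d1, frame_rate k xi chi e1 e2 z w1 w2 = chi * (z - k * e2) + d1 /\
    `|d1| <= W * (`|xi| + Z + k).
Proof.
move=> k0 chi0 W0 e w zZ.
have H := sqrt_dist_le chi0 W0 e w.
rewrite /frame_rate; set n := Num.sqrt _ in H *.
exists ((chi - n) * (xi - z) + k * w1); split; first by ring.
have w1W : `|w1| <= W.
  by apply: normr_le_sqr => //; apply: le_trans w; rewrite lerDl sqr_ge0.
apply: (le_trans (ler_normD _ _)); rewrite !normrM (gtr0_norm k0) mulrDr.
apply: lerD; last by rewrite mulrC ler_wpM2r // ltW.
by apply: ler_pM => //; apply: (le_trans (ler_normB _ _)); rewrite lerD2l.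
Qed.

Definition sqnorm4 x1 x2 x3 x4 := x1 ^+ 2 + x2 ^+ 2 + x3 ^+ 2 + x4 ^+ 2.

(** The left side is [r' + (r - 2 * th) / eps], where [r] is a version of the norm of [x_f] that
    remains differentiable at 0. The couplings between the two blocks cancel in the derivative of
    the squared norm, and [th = eps * M1] balances the input against the decay. *)
Lemma fast_pointwise (L eps M1 th r : R) x1 x2 x3 x4 f1 f2 :
  0 < L -> 0 < eps -> 0 < M1 -> f1 ^+ 2 + f2 ^+ 2 <= (L * M1) ^+ 2 ->
  th = eps * M1 -> r = Num.sqrt (sqnorm4 x1 x2 x3 x4 + th ^+ 2) ->
  (2 * r)^-1 * (2 * (x1 * ((x3 - x1) / eps) + x2 * ((x4 - x2) / eps)
     + x3 * ((- x1 - x3) / eps + f1 / L) + x4 * ((- x2 - x4) / eps + f2 / L)))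
  + (r - 2 * th) / eps <= 0.
Proof.
move=> L0 eps0 M10 f thE rE; set N := sqnorm4 x1 x2 x3 x4 in rE.
have N0 : 0 <= N by rewrite /N /sqnorm4 !addr_ge0 ?sqr_ge0.
have th0 : 0 < th by rewrite thE mulr_gt0.
have r2 : r ^+ 2 = N + th ^+ 2 by rewrite rE sqr_sqrtr // addr_ge0 ?sqr_ge0.
have rth : th <= r.
  rewrite -[th]ger0_norm ?(ltW th0) //; apply: normr_le_sqr; first by rewrite rE sqrtr_ge0.
  by rewrite r2 lerDr.
have r0 : 0 < r by exact: lt_le_trans rth.
have dot : x3 * f1 + x4 * f2 <= r * (L * M1).
  have LM0 : 0 < L * M1 by rewrite mulr_gt0.
  apply: (le_trans (ler_norm _)); apply: normr_le_sqr; first by rewrite mulr_ge0 // ltW.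
  rewrite exprMn r2; apply: (@le_trans _ _ ((x3 ^+ 2 + x4 ^+ 2) * (f1 ^+ 2 + f2 ^+ 2))).
    rewrite -subr_ge0 (_ : _ - _ = (x3 * f2 - x4 * f1) ^+ 2); last by ring.
    exact: sqr_ge0.
  apply: ler_pM => //; try by rewrite addr_ge0 ?sqr_ge0.
  have := sqr_ge0 x1; have := sqr_ge0 x2; have := sqr_ge0 th.
  by rewrite /N /sqnorm4; lra.
have -> : 2 * (x1 * ((x3 - x1) / eps) + x2 * ((x4 - x2) / eps)
     + x3 * ((- x1 - x3) / eps + f1 / L) + x4 * ((- x2 - x4) / eps + f2 / L))
   = 2 * (- N / eps + (x3 * f1 + x4 * f2) / L).
  by rewrite /N /sqnorm4; field; rewrite !gt_eqF.
have dot' : (x3 * f1 + x4 * f2) / L <= r * M1.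
  by rewrite ler_pdivrMr //; apply: (le_trans dot); rewrite -mulrA [M1 * L]mulrC.
have -> : (2 * r)^-1 * (2 * (- N / eps + (x3 * f1 + x4 * f2) / L)) + (r - 2 * th) / eps
  = ((th - r) * M1 + ((x3 * f1 + x4 * f2) / L - r * M1)) / r.
  have -> : N = r ^+ 2 - th ^+ 2 by rewrite r2; ring.
  by rewrite thE; field; rewrite !gt_eqF.
rewrite pmulr_lle0 ?invr_gt0 //.
have : (th - r) * M1 <= 0 by rewrite mulr_le0_ge0 // ?subr_le0 // ltW.
lra.
Qed.

(** The two parts of [f_h] are along the orthogonal unit vectors [J eta] and [eta], so their squares
    add. *)
Lemma fast_input_bound k xi chi dchi chiM dM e1 e2 z w1 w2 W Z B :
  0 < k -> 0 <= chi <= chiM -> `|dchi| <= dM -> 0 <= W ->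
  e1 ^+ 2 + e2 ^+ 2 = 1 -> w1 ^+ 2 + w2 ^+ 2 <= W ^+ 2 -> `|z| <= Z ->
  dM + chiM * (chiM * (Z + k) + W * (`|xi| + Z + k)) <= B ->
  (dchi * e2 + chi * frame_rate k xi chi e1 e2 z w1 w2 * e1) ^+ 2 +
  (- (dchi * e1) + chi * frame_rate k xi chi e1 e2 z w1 w2 * e2) ^+ 2 <= B ^+ 2.
Proof.
move=> k0 /andP[chi0 chiM_] dd W0 e w zZ HB.
have [d1 [-> d1W]] := frame_rate_dist xi k0 chi0 W0 e w zZ.
set Om := chi * (z - k * e2) + d1.
have e2a : `|e2| <= 1.
  apply: normr_le_sqr => //; rewrite expr1n.
  by have := sqr_ge0 e1; lra.
have Z0 : 0 <= Z by exact: le_trans zZ.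
have OmB : `|Om| <= chiM * (Z + k) + W * (`|xi| + Z + k).
  apply: (le_trans (ler_normD _ _)); apply: lerD => //; rewrite normrM.
  apply: ler_pM => //; first by rewrite ger0_norm.
  apply: (le_trans (ler_normB _ _)); apply: lerD => //.
  by rewrite normrM (gtr0_norm k0) ger_pMr.
have cO : `|chi * Om| <= chiM * (chiM * (Z + k) + W * (`|xi| + Z + k)).
  by rewrite normrM; apply: ler_pM => //; rewrite ger0_norm.
have -> : (dchi * e2 + chi * Om * e1) ^+ 2 + (- (dchi * e1) + chi * Om * e2) ^+ 2
  = dchi ^+ 2 * (e1 ^+ 2 + e2 ^+ 2) + (chi * Om) ^+ 2 * (e1 ^+ 2 + e2 ^+ 2) by ring.
rewrite e !mulr1.
have A1 : dchi ^+ 2 <= dM ^+ 2.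
  by rewrite -[dchi ^+ 2]real_normK ?num_real // ler_pXn2r // ?nnegrE // (le_trans _ dd).
set y := chi * Om in cO *; set Y := chiM * _ in cO HB.
have A2 : y ^+ 2 <= Y ^+ 2.
  by rewrite -[y ^+ 2]real_normK ?num_real // ler_pXn2r // ?nnegrE // (le_trans _ cO).
have dM0 : 0 <= dM by exact: le_trans dd.
have Y0 : 0 <= Y by exact: le_trans cO.
have : (dM + Y) ^+ 2 <= B ^+ 2 by rewrite ler_pXn2r // nnegrE; lra.
have := mulr_ge0 dM0 Y0; rewrite sqrrD; lra.
Qed.

Lemma slow_pointwise gamma k Lambda mu chi chim xi e1 e2 z rho lam w1 w2 W Z Rv C D :
  0 < gamma -> 0 < k -> 0 < Lambda -> 0 <= mu <= 1 -> 0 < chim -> chim <= chi ->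
  e1 ^+ 2 + e2 ^+ 2 = 1 -> 0 <= rho <= 1 ->
  mu * (4 * gamma * Rv + k ^+ 2 + gamma + 9 + k) <= k / 2 ->
  mu * Lambda <= chim * k / 2 ->
  2 * lam <= mu * Lambda -> 2 * lam <= mu * (chim * gamma) ->
  energy gamma e1 z <= Rv -> 0 <= Z -> 2 * gamma * Rv <= Z ^+ 2 ->
  0 <= W -> w1 ^+ 2 + w2 ^+ 2 <= W ^+ 2 ->
  (`|xi| + Z + k) * (4 + Z) + gamma * (Z / gamma + 1) <= C -> W * C <= D ->
  lyap_rate gamma Lambda mu e1 e2 z rho (frame_rate k xi chi e1 e2 z w1 w2)
     (- (gamma * (chi * e2 - w1))) <= - (2 * lam) * energy gamma e1 z + D.
Proof.
move=> g0 k0 L0 /andP[mu0 mu1] cm0 cmc e rho01 muk muL lL lg VR Z0 ZR W0 w HC HD.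
have [_ z2] := energy_ge z g0 e.
have z2R : z ^+ 2 <= 2 * gamma * Rv.
  by apply: (le_trans z2); rewrite ler_wpM2l // mulr_ge0 // ltW.
have zZ : `|z| <= Z by apply: normr_le_sqr => //; exact: le_trans ZR.
have chi0 : 0 <= chi by apply: le_trans cmc; exact: ltW.
have [d1 [-> d1W]] := frame_rate_dist xi k0 chi0 W0 e w zZ.
have w1W : `|w1| <= W.
  by apply: normr_le_sqr => //; apply: le_trans w; rewrite lerDl sqr_ge0.
have -> : - (gamma * (chi * e2 - w1)) = - (gamma * chi * e2) + gamma * w1 by ring.
have d2W : `|gamma * w1| <= gamma * W.
  by rewrite normrM (gtr0_norm g0) ler_wpM2l // ltW.
have mu01 : 0 <= mu <= 1 by rewrite mu0.
apply: (le_trans (lyap_rate_perturb Lambda _ _ g0 mu01 e rho01 zZ d1W d2W)).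
have := @lyap_rate_nominal R gamma k Lambda mu chi chim e1 e2 z rho lam
  g0 k0 L0 mu0 cm0 cmc e rho01 _ muL lL lg.
have muk' : mu * (2 * z ^+ 2 + k ^+ 2 + gamma + 9 + k) <= k / 2.
  by apply: le_trans muk; rewrite ler_wpM2l //; lra.
move=> /(_ muk').
have := ler_wpM2l W0 HC; lra.
Qed.

End Pointwise.

(** * Differentiation and continuity rules for real functions *)

Section Calculus.
Variable R : realType.
Implicit Types (f g : R -> R) (t a b : R) (A : set R).

Lemma is_deriveD1 f g t a b : is_derive t (1 : R) f a -> is_derive t (1 : R) g b ->
  is_derive t (1 : R) (fun s => f s + g s) (a + b).
Proof. exact: is_deriveD. Qed.

Lemma is_deriveB1 f g t a b : is_derive t (1 : R) f a -> is_derive t (1 : R) g b ->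
  is_derive t (1 : R) (fun s => f s - g s) (a - b).
Proof. exact: is_deriveB. Qed.

Lemma is_deriveM1 f g t a b : is_derive t (1 : R) f a -> is_derive t (1 : R) g b ->
  is_derive t (1 : R) (fun s => f s * g s) (f t * b + g t * a).
Proof. exact: is_deriveM. Qed.

Lemma is_derive_cst1 c t : is_derive t (1 : R) (fun=> c) (0 : R).
Proof. exact: is_derive_cst. Qed.

Lemma is_derive_sqrt1 f t a : 0 < f t -> is_derive t (1 : R) f a ->
  is_derive t (1 : R) (fun s => Num.sqrt (f s)) ((2 * Num.sqrt (f t))^-1 * a).
Proof.
move=> f0 df; apply: (@is_derive1_comp R (@Num.sqrt R) f) => //.
exact: is_derive1_sqrt.
Qed.

Lemma is_derive_exp1 c t :
  is_derive t (1 : R) (fun s => expR (c * s)) (expR (c * t) * c).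
Proof.
apply: (@is_derive1_comp R (@expR R) (fun s => c * s)).
have : is_derive t (1 : R) (fun s => c * s) (c * 1 + t * 0).
  exact: (is_deriveM1 (is_derive_cst1 c t) (is_derive_id t (1 : R))).
by rewrite mulr0 addr0 mulr1.
Qed.

Lemma within_continuousD1 A f g : {within A, continuous f} ->
  {within A, continuous g} -> {within A, continuous (fun s => f s + g s)}.
Proof. by move=> cf cg x; apply: continuousD; [exact: cf|exact: cg]. Qed.

Lemma within_continuousB1 A f g : {within A, continuous f} ->
  {within A, continuous g} -> {within A, continuous (fun s => f s - g s)}.
Proof. by move=> cf cg x; apply: continuousB; [exact: cf|exact: cg]. Qed.

Lemma within_continuousM1 A f g : {within A, continuous f} ->
  {within A, continuous g} -> {within A, continuous (fun s => f s * g s)}.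
Proof. by move=> cf cg x; apply: continuousM; [exact: cf|exact: cg]. Qed.

Lemma within_continuous_comp1 A f (g : R -> R) : {within A, continuous f} ->
  continuous g -> {within A, continuous (fun s => g (f s))}.
Proof. by move=> cf cg x; apply: continuous_comp; [exact: cf|exact: cg]. Qed.

Lemma within_continuous_cst1 A c : {within A, continuous (fun _ : R => c : R)}.
Proof. by apply: continuous_subspaceT => x; exact: cst_continuous. Qed.

Lemma within_continuous_exp1 A c : {within A, continuous (fun s : R => expR (c * s))}.
Proof.
apply: continuous_subspaceT => x; apply: continuous_comp; last exact: continuous_expR.
exact: mulrl_continuous.
Qed.

Lemma is_derive_sqr1 f t a : is_derive t (1 : R) f a ->
  is_derive t (1 : R) (fun s => f s ^+ 2) (2 * (f t * a)).
Proof.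
move=> df; rewrite mulr2n mulrDl mul1r.
exact: (is_deriveM1 df df).
Qed.

Lemma within_continuous_sqr1 A f : {within A, continuous f} ->
  {within A, continuous (fun s => f s ^+ 2)}.
Proof. by move=> cf; exact: (within_continuousM1 cf cf). Qed.

Lemma lyap_is_derive (gamma mu Lambda om dz t : R) (e1 e2 z rho : R -> R) :
  0 < gamma ->
  is_derive t (1 : R) e1 (- (om * e2 t)) -> is_derive t (1 : R) e2 (om * e1 t) ->
  is_derive t (1 : R) z dz -> is_derive t (1 : R) rho Lambda ->
  is_derive t (1 : R) (fun s => lyap gamma mu (e1 s) (e2 s) (z s) (rho s))
    (lyap_rate gamma Lambda mu (e1 t) (e2 t) (z t) (rho t) om dz).
Proof.
move=> g0 D1 D2 D3 D4; rewrite /lyap /energy.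
have K c := is_derive_cst1 c t.
have H := is_deriveB1 (is_deriveB1 (is_deriveD1 (is_deriveB1 (K 1) D1)
    (is_deriveM1 (is_derive_sqr1 D3) (K (2 * gamma)^-1)))
  (is_deriveM1 (K mu) (is_deriveM1 (is_deriveM1 D1 D2) D3)))
  (is_deriveM1 (K mu) (is_deriveM1 (is_deriveB1 (K 1) D4)
     (is_deriveM1 D1 (is_deriveB1 (K 1) D1)))).
refine (@is_derive_eq _ _ _ _ _ _ _ _ H _).
by rewrite /lyap_rate /=; field; rewrite gt_eqF.
Qed.

Lemma lyap_within_continuous (gamma mu : R) A (e1 e2 z rho : R -> R) :
  {within A, continuous e1} -> {within A, continuous e2} ->
  {within A, continuous z} -> {within A, continuous rho} ->
  {within A, continuous (fun s => lyap gamma mu (e1 s) (e2 s) (z s) (rho s))}.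
Proof.
move=> c1 c2 c3 c4; rewrite /lyap /energy.
have K c := @within_continuous_cst1 A c.
exact: (within_continuousB1 (within_continuousB1 (within_continuousD1
  (within_continuousB1 (K 1) c1)
  (within_continuousM1 (within_continuous_sqr1 c3) (K (2 * gamma)^-1)))
  (within_continuousM1 (K mu) (within_continuousM1 (within_continuousM1 c1 c2) c3)))
  (within_continuousM1 (K mu) (within_continuousM1 (within_continuousB1 (K 1) c4)
     (within_continuousM1 c1 (within_continuousB1 (K 1) c1))))).
Qed.

End Calculus.

(** * The coupled barriers for the fast and slow states *)

Section Barriers.
Variable R : realType.

Definition fast_size (th x1 x2 x3 x4 : R) := Num.sqrt (sqnorm4 x1 x2 x3 x4 + th ^+ 2).

(** The bound [fast_size <= 2 * th + G0 * exp (- t / eps)] multiplied by the growing exponential, so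
    that it becomes a function which has to stay nonpositive. *)
Definition fast_barrier (eps th G0 t x1 x2 x3 x4 : R) :=
  (fast_size th x1 x2 x3 x4 - 2 * th) * expR (eps^-1 * t) - G0.

(* The two terms added to [lyap] absorb the transient of the fast variables    *)
(* during flows and the perturbation of the jumps.                             *)
Definition slow_level (gamma mu a eps kap t e1 e2 z rho : R) :=
  lyap gamma mu e1 e2 z rho + a * eps * expR (- eps^-1 * t) + kap * rho.

Definition slow_barrier (gamma mu a eps kap b lam H0 t e1 e2 z rho : R) :=
  (slow_level gamma mu a eps kap t e1 e2 z rho - b) * expR (lam * t) - H0.

Lemma fast_barrier_le (eps th G0 t x1 x2 x3 x4 y : R) :
  (fast_barrier eps th G0 t x1 x2 x3 x4 <= y) =
  (fast_size th x1 x2 x3 x4 <= 2 * th + (G0 + y) * expR (- eps^-1 * t)).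
Proof.
rewrite /fast_barrier lerBlDr -ler_pdivlMr ?expR_gt0 // -expRN mulNr.
by rewrite lerBlDl [y + G0]addrC.
Qed.

Lemma slow_barrier_le (gamma mu a eps kap b lam H0 t e1 e2 z rho y : R) :
  (slow_barrier gamma mu a eps kap b lam H0 t e1 e2 z rho <= y) =
  (slow_level gamma mu a eps kap t e1 e2 z rho <= b + (H0 + y) * expR (- lam * t)).
Proof.
rewrite /slow_barrier lerBlDr -ler_pdivlMr ?expR_gt0 // -expRN mulNr.
by rewrite lerBlDl [y + H0]addrC.
Qed.

Lemma sqnorm4_ge0 (x1 x2 x3 x4 : R) : 0 <= sqnorm4 x1 x2 x3 x4.
Proof. by rewrite /sqnorm4 !addr_ge0 ?sqr_ge0. Qed.

Lemma fast_size_ge (th x1 x2 x3 x4 : R) :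
  Num.sqrt (sqnorm4 x1 x2 x3 x4) <= fast_size th x1 x2 x3 x4.
Proof. by rewrite ler_wsqrtr // lerDl sqr_ge0. Qed.

Lemma fast_size_le (th x1 x2 x3 x4 : R) : 0 <= th ->
  fast_size th x1 x2 x3 x4 <= Num.sqrt (sqnorm4 x1 x2 x3 x4) + th.
Proof.
move=> th0; set n := Num.sqrt (sqnorm4 x1 x2 x3 x4).
have n0 : 0 <= n by exact: sqrtr_ge0.
rewrite /fast_size -(sqr_sqrtr (sqnorm4_ge0 x1 x2 x3 x4)) -/n.
rewrite -[leRHS]ger0_norm ?addr_ge0 // -sqrtr_sqr ler_wsqrtr //.
by rewrite sqrrD -addrA lerD2l lerDr mulrn_wge0 // mulr_ge0.
Qed.

Lemma sum_sqr_le (L x1 x2 x3 x4 n : R) : Num.sqrt (sqnorm4 x1 x2 x3 x4) <= n ->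
  (L * (x1 + x3)) ^+ 2 + (L * (x2 + x4)) ^+ 2 <= (2 * L * n) ^+ 2.
Proof.
move=> Hn; have n0 : 0 <= n by exact: le_trans Hn; rewrite sqrtr_ge0.
have : sqnorm4 x1 x2 x3 x4 <= n ^+ 2.
  rewrite -(sqr_sqrtr (sqnorm4_ge0 x1 x2 x3 x4)) ler_pXn2r // nnegrE //.
move=> /(ler_wpM2l (sqr_ge0 L)); rewrite /sqnorm4.
have := mulr_ge0 (sqr_ge0 L) (sqr_ge0 (x1 - x3)).
have := mulr_ge0 (sqr_ge0 L) (sqr_ge0 (x2 - x4)).
have := mulr_ge0 (sqr_ge0 L) (sqr_ge0 n).
have -> : (2 * L * n) ^+ 2 = 4 * (L ^+ 2 * n ^+ 2) by ring.
by move=> *; nra.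
Qed.

(** The small-gain step. While both barriers are at most 1, the fast state is bounded by [X] and the
    energy by [Rv]; these bounds are what each differential inequality requires, and [joint_barrier]
    closes the loop. The [+ 1] next to [G0] and [H0] is this slack. *)
Lemma barriers_flow (L k gamma Lambda xi eps chim chiM dM M1 mu lam Rv Z X C D kap bb G0 H0 : R)
  (a b : R) (B : seq R) (chi dchi x1 x2 x3 x4 e1 e2 z rho : R -> R) :
  0 < L -> 0 < k -> 0 < gamma -> 0 < Lambda -> 0 < eps -> 0 < chim -> 0 < M1 ->
  0 <= mu <= 1 -> mu * (2 + gamma) <= 1 / 2 ->
  mu * (4 * gamma * Rv + k ^+ 2 + gamma + 9 + k) <= k / 2 ->
  mu * Lambda <= chim * k / 2 ->
  0 <= lam -> 2 * lam <= mu * Lambda -> 2 * lam <= mu * (chim * gamma) ->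
  0 <= Z -> 2 * gamma * Rv <= Z ^+ 2 ->
  dM + chiM * (chiM * (Z + k) + 2 * L * X * (`|xi| + Z + k)) <= L * M1 ->
  2 * L * ((`|xi| + Z + k) * (4 + Z) + gamma * (Z / gamma + 1)) <= C ->
  0 <= kap -> 0 <= D -> 0 <= C ->
  2 * C * (eps * M1) + kap * Lambda + lam * (C * D * eps + kap) <= lam * bb ->
  0 <= bb -> 0 <= H0 + 1 -> 2 * (bb + H0 + 1) <= Rv ->
  G0 + 1 <= D -> 2 * (eps * M1) + D <= X ->
  0 <= a -> a <= b ->
  {within `[a, b], continuous x1} -> {within `[a, b], continuous x2} ->
  {within `[a, b], continuous x3} -> {within `[a, b], continuous x4} ->
  {within `[a, b], continuous e1} -> {within `[a, b], continuous e2} ->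
  {within `[a, b], continuous z} -> {within `[a, b], continuous rho} ->
  (forall t, a < t < b -> [/\ chim <= chi t, chi t <= chiM,
     e1 t ^+ 2 + e2 t ^+ 2 = 1 & 0 <= rho t <= 1]) ->
  (forall t, a < t < b -> t \notin B ->
    let w1 := L * (x1 t + x3 t) in let w2 := L * (x2 t + x4 t) in
    let om := frame_rate k xi (chi t) (e1 t) (e2 t) (z t) w1 w2 in
    [/\ `|dchi t| <= dM,
      [/\ is_derive t (1 : R) x1 ((x3 t - x1 t) / eps),
          is_derive t (1 : R) x2 ((x4 t - x2 t) / eps),
          is_derive t (1 : R) x3 ((- x1 t - x3 t) / eps
             + (dchi t * e2 t + chi t * om * e1 t) / L) &
          is_derive t (1 : R) x4 ((- x2 t - x4 t) / eps
             + (- (dchi t * e1 t) + chi t * om * e2 t) / L)] &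
      [/\ is_derive t (1 : R) e1 (- (om * e2 t)),
          is_derive t (1 : R) e2 (om * e1 t),
          is_derive t (1 : R) z (- (gamma * (chi t * e2 t - w1))) &
          is_derive t (1 : R) rho Lambda]]) ->
  let g t := fast_barrier eps (eps * M1) G0 t (x1 t) (x2 t) (x3 t) (x4 t) in
  let h t := slow_barrier gamma mu (C * D) eps kap bb lam H0 t (e1 t) (e2 t) (z t) (rho t) in
  g a <= 0 -> h a <= 0 -> g b <= 0 /\ h b <= 0.
Proof.
move=> L0 k0 g0 La0 eps0 cm0 M10 mu01 mug muk muL lam0 lL lg Z0 ZR HM1 HC kap0 D0 C0.
move=> Hbb bb0 H01 HRv GD DX a0 ab c1 c2 c3 c4 ce1 ce2 cz crho Hbd Hode g h ga ha.
have mu0 : 0 <= mu by case/andP: mu01.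
have th0 : 0 < eps * M1 by rewrite mulr_gt0.
have epsV0 : 0 < eps^-1 by rewrite invr_gt0.
have K A c := @within_continuous_cst1 R A c.
have cN : {within `[a, b], continuous (fun t =>
    sqnorm4 (x1 t) (x2 t) (x3 t) (x4 t) + (eps * M1) ^+ 2)}.
  exact: (within_continuousD1 (within_continuousD1 (within_continuousD1
    (within_continuousD1 (within_continuous_sqr1 c1) (within_continuous_sqr1 c2))
    (within_continuous_sqr1 c3)) (within_continuous_sqr1 c4)) (K _ _)).
have cg : {within `[a, b], continuous g}.
  exact: (within_continuousB1 (within_continuousM1 (within_continuousB1
    (within_continuous_comp1 cN (@sqrt_continuous R)) (K _ _))
    (@within_continuous_exp1 R _ _)) (K _ _)).
have ch : {within `[a, b], continuous h}.
  have cU := @lyap_within_continuous R gamma mu _ _ _ _ _ ce1 ce2 cz crho.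
  have cE := within_continuousM1 (K _ (C * D * eps))
    (@within_continuous_exp1 R `[a, b] (- eps^-1)).
  have cR := within_continuousM1 (K _ kap) crho.
  rewrite /h /slow_barrier /slow_level.
  apply: within_continuousB1; last exact: K.
  apply: within_continuousM1; last exact: within_continuous_exp1.
  apply: within_continuousB1; last exact: K.
  exact: (within_continuousD1 (within_continuousD1 cU cE) cR).
have guard t : a < t < b -> g t <= 1 -> h t <= 1 ->
  [/\ Num.sqrt (sqnorm4 (x1 t) (x2 t) (x3 t) (x4 t)) <=
        2 * (eps * M1) + D * expR (- eps^-1 * t),
      2 * (eps * M1) + D * expR (- eps^-1 * t) <= X &
      energy gamma (e1 t) (z t) <= Rv].
  move=> atb; rewrite fast_barrier_le slow_barrier_le => Hg Hh.
  have t0 : 0 <= t by clear - atb a0; lra.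
  have E1 : expR (- eps^-1 * t) <= 1.
    by rewrite expR_le1 mulNr oppr_le0 mulr_ge0 // ltW.
  have E2 : expR (- lam * t) <= 1 by rewrite expR_le1 mulNr oppr_le0 mulr_ge0.
  have E10 := expR_gt0 (- eps^-1 * t).
  have [_ _ eu rho01] := Hbd t atb.
  split.
  - apply: (le_trans (fast_size_ge (eps * M1) _ _ _ _)); apply: (le_trans Hg).
    by rewrite lerD2l ler_wpM2r // ltW.
  - have : D * expR (- eps^-1 * t) <= D * 1 by rewrite ler_wpM2l.
    by clear - DX; lra.
  - have [V2 _] := lyap_energy (z t) g0 mu0 mug eu rho01.
    have : (H0 + 1) * expR (- lam * t) <= (H0 + 1) * 1 by rewrite ler_wpM2l.
    have : 0 <= C * D * eps * expR (- eps^-1 * t).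
      by rewrite !mulr_ge0 // ltW.
    have : 0 <= kap * rho t by rewrite mulr_ge0 //; clear - rho01 kap0; lra.
    move: Hh; rewrite /slow_level; clear - V2 HRv; lra.
apply: (@joint_barrier R a b B g h 1) => // t atb tB gt1 ht1.
- have [Hn HX HV] := guard t atb gt1 ht1.
  have [chit chiMt eu rho01] := Hbd t atb.
  have [dd [D1 D2 D3 D4] _] := Hode t atb tB.
  set w1 := L * (x1 t + x3 t) in dd D1 D2 D3 D4 *.
  set w2 := L * (x2 t + x4 t) in dd D1 D2 D3 D4 *.
  have [_ z2] := energy_ge (z t) g0 eu.
  have zZ : `|z t| <= Z.
    apply: normr_le_sqr => //; apply: le_trans ZR; apply: (le_trans z2).
    by rewrite ler_wpM2l // mulr_ge0 // ltW.
  have X0 : 0 <= X by apply: le_trans HX; apply: le_trans Hn; exact: sqrtr_ge0.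
  have LX0 : 0 <= 2 * L * X by rewrite !mulr_ge0 // ltW.
  have HW : w1 ^+ 2 + w2 ^+ 2 <= (2 * L * X) ^+ 2.
    by apply: sum_sqr_le; exact: le_trans HX.
  have chi01 : 0 <= chi t <= chiM by clear - chit chiMt cm0; lra.
  have Hf := fast_input_bound k0 chi01 dd LX0 eu HW zZ HM1.
  have N0 : 0 < sqnorm4 (x1 t) (x2 t) (x3 t) (x4 t) + (eps * M1) ^+ 2.
    by rewrite ltr_wpDl ?sqnorm4_ge0 // exprn_gt0.
  have DN := is_deriveD1 (is_deriveD1 (is_deriveD1 (is_deriveD1
    (is_derive_sqr1 D1) (is_derive_sqr1 D2)) (is_derive_sqr1 D3)) (is_derive_sqr1 D4))
    (is_derive_cst1 ((eps * M1) ^+ 2) t).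
  have Dr := is_derive_sqrt1
    (f := fun s => sqnorm4 (x1 s) (x2 s) (x3 s) (x4 s) + (eps * M1) ^+ 2) N0 DN.
  have Dg := is_deriveB1 (is_deriveM1 (is_deriveB1 Dr (is_derive_cst1 (2 * (eps * M1)) t))
    (is_derive_exp1 eps^-1 t)) (is_derive_cst1 G0 t).
  eexists; first exact: Dg.
  have := fast_pointwise (x1 := x1 t) (x2 := x2 t) (x3 := x3 t) (x4 := x4 t)
    L0 eps0 M10 Hf erefl erefl.
  set r := Num.sqrt (sqnorm4 _ _ _ _ + _); set N' := 2 * (_ + _ + _ + _).
  move=> Hp; rewrite subr0 subr0 addr0.
  set DN' := (X in (2 * _)^-1 * X).
  have -> : DN' = N' by rewrite /DN' /N' /=; ring.
  rewrite (_ : _ + _ = expR (eps^-1 * t) * ((2 * r)^-1 * N' + (r - 2 * (eps * M1)) / eps)).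
    by rewrite pmulr_rle0 ?expR_gt0.
  by rewrite -/(sqnorm4 _ _ _ _) -/r; ring.
- have [Hn HX HV] := guard t atb gt1 ht1.
  have [chit chiMt eu rho01] := Hbd t atb.
  have [dd _ [D1 D2 D3 D4]] := Hode t atb tB.
  set w1 := L * (x1 t + x3 t) in dd D1 D2 D3 D4 *.
  set w2 := L * (x2 t + x4 t) in dd D1 D2 D3 D4 *.
  pose n := 2 * (eps * M1) + D * expR (- eps^-1 * t).
  have E10 := expR_gt0 (- eps^-1 * t).
  have n0 : 0 <= n by rewrite /n addr_ge0 ?mulr_ge0 // ltW.
  have LX0 : 0 <= 2 * L * n by rewrite !mulr_ge0 // ltW.
  have HW : w1 ^+ 2 + w2 ^+ 2 <= (2 * L * n) ^+ 2 by apply: sum_sqr_le.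
  have HD : 2 * L * n * ((`|xi| + Z + k) * (4 + Z) + gamma * (Z / gamma + 1)) <= n * C.
    by have := ler_wpM2l n0 HC; rewrite [X in _ <= X]mulrC [n * C]mulrC; clear; lra.
  have Hs := slow_pointwise g0 k0 La0 mu01 cm0 chit eu rho01 muk muL lL lg HV Z0 ZR
    LX0 HW (lexx _) HD.
  have DU := lyap_is_derive mu g0 D1 D2 D3 D4.
  have Dh := is_deriveB1 (is_deriveM1 (is_deriveB1 (is_deriveD1 (is_deriveD1 DU
      (is_deriveM1 (is_derive_cst1 (C * D * eps) t) (is_derive_exp1 (- eps^-1) t)))
      (is_deriveM1 (is_derive_cst1 kap t) D4)) (is_derive_cst1 bb t))
    (is_derive_exp1 lam t)) (is_derive_cst1 H0 t).
  eexists; first exact: Dh.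
  have [_ V3] := lyap_energy (z t) g0 mu0 mug eu rho01.
  have [/andP[V1 V0] _] := energy_ge (z t) g0 eu.
  move: Hs DU Dh V3; set U' := lyap_rate _ _ _ _ _ _ _ _ _; set U := lyap _ _ _ _ _ _.
  set V := energy _ _ _ in V0 HV *.
  move=> Hs DU Dh V3.
  (* The derivative of the transient term of [slow_level] cancels the contribution
     [C * D * exp (- t / eps)] of the fast state to [U']. Since [lam * U] is at most
     [3 / 2 * lam * V], it is covered by [- 2 * lam * V], and what is left is at most [lam * bb] by
     [Hbb]. *)
  rewrite (_ : _ - _ = expR (lam * t) *
     (lam * (U + C * D * eps * expR (- eps^-1 * t) + kap * rho t - bb)
      + (U' - C * D * expR (- eps^-1 * t) + kap * Lambda))); last first.
    by field; rewrite gt_eqF.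
  rewrite pmulr_rle0 ?expR_gt0 //.
  have E1 : expR (- eps^-1 * t) <= 1.
    by rewrite expR_le1 mulNr oppr_le0 mulr_ge0 // ?ltW //; clear - atb a0; lra.
  have Q1 : lam * (C * D * eps * expR (- eps^-1 * t)) <= lam * (C * D * eps * 1).
    by rewrite !ler_wpM2l // !mulr_ge0 // ltW.
  have Q2 : lam * (kap * rho t) <= lam * (kap * 1) by rewrite !ler_wpM2l //; clear - rho01; lra.
  have Q3 := ler_wpM2l lam0 V3.
  have Q4 : 0 <= lam * V by rewrite mulr_ge0 // (le_trans V1 V0).
  move: Hs; rewrite /n; clear - Hbb Q1 Q2 Q3 Q4; lra.
Qed.

End Barriers.

(** * Coordinates and jumps *)

Section Components.
Variable R : realType.
Implicit Types (v : 'cV[R]_2) (xf xs : 'cV[R]_(2 + 2)).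

Lemma enorm2 v : enorm v = Num.sqrt (v 0 0 ^+ 2 + v 1 0 ^+ 2).
Proof.
rewrite /enorm !big_ord_recl big_ord0 addr0.
by rewrite (_ : lift ord0 ord0 = 1) //; exact: val_inj.
Qed.

Lemma unit_circleP v : unit_circle v <-> v 0 0 ^+ 2 + v 1 0 ^+ 2 = 1.
Proof.
rewrite /unit_circle /= enorm2; split=> [H|->]; last by rewrite sqrtr1.
by rewrite -[LHS]sqr_sqrtr ?addr_ge0 ?sqr_ge0 // H expr1n.
Qed.

Lemma enorm_fast xf : enorm xf =
  Num.sqrt (sqnorm4 (usubmx xf 0 0) (usubmx xf 1 0) (dsubmx xf 0 0) (dsubmx xf 1 0)).
Proof.
rewrite /enorm big_split_ord /= !big_ord_recl !big_ord0 !addr0 !mxE addrA.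
rewrite (_ : lift ord0 ord0 = 1 :> 'I_2) //; exact: val_inj.
Qed.

Lemma mulmx2 (A : 'M[R]_2) v i : (A *m v) i 0 = A i 0 * v 0 0 + A i 1 * v 1 0.
Proof.
rewrite !mxE !big_ord_recl big_ord0 addr0.
by rewrite (_ : lift ord0 ord0 = 1) //; exact: val_inj.
Qed.

Lemma col2E (a b : R) : col2 a b 0 0 = a /\ col2 a b 1 0 = b.
Proof. by rewrite /col2 !mxE. Qed.

Lemma hat_hE L chi xf xs :
  hat_h L chi xf xs 0 0 = chi * eta xs 1 0 - L * (usubmx xf 0 0 + dsubmx xf 0 0) /\
  hat_h L chi xf xs 1 0 = - (chi * eta xs 0 0) - L * (usubmx xf 1 0 + dsubmx xf 1 0).
Proof.
rewrite /hat_h; set u := usubmx xf; set d := dsubmx xf; set e := eta xs.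
have J i : (- (chi *: (Jmx R *m e)) - L *: (u + d)) i 0 =
    - (chi * (Jmx R *m e) i 0) - L * (u i 0 + d i 0) by rewrite !mxE.
by rewrite !J !mulmx2 /Jmx !mxE /=; split; ring.
Qed.

Lemma frame_rateE L k xi chi xf xs :
  chi * xi - hat_omega L k xi chi xf xs =
  frame_rate k xi chi (eta xs 0 0) (eta xs 1 0) (xi_err xs)
    (L * (usubmx xf 0 0 + dsubmx xf 0 0)) (L * (usubmx xf 1 0 + dsubmx xf 1 0)).
Proof.
rewrite /hat_omega /frame_rate enorm2.
by have [-> ->] := hat_hE L chi xf xs.
Qed.

Lemma f_hE L k xi chi dchi xf xs (om := chi * xi - hat_omega L k xi chi xf xs) :
  f_h L k xi chi dchi xf xs 0 0 = dchi * eta xs 1 0 + chi * om * eta xs 0 0 /\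
  f_h L k xi chi dchi xf xs 1 0 = - (dchi * eta xs 0 0) + chi * om * eta xs 1 0.
Proof.
rewrite /f_h -/om; set e := eta xs.
have J i : (- (dchi *: (Jmx R *m e)) + (chi * om) *: e) i 0 =
    - (dchi * (Jmx R *m e) i 0) + chi * om * e i 0 by rewrite !mxE.
by rewrite !J !mulmx2 /Jmx !mxE /=; split; ring.
Qed.

Lemma fast_flowE L k xi eps chi dchi xf xs i (f := f_h L k xi chi dchi xf xs) :
  fast_flow L k xi eps chi dchi xf xs (lshift 2 i) 0 =
    (dsubmx xf i 0 - usubmx xf i 0) / eps /\
  fast_flow L k xi eps chi dchi xf xs (rshift 2 i) 0 =
    (- usubmx xf i 0 - dsubmx xf i 0) / eps + f i 0 / L.
Proof.
rewrite /fast_flow -/f.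
have -> : block_mx (- 1%:M) 1%:M (- 1%:M) (- 1%:M) *m xf =
    col_mx (- usubmx xf + dsubmx xf) (- usubmx xf - dsubmx xf).
  by rewrite -{1}[xf]vsubmxK mul_block_col !mulNmx !mul1mx.
rewrite mul_col_mx mul0mx -scalemxAl mul1mx scale_col_mx add_col_mx.
rewrite col_mxEu col_mxEd; clearbody f.
by move: (usubmx xf) (dsubmx xf) => u d; split; rewrite !mxE; ring.
Qed.

Lemma slow_flowE L k gamma Lambda xi chi xf xs
    (om := chi * xi - hat_omega L k xi chi xf xs)
    (F := slow_flow L k gamma Lambda xi chi xf xs) :
  [/\ F (lshift 2 0) 0 = - (om * eta xs 1 0), F (lshift 2 1) 0 = om * eta xs 0 0,
      F (rshift 2 0) 0 = - (gamma * hat_h L chi xf xs 0 0) & F (rshift 2 1) 0 = Lambda].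
Proof.
rewrite /F /slow_flow -/om !col_mxEu !col_mxEd.
have J i : (om *: (Jmx R *m eta xs)) i 0 = om * (Jmx R *m eta xs) i 0 by rewrite mxE.
by rewrite !J !mulmx2 /Jmx /col2 !mxE /=; split => //; ring.
Qed.

(** Multiplication by [- u^2] for the complex number [u = u1 + i u2]. *)
Definition rot_sq (u1 u2 : R) : 'M[R]_2 :=
  mx2 (- (u1 ^+ 2 - u2 ^+ 2)) (2 * u1 * u2) (- (2 * u1 * u2)) (- (u1 ^+ 2 - u2 ^+ 2)).

Lemma mx2_eq (A : 'M[R]_2) a b c d :
  A 0 0 = a -> A 0 1 = b -> A 1 0 = c -> A 1 1 = d -> A = mx2 a b c d.
Proof.
move=> Ea Eb Ec Ed; apply/matrixP => i j; rewrite !mxE.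
have o2 (l : 'I_2) : l = 0 \/ l = 1.
  by case: l => [[|[|//]]] Hl; [left|right]; exact: val_inj.
by have [->|->] := o2 i; have [->|->] := o2 j.
Qed.

(** Removes the frame estimate from the jump map: only a unit [u] with [|hh| u = conj (i hh)]
    matters, and this equation leaves [u] free when [hh = 0], as the set-valued angle does. *)
Lemma G_fP hh (G : 'M[R]_2) : G_f hh G ->
  (hh 1 0 < 0 /\ G = 1%:M) \/
  (0 <= hh 1 0 /\ exists u1 u2, [/\ u1 ^+ 2 + u2 ^+ 2 = 1,
     enorm hh * u1 = - hh 1 0, enorm hh * u2 = - hh 0 0 & G = rot_sq u1 u2]).
Proof.
move=> [zeta [zp [/unit_circleP uz + GE]]].
set c := zeta 0 0 in uz *; set s := zeta 1 0 in uz *.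
have CE (x y : 'cV[R]_2) : (Cmx x)^T *m Cmx y =
    mx2 (x 0 0 * y 0 0 + x 1 0 * y 1 0) (x 1 0 * y 0 0 - x 0 0 * y 1 0)
        (x 0 0 * y 1 0 - x 1 0 * y 0 0) (x 0 0 * y 0 0 + x 1 0 * y 1 0).
  apply: mx2_eq; rewrite !mxE !big_ord_recl big_ord0 !mxE /=; ring.
rewrite /G_zeta /=; case: ifPn => [h2|]; last first.
  rewrite -ltNge => h2 zpE; left; split => //.
  rewrite GE zpE CE; apply/esym/mx2_eq; rewrite !mxE /= -?/c -?/s ?mulr1n ?mulr0n.
  - by rewrite -uz; ring.
  - by ring.
  - by ring.
  - by rewrite -uz; ring.
set p := Cmx zeta *m (Jmx R *m hh) => -[th [_ p1E p2E] zpE].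
right; split => //.
have P1 : p 0 0 = - (c * hh 1 0) - s * hh 0 0.
  by rewrite /p !mulmx2 /Cmx /Jmx !mxE /= -/c -/s; ring.
have P2 : p 1 0 = c * hh 0 0 - s * hh 1 0.
  by rewrite /p !mulmx2 /Cmx /Jmx !mxE /= -/c -/s; ring.
have nE : enorm (col2 (p 0 0) (p 1 0)) = enorm hh.
  rewrite !enorm2 (col2E _ _).1 (col2E _ _).2 P1 P2; congr Num.sqrt.
  transitivity ((c ^+ 2 + s ^+ 2) * (hh 0 0 ^+ 2 + hh 1 0 ^+ 2)); first by ring.
  by rewrite uz mul1r.
rewrite nE in p1E p2E.
(* In complex notation [u = zeta * conj (exp (i th))], where [|hh| exp (i th) = zeta * i * hh]. *)
exists (c * cos th + s * sin th), (s * cos th - c * sin th); split.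
- transitivity ((c ^+ 2 + s ^+ 2) * (cos th ^+ 2 + sin th ^+ 2)); first by ring.
  by rewrite uz cos2Dsin2 mul1r.
- rewrite mulrDr mulrCA -p1E mulrCA -p2E P1 P2.
  transitivity (- (c ^+ 2 + s ^+ 2) * hh 1 0); first by ring.
  by rewrite uz mulN1r.
- rewrite mulrBr mulrCA -p1E mulrCA -p2E P1 P2.
  transitivity (- (c ^+ 2 + s ^+ 2) * hh 0 0); first by ring.
  by rewrite uz mulN1r.
- have C2 : cos (th *+ 2) = cos th ^+ 2 - sin th ^+ 2.
    by rewrite mulr2n cosD -!expr2.
  have S2 : sin (th *+ 2) = 2 * (sin th * cos th).
    by rewrite mulr2n sinD; ring.
  have Z1 : zp 0 0 = - (c * cos (th *+ 2) + s * sin (th *+ 2)).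
    by rewrite zpE mxE mulmx2 /Cmx /col2 !mxE /= -/c -/s; ring.
  have Z2 : zp 1 0 = - (c * sin (th *+ 2) - s * cos (th *+ 2)).
    by rewrite zpE mxE mulmx2 /Cmx /col2 !mxE /= -/c -/s; ring.
  rewrite GE CE -/c -/s Z1 Z2 C2 S2 /rot_sq.
  by congr mx2; ring.
Qed.

(** The sign test on the second component of [hat_h] determines the sign of [eta_1] up to [W / chi],
    which selects one of the two jump lemmas. The constant is 25 = 5 + 5 * 4, the last factor coming
    from [flip_estimate]; the fast norm is preserved since [G] is a rotation. *)
Lemma jump_estimate (L gamma mu chi chim W : R) xf xs (G : 'M[R]_2) :
  0 < L -> 0 < gamma -> 0 <= mu <= 1 -> mu * `|xi_err xs| <= 1 / 2 ->
  0 < chim -> chim <= chi ->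
  eta xs 0 0 ^+ 2 + eta xs 1 0 ^+ 2 = 1 ->
  (L * (usubmx xf 0 0 + dsubmx xf 0 0)) ^+ 2 +
  (L * (usubmx xf 1 0 + dsubmx xf 1 0)) ^+ 2 <= W ^+ 2 -> 0 <= W ->
  G_f (hat_h L chi xf xs) G ->
  let xf' := block_mx G 0 0 G *m xf in
  let xs' := col_mx (G *m eta xs) (col2 (xi_err xs) 0) in
  [/\ sqnorm4 (usubmx xf' 0 0) (usubmx xf' 1 0) (dsubmx xf' 0 0) (dsubmx xf' 1 0) =
      sqnorm4 (usubmx xf 0 0) (usubmx xf 1 0) (dsubmx xf 0 0) (dsubmx xf 1 0),
      eta xs' 0 0 ^+ 2 + eta xs' 1 0 ^+ 2 = 1, clock xs' = 0 &
      lyap gamma mu (eta xs' 0 0) (eta xs' 1 0) (xi_err xs') (clock xs') <=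
      lyap gamma mu (eta xs 0 0) (eta xs 1 0) (xi_err xs) 1 + 25 * (W / chim)].
Proof.
move=> L0 g0 mu01 muz cm0 cmc eu HW W0 GG xf' xs'.
have chi0 : 0 < chi by exact: lt_le_trans cmc.
have xf'E : xf' = col_mx (G *m usubmx xf) (G *m dsubmx xf).
  by rewrite /xf' -{1}[xf]vsubmxK mul_block_col !mul0mx addr0 add0r.
have -> : usubmx xf' = G *m usubmx xf by rewrite xf'E col_mxKu.
have -> : dsubmx xf' = G *m dsubmx xf by rewrite xf'E col_mxKd.
have -> : eta xs' = G *m eta xs by rewrite /eta /xs' col_mxKu.
have -> : xi_err xs' = xi_err xs by rewrite /xi_err /xs' col_mxKd (col2E _ _).1.
have -> : clock xs' = 0 by rewrite /clock /xs' col_mxKd (col2E _ _).2.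
have [h1E h2E] := hat_hE L chi xf xs.
set w1 := L * (usubmx xf 0 0 + _) in HW h1E; set w2 := L * (usubmx xf 1 0 + _) in HW h2E.
set e1 := eta xs 0 0 in eu *; set e2 := eta xs 1 0 in eu *.
have w2W : `|w2| <= W.
  by apply: normr_le_sqr => //; apply: le_trans HW; rewrite lerDr sqr_ge0.
have Wc0 : 0 <= W / chi by rewrite divr_ge0 // ltW.
have Wcm : W / chi <= W / chim by rewrite ler_wpM2l // lef_pV2 ?posrE.
move: w2W; rewrite ler_norml => /andP[w2a w2b].
have [[h2 ->]|[h2 [u1 [u2 [uu E1 E2 ->]]]]] := G_fP GG.
  rewrite !mul1mx; split => //.
  have We1 : - (W / chi) <= e1.
    rewrite lerNl ler_pdivlMr //; move: h2; rewrite h2E -/e1; lra.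
  have := lyap_jump_id gamma (xi_err xs) mu01 eu Wc0 We1; lra.
rewrite h1E h2E in E1 E2 h2.
have n0 : 0 <= enorm (hat_h L chi xf xs) by exact: sqrtr_ge0.
have [] := @flip_estimate R chi e1 e2 w1 w2 _ u1 u2 W chi0 n0 eu uu _ _ HW W0.
- by rewrite E1 -/e1; ring.
- by rewrite E2 -/e2; ring.
have RE v : (rot_sq u1 u2 *m v) 0 0 =
     - ((u1 ^+ 2 - u2 ^+ 2) * v 0 0 - 2 * u1 * u2 * v 1 0) /\
   (rot_sq u1 u2 *m v) 1 0 =
     - ((u1 ^+ 2 - u2 ^+ 2) * v 1 0 + 2 * u1 * u2 * v 0 0).
  by rewrite !mulmx2 /rot_sq !mxE /=; split; ring.
have [-> ->] := RE (eta xs); have [-> ->] := RE (usubmx xf).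
have [-> ->] := RE (dsubmx xf); rewrite -/e1 -/e2.
move=> fu f1A f2A; split => //.
  transitivity ((u1 ^+ 2 + u2 ^+ 2) ^+ 2 *
    sqnorm4 (usubmx xf 0 0) (usubmx xf 1 0) (dsubmx xf 0 0) (dsubmx xf 1 0)).
    by rewrite /sqnorm4; ring.
  by rewrite uu expr1n mul1r.
have We1 : e1 <= W / chi by rewrite ler_pdivlMr //; move: h2; rewrite -/e1; lra.
have := lyap_jump_flip gamma mu01 eu fu muz Wc0 We1 f1A f2A.
have -> : 4 * W / chi = 4 * (W / chi) by rewrite mulrA.
lra.
Qed.

End Components.

(** * Solutions on an interval of flow *)

Section Inputs.
Variable R : realType.

Lemma within_continuous_at (a b t : R) (f : R -> R) :
  {within `[a, b], continuous f} -> a < t < b -> {for t, continuous f}.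
Proof.
move=> cf atb; apply/cvgrPdist_lt => z z0.
have atb' : a <= t <= b by lra.
have [d d0 H] := within_itv_dist cf atb' z0.
apply/nbhs_ballP; exists (Num.min d (Num.min (t - a) (b - t))) => /=.
  by rewrite !lt_min d0; apply/andP; split; [|apply/andP; split]; lra.
move=> s; rewrite /ball /= !lt_min => /andP[sd /andP[sa sb]].
rewrite distrC; apply: H; last by rewrite distrC.
by move: sa sb; rewrite !ltr_norml => /andP[? ?] /andP[? ?]; lra.
Qed.

(** Being continuous and bounded away from 0, [omega] keeps its sign near [t], so the absolute value
    acts there as a constant factor. Breakpoints are locally finite, so a neighbourhood of [t]
    avoids them and the Dini derivative is classical on it. *)
Lemma derive_input (omega : R -> R) (phi wmin t : R) (B : set R) (M : R) :
  0 < phi -> 0 < wmin -> {within `[0, +oo[, continuous omega} ->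
  (forall T : R, finite_set (B `&` `[0, T])) ->
  (forall s : R, 0 < s -> ~ B s ->
     derivable omega s 1 /\ {for s, continuous (derive1 omega)}) ->
  (forall s, 0 <= s -> wmin <= `|omega s|) ->
  (forall s, 0 <= s -> (`|upper_right_dini omega s| <= M%:E)%E) ->
  0 < t -> ~ B t ->
  let dchi s := fine (upper_right_dini (fun s => phi * `|omega s|) s) in
  {for t, continuous dchi} /\ `|dchi t| <= phi * `|M|.
Proof.
move=> phi0 wmin0 cw fB HB Hw HM t0 nBt dchi.
have cw_at s : 0 < s -> {for s, continuous omega}.
  move=> s0; apply: (@within_continuous_at 0 (s + 1)); last by lra.
  by apply: continuous_subspaceW cw => x /=; rewrite !in_itv /= => /andP[->].
pose sg := Num.sg (omega t).
have wt0 : omega t != 0 by rewrite -normr_gt0 (lt_le_trans wmin0) // Hw // ltW.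
have sgn1 : `|sg| = 1 by rewrite normr_sg wt0.
have near_sg s : 0 < s -> Num.sg (omega s) = sg ->
    \forall u \near s, `|omega u| = sg * omega u.
  move=> s0 ss; have /cvgrPdist_lt /(_ _ wmin0) := cw_at s s0.
  have : \forall u \near s, 0 < u by apply: lt_nbhsr.
  apply: filterS2 => u u0 us.
  have := Hw s (ltW s0); have := Hw u (ltW u0).
  rewrite -ss; move: us; have [ws|ws|->] := ltrgtP (omega s) 0.
  - rewrite (ltr0_norm ws) (ltr0_sg ws) mulN1r ltr_norml => /andP[A1 A2] Hu Hs.
    by rewrite ltr0_norm //; lra.
  - rewrite (gtr0_norm ws) (gtr0_sg ws) mul1r ltr_norml => /andP[A1 A2] Hu Hs.
    by rewrite gtr0_norm //; lra.
  - by rewrite normr0 => *; lra.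
have near_good : \forall s \near t, [/\ 0 < s, ~ B s & Num.sg (omega s) = sg].
  have n1 : \forall u \near t, 0 < u by apply: lt_nbhsr.
  have n2 : \forall u \near t, ~ (B `&` `[0, t + 1]) u.
    have oC : open (~` (B `&` `[0, t + 1])).
      apply: closed_openC; apply: accessible_finite_set_closed.1; last exact: fB.
      exact: hausdorff_accessible.
    by apply: (open_nbhs_nbhs (conj oC _)) => -[].
  have n3 : \forall u \near t, u < t + 1 by apply: lt_nbhsl; rewrite ltrDl.
  have n4 := near_sg t t0 erefl.
  near=> s; have s0 : 0 < s by near: s.
  split => //.
    have : ~ (B `&` `[0, t + 1]) s by near: s.
    move=> H Bs; apply: H; split => //=; rewrite in_itv /= ltW //=.
    by apply/ltW; near: s.
  have : `|omega s| = sg * omega s by near: s.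
  have ws0 : omega s != 0 by rewrite -normr_gt0 (lt_le_trans wmin0) // Hw // ltW.
  rewrite [`|omega s|]normrEsg => /(mulIf ws0) //.
have dchiE s : 0 < s -> ~ B s -> Num.sg (omega s) = sg ->
    dchi s = phi * sg * derive1 omega s.
  move=> s0 nBs ss; rewrite /dchi.
  have [dw _] := HB s s0 nBs.
  have D : is_derive s (1 : R) (fun u => phi * sg * omega u) (phi * sg * derive1 omega s).
    have := is_deriveM1 (is_derive_cst1 (phi * sg) s) (derivableP dw).
    by rewrite mulr0 addr0 -derive1E.
  have D' : is_derive s (1 : R) (fun u => phi * `|omega u|) (phi * sg * derive1 omega s).
    apply: (near_eq_is_derive _ D).
    by apply: filterS (near_sg s s0 ss) => u ->; rewrite mulrA.
  by rewrite (upper_right_dini_derive D').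
split.
  have cd : {for t, continuous (fun s => phi * sg * derive1 omega s)}.
    have [_ c] := HB t t0 nBt.
    by apply: continuousM => //; exact: cst_continuous.
  rewrite /prop_for /continuous_at (dchiE t) //.
  apply: cvg_trans cd; apply: near_eq_cvg.
  by near=> s; rewrite dchiE //; near: s; apply: filterS near_good => s [].
rewrite dchiE // !normrM sgn1 mulr1 (gtr0_norm phi0); apply: ler_wpM2l; first exact: ltW.
have [dw _] := HB t t0 nBt.
have := HM t (ltW t0); rewrite (upper_right_dini_derive (derivableP dw)) /=.
rewrite lee_fin derive1E => H; apply: (le_trans H); exact: ler_norm.
Unshelve. all: by end_near. Qed.

Lemma abs_continuous_acr n (a b : R) (f : R -> 'cV[R]_n) i :
  abs_continuous a b f -> acr a b (fun t => f t i 0).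
Proof.
move=> acf e e0; have [d d0 H] := acf e e0; exists d => // m u v uv duv luv.
apply: le_lt_trans (H m u v uv duv luv); apply: ler_sum => l _.
rewrite /enorm; apply: normr_le_sqr; first exact: sqrtr_ge0.
rewrite sqr_sqrtr; last by apply: sumr_ge0 => ? _; exact: sqr_ge0.
rewrite (bigD1 i) //= !mxE lerDl; apply: sumr_ge0 => ? _; exact: sqr_ge0.
Qed.

Lemma is_derive_cV n (f : R -> 'cV[R]_n) (t : R) (d : 'cV[R]_n) i :
  is_derive t (1 : R) f d -> is_derive t (1 : R) (fun s => f s i 0) (d i 0).
Proof.
move=> [df <-]; rewrite (derive_mx df) mxE.
by apply: DeriveDef => //; exact: (derivable_mxP _ _ _).1 df i 0.
Qed.

Section ContinuousAt.
Variables (T : topologicalType) (t : T).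
Implicit Types f g : T -> R.

Lemma continuous_atD f g : {for t, continuous f} -> {for t, continuous g} ->
  {for t, continuous (fun s => f s + g s)}.
Proof. exact: continuousD. Qed.

Lemma continuous_atB f g : {for t, continuous f} -> {for t, continuous g} ->
  {for t, continuous (fun s => f s - g s)}.
Proof. exact: continuousB. Qed.

Lemma continuous_atN f : {for t, continuous f} ->
  {for t, continuous (fun s => - f s)}.
Proof. exact: continuousN. Qed.

Lemma continuous_atM f g : {for t, continuous f} -> {for t, continuous g} ->
  {for t, continuous (fun s => f s * g s)}.
Proof. exact: continuousM. Qed.

Lemma continuous_at_cst (c : R) : {for t, continuous (fun _ : T => c)}.
Proof. exact: cst_continuous. Qed.

Lemma continuous_at_sqrt f : {for t, continuous f} ->
  {for t, continuous (fun s => Num.sqrt (f s))}.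
Proof. by move=> cf; apply: continuous_comp => //; exact: sqrt_continuous. Qed.

Lemma frame_rate_continuous (k xi : R) (chi e1 e2 z w1 w2 : T -> R) :
  {for t, continuous chi} -> {for t, continuous e1} -> {for t, continuous e2} ->
  {for t, continuous z} -> {for t, continuous w1} -> {for t, continuous w2} ->
  {for t, continuous (fun s =>
     frame_rate k xi (chi s) (e1 s) (e2 s) (z s) (w1 s) (w2 s))}.
Proof.
move=> cc c1 c2 cz cw1 cw2; rewrite /frame_rate.
have K c := continuous_at_cst c.
have h1 := continuous_atB (continuous_atM cc c2) cw1.
have h2 := continuous_atB (continuous_atN (continuous_atM cc c1)) cw2.
exact: (continuous_atB (continuous_atM cc (K xi)) (continuous_atD
  (continuous_atM (continuous_at_sqrt (continuous_atD (continuous_atM h1 h1)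
     (continuous_atM h2 h2))) (continuous_atB (K xi) cz))
  (continuous_atM (K k) h1))).
Qed.

End ContinuousAt.

Section SolutionFlow.
Variables (L k gamma Lambda xi eps : R) (chi : R -> R) (E : set (R * nat)).
Variables psif psis : R -> nat -> 'cV[R]_(2 + 2).
Hypothesis sol : error_solution L k gamma Lambda xi eps chi E psif psis.
Variables (j : nat) (a b : R).
Hypothesis ab : a < b.
Hypothesis abE : `[a, b] `<=` flow_times E j.

Let x1 s := usubmx (psif s j) 0 0.
Let x2 s := usubmx (psif s j) 1 0.
Let x3 s := dsubmx (psif s j) 0 0.
Let x4 s := dsubmx (psif s j) 1 0.
Let e1 s := eta (psis s j) 0 0.
Let e2 s := eta (psis s j) 1 0.
Let z s := xi_err (psis s j).
Let rho s := clock (psis s j).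

Lemma solution_acr :
  [/\ acr a b x1, acr a b x2, acr a b x3 & acr a b x4] /\
  [/\ acr a b e1, acr a b e2, acr a b z & acr a b rho].
Proof.
have Af i : acr a b (fun s => psif s j i 0).
  exact: (abs_continuous_acr _ (@sol_arc_f _ _ _ _ _ _ _ _ _ _ _ sol j a b (ltW ab) abE)).
have As i : acr a b (fun s => psis s j i 0).
  exact: (abs_continuous_acr _ (@sol_arc_s _ _ _ _ _ _ _ _ _ _ _ sol j a b (ltW ab) abE)).
have Ef i : (fun s => usubmx (psif s j) i 0) = (fun s => psif s j (lshift 2 i) 0).
  by apply/funext => s; rewrite mxE.
have Ef' i : (fun s => dsubmx (psif s j) i 0) = (fun s => psif s j (rshift 2 i) 0).
  by apply/funext => s; rewrite mxE.
have Es i : (fun s => usubmx (psis s j) i 0) = (fun s => psis s j (lshift 2 i) 0).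
  by apply/funext => s; rewrite mxE.
have Es' i : (fun s => dsubmx (psis s j) i 0) = (fun s => psis s j (rshift 2 i) 0).
  by apply/funext => s; rewrite mxE.
by rewrite /x1 /x2 /x3 /x4 /e1 /e2 /z /rho /eta /xi_err /clock !Ef !Ef' !Es !Es'.
Qed.

(** The flow constraint is given at interior times; continuity of the arcs carries it to the
    endpoints, where jumps take place. *)
Lemma solution_slow_flow_set t : a <= t <= b -> slow_flow_set (psis t j).
Proof.
move=> atb.
have H s : a < s < b -> [/\ e1 s ^+ 2 + e2 s ^+ 2 = 1, 0 <= rho s & rho s <= 1].
  move=> /andP[as_ sb].
  have [] : slow_flow_set (psis s j).
    apply: (sol_flow_set sol).
    have sI : s \in `]a, b[ by rewrite in_itv /= as_.
    apply: filterS (near_in_itvoo sI) => u /=; rewrite in_itv /= => /andP[au ub].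
    by apply: abE; rewrite /= in_itv /= !ltW.
  by move=> /unit_circleP ? /andP[].
have [_ [A1 A2 _ A4]] := solution_acr.
have c1 := acr_within_continuous A1.
have c2 := acr_within_continuous A2.
have c4 := acr_within_continuous A4.
have K := @within_continuous_cst1 R `[a, b].
have cn := within_continuousB1 (within_continuousD1
  (within_continuous_sqr1 c1) (within_continuous_sqr1 c2)) (K 1).
have cn' := within_continuousB1 (K 1) (within_continuousD1
  (within_continuous_sqr1 c1) (within_continuous_sqr1 c2)).
have n1 := within_itv_le0 ab cn _ atb.
have n2 := within_itv_le0 ab cn' _ atb.
have n3 := within_itv_le0 ab (within_continuousB1 c4 (K 1)) _ atb.
have n4 := within_itv_le0 ab (within_continuousB1 (K 0) c4) _ atb.
split.
  apply/unit_circleP; rewrite -/(e1 t) -/(e2 t).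
  have := n1 ltac:(by move=> s /H[-> _ _]; rewrite subrr).
  have := n2 ltac:(by move=> s /H[-> _ _]; rewrite subrr).
  by move=> *; lra.
rewrite -/(rho t).
have := n3 ltac:(by move=> s /H[_ _ ?]; lra).
have := n4 ltac:(by move=> s /H[_ ? _]; lra).
by move=> *; lra.
Qed.

Let w1 s := L * (x1 s + x3 s).
Let w2 s := L * (x2 s + x4 s).
Let om s := frame_rate k xi (chi s) (e1 s) (e2 s) (z s) (w1 s) (w2 s).
Let dchi s := fine (upper_right_dini chi s).

(** Continuity of [dchi] guards the fast equations only: at a breakpoint of [omega] the slow ones
    remain classical. *)
Lemma solution_ode t : a < t < b -> {for t, continuous chi} ->
  ({for t, continuous dchi} ->
   [/\ is_derive t (1 : R) x1 ((x3 t - x1 t) / eps),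
       is_derive t (1 : R) x2 ((x4 t - x2 t) / eps),
       is_derive t (1 : R) x3 ((- x1 t - x3 t) / eps
             + (dchi t * e2 t + chi t * om t * e1 t) / L) &
       is_derive t (1 : R) x4 ((- x2 t - x4 t) / eps
             + (- (dchi t * e1 t) + chi t * om t * e2 t) / L)]) /\
  [/\ is_derive t (1 : R) e1 (- (om t * e2 t)),
      is_derive t (1 : R) e2 (om t * e1 t),
      is_derive t (1 : R) z (- (gamma * (chi t * e2 t - w1 t))) &
      is_derive t (1 : R) rho Lambda].
Proof.
move=> atb cchi.
have [[B1 B2 B3 B4] [A1 A2 A3 A4]] := solution_acr.
have cont f : acr a b f -> {for t, continuous f}.
  by move=> /acr_within_continuous cf; exact: within_continuous_at cf atb.
have [c1 c2 c3 c4] := And4 (cont _ B1) (cont _ B2) (cont _ B3) (cont _ B4).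
have [ce1 ce2 cz cr] := And4 (cont _ A1) (cont _ A2) (cont _ A3) (cont _ A4).
have K c := @continuous_at_cst _ t c.
have cw1 : {for t, continuous w1} := continuous_atM (K L) (continuous_atD c1 c3).
have cw2 : {for t, continuous w2} := continuous_atM (K L) (continuous_atD c2 c4).
have com : {for t, continuous om} :=
  frame_rate_continuous (k := k) (xi := xi) cchi ce1 ce2 cz cw1 cw2.
have inE s : a < s < b -> flow_times E j s.
  by move=> sab; apply: abE; rewrite /= in_itv /=; lra.
have omE s : chi s * xi - hat_omega L k xi (chi s) (psif s j) (psis s j) = om s.
  exact: frame_rateE.
split.
- move=> cd; have nN := @sol_flow_f _ _ _ _ _ _ _ _ _ _ _ sol j.
  have [N [mN N0 HN0]] := nN.
  have negN : lebesgue_measure.-negligible N by exists N; split.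
  have HN s : a < s < b -> ~ N s -> forall i, upper_right_dini (fun s => psif s j i 0) s =
      (fast_flow L k xi eps (chi s) (dchi s) (psif s j) (psis s j) i 0)%:E.
    move=> /inE sE nNs; apply: contrapT => H; apply: nNs; apply: HN0 => /=.
    by move=> /(_ sE).
  have Ef (i : 'I_2) : (fun s => usubmx (psif s j) i 0) = (fun s => psif s j (lshift 2 i) 0).
    by apply/funext => s; rewrite mxE.
  have Ef' (i : 'I_2) : (fun s => dsubmx (psif s j) i 0) = (fun s => psif s j (rshift 2 i) 0).
    by apply/funext => s; rewrite mxE.
  split.
  + apply: (@acr_is_derive R a b x1 (fun s => (x3 s - x1 s) / eps) N) => //.
      move=> s sab nNs; rewrite /x1 Ef (HN s sab nNs).
      by have [-> _] := fast_flowE L k xi eps (chi s) (dchi s) (psif s j) (psis s j) 0.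
    exact: (continuous_atM (continuous_atB c3 c1) (K _)).
  + apply: (@acr_is_derive R a b x2 (fun s => (x4 s - x2 s) / eps) N) => //.
      move=> s sab nNs; rewrite /x2 Ef (HN s sab nNs).
      by have [-> _] := fast_flowE L k xi eps (chi s) (dchi s) (psif s j) (psis s j) 1.
    exact: (continuous_atM (continuous_atB c4 c2) (K _)).
  + apply: (@acr_is_derive R a b x3 (fun s => (- x1 s - x3 s) / eps
             + (dchi s * e2 s + chi s * om s * e1 s) / L) N) => //.
      move=> s sab nNs; rewrite /x3 Ef' (HN s sab nNs).
      have [_ ->] := fast_flowE L k xi eps (chi s) (dchi s) (psif s j) (psis s j) 0.
      by have [-> _] := f_hE L k xi (chi s) (dchi s) (psif s j) (psis s j); rewrite omE.
    exact: (continuous_atD (continuous_atM (continuous_atB (continuous_atN c1) c3) (K _))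
      (continuous_atM (continuous_atD (continuous_atM cd ce2)
         (continuous_atM (continuous_atM cchi com) ce1)) (K _))).
  + apply: (@acr_is_derive R a b x4 (fun s => (- x2 s - x4 s) / eps
             + (- (dchi s * e1 s) + chi s * om s * e2 s) / L) N) => //.
      move=> s sab nNs; rewrite /x4 Ef' (HN s sab nNs).
      have [_ ->] := fast_flowE L k xi eps (chi s) (dchi s) (psif s j) (psis s j) 1.
      by have [_ ->] := f_hE L k xi (chi s) (dchi s) (psif s j) (psis s j); rewrite omE.
    exact: (continuous_atD (continuous_atM (continuous_atB (continuous_atN c2) c4) (K _))
      (continuous_atM (continuous_atD (continuous_atN (continuous_atM cd ce1))
         (continuous_atM (continuous_atM cchi com) ce2)) (K _))).
- have nN := @sol_flow_s _ _ _ _ _ _ _ _ _ _ _ sol j.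
  have [N [mN N0 HN0]] := nN.
  have negN : lebesgue_measure.-negligible N by exists N; split.
  have HN s i : a < s < b -> ~ N s -> upper_right_dini (fun s => psis s j i 0) s =
      (slow_flow L k gamma Lambda xi (chi s) (psif s j) (psis s j) i 0)%:E.
    move=> /inE sE nNs; apply: upper_right_dini_derive; apply: is_derive_cV.
    apply: contrapT => H; apply: nNs; apply: HN0 => /=.
    by move=> /(_ sE).
  have Es (i : 'I_2) : (fun s => usubmx (psis s j) i 0) = (fun s => psis s j (lshift 2 i) 0).
    by apply/funext => s; rewrite mxE.
  have Es' (i : 'I_2) : (fun s => dsubmx (psis s j) i 0) = (fun s => psis s j (rshift 2 i) 0).
    by apply/funext => s; rewrite mxE.
  split.
  + apply: (@acr_is_derive R a b e1 (fun s => - (om s * e2 s)) N) => //.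
      move=> s sab nNs; rewrite /e1 /eta Es (HN s _ sab nNs).
      have [-> _ _ _] := slow_flowE L k gamma Lambda xi (chi s) (psif s j) (psis s j).
      by rewrite omE.
    exact: (continuous_atN (continuous_atM com ce2)).
  + apply: (@acr_is_derive R a b e2 (fun s => om s * e1 s) N) => //.
      move=> s sab nNs; rewrite /e2 /eta Es (HN s _ sab nNs).
      have [_ -> _ _] := slow_flowE L k gamma Lambda xi (chi s) (psif s j) (psis s j).
      by rewrite omE.
    exact: (continuous_atM com ce1).
  + apply: (@acr_is_derive R a b z (fun s => - (gamma * (chi s * e2 s - w1 s))) N) => //.
      move=> s sab nNs; rewrite /z /xi_err Es' (HN s _ sab nNs).
      have [_ _ -> _] := slow_flowE L k gamma Lambda xi (chi s) (psif s j) (psis s j).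
      by have [-> _] := hat_hE L (chi s) (psif s j) (psis s j).
    exact: (continuous_atN (continuous_atM (K _)
      (continuous_atB (continuous_atM cchi ce2) cw1))).
  + apply: (@acr_is_derive R a b rho (fun=> Lambda) N) => //.
    move=> s sab nNs; rewrite /rho /clock Es' (HN s _ sab nNs).
    by have [_ _ _ ->] := slow_flowE L k gamma Lambda xi (chi s) (psif s j) (psis s j).
Qed.

Lemma solution_clock : (forall t, a < t < b -> {for t, continuous chi}) ->
  rho b - rho a <= Lambda * (b - a).
Proof.
move=> cchi; have [_ [_ _ _ A4]] := solution_acr.
have cid : {within `[a, b], continuous (fun s : R => s)}.
  by apply: continuous_subspaceT => x; exact: cvg_id.
have c := within_continuousB1 (within_continuousB1 (acr_within_continuous A4)
  (within_continuousM1 (@within_continuous_cst1 R `[a, b] Lambda)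
     (within_continuousB1 cid
        (@within_continuous_cst1 R `[a, b] a))))
  (@within_continuous_cst1 R `[a, b] (rho a)).
have D t : a < t < b -> exists2 g', is_derive t (1 : R)
    (fun s => rho s - Lambda * (s - a) - rho a) g' & g' <= 0.
  move=> atb; have [_ [_ _ _ D]] := solution_ode atb (cchi t atb).
  eexists.
    exact: (is_deriveB1 (is_deriveB1 D (is_deriveM1 (is_derive_cst1 Lambda t)
      (is_deriveB1 (is_derive_id t (1 : R)) (is_derive_cst1 a t)))) (is_derive_cst1 _ t)).
  by rewrite !subr0 mulr1 mulr0 addr0 subrr.
(* The same function serves as both barriers, with no breakpoints since the clock equation is
   classical at every interior time. *)
have := @joint_barrier R a b [::] _ _ 1 (ltW ab) ltr01 c c.
move=> /(_ _ _ _ _)[]; last by rewrite /=; lra.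
- by rewrite /= subrr mulr0 subr0 subrr.
- by rewrite /= subrr mulr0 subr0 subrr.
- by move=> t atb _ _ _; exact: D.
- by move=> t atb _ _ _; exact: D.
Qed.

End SolutionFlow.

End Inputs.

(** * Invariants of hybrid solutions *)

(** Truncating the domain at [(T, J)] gives a finite staircase of jump times, climbed by induction
    on the number of jumps. *)
Lemma hybrid_induction (R : realType) (E : set (R * nat)) (P : R -> nat -> Prop) :
  hybrid_time_domain E -> P 0 0%N ->
  (forall j a b, 0 <= a -> a <= b -> `[a, b] `<=` flow_times E j ->
     P a j -> P b j) ->
  (forall t j, 0 <= t -> E (t, j) -> E (t, j.+1) -> P t j -> P t j.+1) ->
  forall t j, E (t, j) -> P t j.
Proof.
move=> [E0 _ EC] P0 Pf Pj T J ETJ.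
have [K [s [s0 smono EE]]] := EC T J ETJ.
have [JK /andP[sJ TJ]] : (J < K)%N /\ s J <= T <= s J.+1.
  have : (E `&` [set p | 0 <= p.1 <= T /\ (p.2 <= J)%N]) (T, J).
    by split => //=; rewrite lexx (E0 _ ETJ).
  by rewrite EE.
have inE i u : (i < K)%N -> s i <= u <= s i.+1 -> E (u, i).
  move=> iK su; have : [set p | (p.2 < K)%N /\ s p.2 <= p.1 <= s p.2.+1] (u, i) by [].
  by rewrite -EE => -[].
have s_ge0 i : (i <= J)%N -> 0 <= s i.
  move=> iJ; have iK : (i < K)%N by exact: leq_ltn_trans JK.
  by apply: (E0 (s i, i)); apply: inE => //; rewrite lexx smono.
have Ps i : (i <= J)%N -> P (s i) i.
  elim: i => [|i IH] iJ; first by rewrite s0.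
  have iK : (i < K)%N by exact: leq_ltn_trans (ltnW iJ) JK.
  have iK' : (i.+1 < K)%N by exact: leq_ltn_trans JK.
  apply: Pj; first exact: s_ge0.
  - by apply: inE => //; rewrite lexx smono.
  - by apply: inE => //; rewrite lexx smono.
  - apply: (Pf i (s i)); [exact: s_ge0 (ltnW iJ)|exact: smono| |exact: IH (ltnW iJ)].
    by move=> u /=; rewrite in_itv /= => su; exact: inE.
apply: (Pf J (s J)) => //; [exact: s_ge0| |exact: Ps].
move=> u /=; rewrite in_itv /= => /andP[su uT]; apply: inE => //.
by rewrite su (le_trans uT TJ).
Qed.

(** * The invariant under a consistent choice of constants *)

Section Tuned.
Variable R : realType.
Variables L k gamma Lambda xi eps chim chiM dM M1 mu lam Rv Z X C D kap bb G0 H0 : R.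

(* [mu], [lam]: weight of the cross terms and decay rate of [lyap]; [Rv], [X], *)
(* [Z]: a priori bounds on the energy, on [x_f] and on [xi_err]; [M1], [C]:    *)
(* gains of the slow onto the fast subsystem and conversely; [kap], [bb]: size *)
(* of the jump perturbation and ultimate bound, both O(eps); [G0], [H0]:       *)
(* initial values that normalize the two barriers.                             *)
Record tuned : Prop := Tuned {
  tuned_L : 0 < L;
  tuned_k : 0 < k;
  tuned_gamma : 0 < gamma;
  tuned_Lambda : 0 < Lambda;
  tuned_eps : 0 < eps;
  tuned_chim : 0 < chim;
  tuned_M1 : 0 < M1;
  tuned_mu : 0 <= mu <= 1;
  tuned_mu_energy : mu * (2 + gamma) <= 1 / 2;
  tuned_mu_jump : mu * (1 + 2 * gamma * Rv) <= 1;
  tuned_mu_flow : mu * (4 * gamma * Rv + k ^+ 2 + gamma + 9 + k) <= k / 2;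
  tuned_mu_clock : mu * Lambda <= chim * k / 2;
  tuned_lam : 0 <= lam;
  tuned_lam_clock : 2 * lam <= mu * Lambda;
  tuned_lam_flow : 2 * lam <= mu * (chim * gamma);
  tuned_Z : 0 <= Z;
  tuned_Z_sqr : 2 * gamma * Rv <= Z ^+ 2;
  tuned_fast : dM + chiM * (chiM * (Z + k) + 2 * L * X * (`|xi| + Z + k)) <= L * M1;
  tuned_slow : 2 * L * ((`|xi| + Z + k) * (4 + Z) + gamma * (Z / gamma + 1)) <= C;
  tuned_kap : 25 * (2 * L * (eps * (2 * M1 + Lambda * D)) / chim) <= kap;
  tuned_D : 0 <= D;
  tuned_C : 0 <= C;
  tuned_bb : 2 * C * (eps * M1) + kap * Lambda + lam * (C * D * eps + kap) <= lam * bb;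
  tuned_bb_ge0 : 0 <= bb;
  tuned_H0 : 0 <= H0 + 1;
  tuned_Rv : 2 * (bb + H0 + 1) <= Rv;
  tuned_G0 : G0 + 1 <= D;
  tuned_X : 2 * (eps * M1) + D <= X }.

Lemma tuned_kap_ge0 : tuned -> 0 <= kap.
Proof.
move=> T; apply: le_trans (tuned_kap T).
have := tuned_L T; have := tuned_eps T; have := tuned_M1 T.
have := tuned_chim T; have := tuned_Lambda T; have := tuned_D T => *.
by rewrite mulr_ge0 // divr_ge0 ?mulr_ge0 ?addr_ge0 ?mulr_ge0 // ltW.
Qed.

Hypothesis tun : tuned.

Variables (chi : R -> R) (E : set (R * nat)) (psif psis : R -> nat -> 'cV[R]_(2 + 2)).
Hypothesis sol : error_solution L k gamma Lambda xi eps chi E psif psis.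
Hypothesis chi_bounds : forall t, 0 <= t -> chim <= chi t <= chiM.
Hypothesis chi_cont : forall t, 0 < t -> {for t, continuous chi}.
Let dchi t := fine (upper_right_dini chi t).
Hypothesis chi_C1 : forall T : R, exists B : seq R, forall t, 0 < t -> t <= T ->
  t \notin B -> {for t, continuous dchi} /\ `|dchi t| <= dM.

Definition fast_barrier_at t (xf : 'cV[R]_(2 + 2)) :=
  fast_barrier eps (eps * M1) G0 t (usubmx xf 0 0) (usubmx xf 1 0)
    (dsubmx xf 0 0) (dsubmx xf 1 0).

Definition slow_barrier_at t (xs : 'cV[R]_(2 + 2)) :=
  slow_barrier gamma mu (C * D) eps kap bb lam H0 t
    (eta xs 0 0) (eta xs 1 0) (xi_err xs) (clock xs).

(** The last clause counts jumps. It forces [Lambda * t >= 1] at every jump and later bounds [t + j]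
    by a multiple of [t]. *)
Definition tuned_inv (t : R) (j : nat) :=
  [/\ slow_flow_set (psis t j), fast_barrier_at t (psif t j) <= 0,
      slow_barrier_at t (psis t j) <= 0 & j%:R + clock (psis t j) <= Lambda * t].

Lemma tuned_inv_flow j a b : 0 <= a -> a <= b -> `[a, b] `<=` flow_times E j ->
  tuned_inv a j -> tuned_inv b j.
Proof.
move=> a0; rewrite le_eqVlt => /predU1P[<- //|ab] abE [Sa ga ha ca].
have Sab := solution_slow_flow_set sol ab abE.
have [[B1 B2 B3 B4] [A1 A2 A3 A4]] := solution_acr sol ab abE.
have pos t : a < t < b -> 0 < t by lra.
have [B HB] := chi_C1 b.
have Hbd t : a < t < b -> [/\ chim <= chi t, chi t <= chiM,
    eta (psis t j) 0 0 ^+ 2 + eta (psis t j) 1 0 ^+ 2 = 1 & 0 <= clock (psis t j) <= 1].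
  move=> atb; have [/unit_circleP ? ?] := Sab t ltac:(lra).
  by have /andP[] := chi_bounds (ltW (pos t atb)).
have := @barriers_flow R L k gamma Lambda xi eps chim chiM dM M1 mu lam Rv Z X C D kap
  bb G0 H0 a b B chi dchi _ _ _ _ _ _ _ _
  (tuned_L tun) (tuned_k tun) (tuned_gamma tun) (tuned_Lambda tun) (tuned_eps tun)
  (tuned_chim tun) (tuned_M1 tun) (tuned_mu tun) (tuned_mu_energy tun)
  (tuned_mu_flow tun) (tuned_mu_clock tun) (tuned_lam tun) (tuned_lam_clock tun)
  (tuned_lam_flow tun) (tuned_Z tun) (tuned_Z_sqr tun) (tuned_fast tun) (tuned_slow tun)
  _ (tuned_D tun) (tuned_C tun) (tuned_bb tun) (tuned_bb_ge0 tun) (tuned_H0 tun)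
  (tuned_Rv tun) (tuned_G0 tun) (tuned_X tun) a0 (ltW ab)
  (acr_within_continuous B1) (acr_within_continuous B2) (acr_within_continuous B3)
  (acr_within_continuous B4) (acr_within_continuous A1) (acr_within_continuous A2)
  (acr_within_continuous A3) (acr_within_continuous A4) Hbd.
move=> /(_ (tuned_kap_ge0 tun)) []; [|exact: ga|exact: ha|].
  move=> t atb tB.
  have t0 := pos t atb.
  have [cd dd] := HB t t0 ltac:(lra) tB.
  have [ode1 ode2] := solution_ode sol ab abE atb (chi_cont t0).
  by split => //; exact: ode1.
move=> gb hb; split => //; first by apply: Sab; rewrite lexx ltW.
have := solution_clock sol ab abE (fun t atb => chi_cont (pos t atb)).
lra.
Qed.

(** The fast barrier is unchanged since [G] is a rotation. In the slow one, [lyap] may rise by at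
    most [kap], while the reset of the clock lowers [kap * rho] by exactly [kap]. *)
Lemma tuned_inv_jump t j : 0 <= t -> E (t, j) -> E (t, j.+1) ->
  tuned_inv t j -> tuned_inv t j.+1.
Proof.
move=> t0 Ej Ej1 [[/unit_circleP eu rho01] gt_ ht_ ct].
have [[_ c1] [G [GG psifE psisE]]] := sol_jump sol Ej Ej1.
have [L0 k0 g0 La0] := And4 (tuned_L tun) (tuned_k tun) (tuned_gamma tun) (tuned_Lambda tun).
have [eps0 M10 D0 cm0] := And4 (tuned_eps tun) (tuned_M1 tun) (tuned_D tun) (tuned_chim tun).
have mu01 := tuned_mu tun; have /andP[mu0 mu1] := mu01.
have th0 : 0 < eps * M1 by rewrite mulr_gt0.
have Lt1 : 1 <= Lambda * t.
  by rewrite -c1; apply: le_trans ct; rewrite lerDr ler0n.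
have /andP[cmc _] := chi_bounds t0.
pose n := eps * (2 * M1 + Lambda * D).
have n0 : 0 <= n.
  by rewrite /n mulr_ge0 ?(ltW eps0) // addr_ge0 ?mulr_ge0 // ltW.
(* From [exp y >= y] at [y = t / eps] and [1 <= Lambda * t]. *)
have E1 : expR (- eps^-1 * t) <= eps * Lambda.
  have y0 : 0 < eps^-1 * t.
    by rewrite mulr_gt0 ?invr_gt0 // -(pmulr_rgt0 _ La0) (lt_le_trans ltr01).
  rewrite mulNr expRN -[leRHS]invrK lef_pV2 ?posrE ?expR_gt0 ?invr_gt0 ?mulr_gt0 //.
  apply: (@le_trans _ _ (eps^-1 * t)); last first.
    by apply: le_trans (expR_ge1Dx _); rewrite lerDr.
  by rewrite invfM ler_pM2l ?invr_gt0 // -div1r ler_pdivrMr // mulrC.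
have Hn : Num.sqrt (sqnorm4 (usubmx (psif t j) 0 0) (usubmx (psif t j) 1 0)
    (dsubmx (psif t j) 0 0) (dsubmx (psif t j) 1 0)) <= n.
  move: gt_; rewrite /fast_barrier_at fast_barrier_le addr0 => H.
  apply: (le_trans (fast_size_ge (eps * M1) _ _ _ _)); apply: (le_trans H).
  have ex0 := expR_gt0 (- eps^-1 * t).
  have GD : G0 <= D by have := tuned_G0 tun; lra.
  have := ler_wpM2r (ltW ex0) GD; have := ler_wpM2l D0 E1.
  rewrite /n; lra.
have HW := sum_sqr_le L Hn.
have W0 : 0 <= 2 * L * n by rewrite mulr_ge0 // mulr_ge0 // ltW.
have VR : energy gamma (eta (psis t j) 0 0) (xi_err (psis t j)) <= Rv.
  have [V2 _] := lyap_energy (xi_err (psis t j)) g0 mu0 (tuned_mu_energy tun) eu rho01.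
  move: ht_; rewrite /slow_barrier_at slow_barrier_le addr0 /slow_level => H.
  have kap0 := tuned_kap_ge0 tun.
  have := tuned_Rv tun; have := tuned_H0 tun => H01 HRv.
  have ex0 := expR_gt0 (- lam * t).
  have ex1 : expR (- lam * t) <= 1.
    by rewrite expR_le1 mulNr oppr_le0 mulr_ge0 // (tuned_lam tun).
  have : (H0 + 1) * expR (- lam * t) <= (H0 + 1) * 1 by rewrite ler_wpM2l.
  have : 0 <= C * D * eps * expR (- eps^-1 * t).
    by rewrite !mulr_ge0 ?expR_ge0 ?(tuned_C tun) // ltW.
  have : 0 <= kap * clock (psis t j) by rewrite mulr_ge0 //; lra.
  lra.
have muz : mu * `|xi_err (psis t j)| <= 1 / 2.
  have [_ z2] := energy_ge (xi_err (psis t j)) g0 eu.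
  (* From [2 * |z| <= 1 + z^2]; this is the origin of the condition [tuned_mu_jump]. *)
  have zR : `|xi_err (psis t j)| <= (1 + 2 * gamma * Rv) / 2.
    have := ler_wpM2l (mulr_ge0 (ler0n _ 2) (ltW g0)) VR.
    have := sqr_ge0 (`|xi_err (psis t j)| - 1).
    rewrite sqrrB expr1n mulr1 real_normK ?num_real //; lra.
  by have := ler_wpM2l mu0 zR; have := tuned_mu_jump tun; lra.
have [Nf eu' c0 UU] := jump_estimate L0 g0 mu01 muz cm0 cmc eu HW W0 GG.
split.
- rewrite psisE; split; first exact/unit_circleP.
  by rewrite c0 lexx ler01.
- by rewrite psifE /fast_barrier_at /fast_barrier /fast_size Nf.
- move: ht_; rewrite psisE /slow_barrier_at !slow_barrier_le !addr0; apply: le_trans.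
  rewrite /slow_level c1 c0 mulr0 mulr1.
  move: UU; rewrite c0; have := tuned_kap tun; rewrite -/n.
  lra.
- by rewrite psisE c0 addr0 -natr1; move: ct; rewrite c1.
Qed.

Lemma tuned_inv_holds : tuned_inv 0 0 -> forall t j, E (t, j) -> tuned_inv t j.
Proof.
move=> I0; apply: hybrid_induction => //; first exact: sol_domain sol.
- by move=> j a b; exact: tuned_inv_flow.
- by move=> t j; exact: tuned_inv_jump.
Qed.

End Tuned.

(** * Comparison functions and choice of the gains *)

Section Comparison.
Variable R : realType.

(** The second summand is the distance of the clock to [[0, 1]]: it makes the function proper on the
    whole slow space, where the clock ranges over the real line, and it vanishes along solutions. *)
Definition slow_indicator (gamma : R) (xs : 'cV[R]_(2 + 2)) : R :=
  energy gamma (eta xs 0 0) (xi_err xs)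
  + Num.max 0 (Num.max (- clock xs) (clock xs - 1)).

Lemma slow_indicator_flow (gamma : R) xs : slow_flow_set xs ->
  slow_indicator gamma xs = energy gamma (eta xs 0 0) (xi_err xs).
Proof.
move=> [_ c01]; rewrite /slow_indicator (_ : Num.max 0 _ = 0) ?addr0 //.
by apply/max_idPl; rewrite ge_max; apply/andP; split; lra.
Qed.

Lemma slow_indicator_proper (gamma : R) : 0 < gamma ->
  proper_indicator (@slow_space R) (@slow_attractor R) (slow_indicator gamma).
Proof.
move=> g0.
have max_ge (c : R) : [/\ 0 <= Num.max 0 (Num.max (- c) (c - 1)),
    - c <= Num.max 0 (Num.max (- c) (c - 1)) &
    c - 1 <= Num.max 0 (Num.max (- c) (c - 1))].
  by rewrite !le_max !lexx !orbT.
have en xs : slow_space xs -> 0 <= 1 - eta xs 0 0 <= energy gamma (eta xs 0 0) (xi_err xs) /\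
    xi_err xs ^+ 2 <= 2 * gamma * energy gamma (eta xs 0 0) (xi_err xs).
  by move=> /unit_circleP eu; exact: (energy_ge _ g0 eu).
split.
- apply: continuous_subspaceT => xs.
  have co i : {for xs, continuous (fun v : 'cV[R]_(2 + 2) => v i 0)}.
    exact: coord_continuous.
  have Eu i : (fun v : 'cV[R]_(2 + 2) => usubmx v i 0) = (fun v => v (lshift 2 i) 0).
    by apply/funext => v; rewrite mxE.
  have Ed i : (fun v : 'cV[R]_(2 + 2) => dsubmx v i 0) = (fun v => v (rshift 2 i) 0).
    by apply/funext => v; rewrite mxE.
  have ce : {for xs, continuous (fun v : 'cV[R]_(2 + 2) => eta v 0 0)}.
    by rewrite /eta Eu; exact: co.
  have cz : {for xs, continuous (@xi_err R)} by rewrite /xi_err Ed; exact: co.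
  have cc : {for xs, continuous (@clock R)} by rewrite /clock Ed; exact: co.
  have K (c : R) : {for xs, continuous (fun _ : 'cV[R]_(2 + 2) => c)}.
    exact: cst_continuous.
  have cmax (f g : 'cV[R]_(2 + 2) -> R) : {for xs, continuous f} -> {for xs, continuous g} ->
      {for xs, continuous (fun v => Num.max (f v) (g v))}.
    move=> cf cg; rewrite (_ : (fun v => _) =
        (fun v => (f v + g v + `|f v - g v|) * 2^-1)); last first.
      by apply/funext => v; rewrite maxr_absE.
    apply: continuous_atM (K _); apply: continuous_atD; first exact: continuous_atD.
    by apply: continuous_comp; [exact: continuous_atB|exact: norm_continuous].
  exact: (continuous_atD (continuous_atD (continuous_atB (K 1) ce)
    (continuous_atM (continuous_atM cz cz) (K _)))
    (cmax _ _ (K 0) (cmax _ _ (continuous_atN cc) (continuous_atB cc (K 1))))).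
- move=> xs /en[/andP[e0 eV] _]; have [m0 _ _] := max_ge (clock xs).
  by rewrite /slow_indicator addr_ge0 // (le_trans e0 eV).
- move=> xs Xxs; have [/andP[e0 eV] zV] := en xs Xxs.
  have [m0 m1 m2] := max_ge (clock xs).
  split=> [S0|[xE zE c01]].
    have V0 : energy gamma (eta xs 0 0) (xi_err xs) = 0.
      by move: S0; rewrite /slow_indicator; lra.
    have e1 : eta xs 0 0 = 1 by lra.
    have z0 : xi_err xs = 0.
      by apply/eqP; rewrite -sqrf_eq0 eq_le sqr_ge0 andbT; move: zV; rewrite V0 mulr0.
    split => //; last by move: S0; rewrite /slow_indicator V0; lra.
    have e2 : eta xs 1 0 = 0.
      move/unit_circleP : Xxs; rewrite e1 expr1n => /eqP.
      by rewrite -subr_eq0 addrAC subrr add0r sqrf_eq0 => /eqP.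
    apply/matrixP => i l; rewrite ord1.
    have i01 : i = 0 \/ i = 1.
      by case: i => [[|[|//]]] Hi; [left|right]; exact: val_inj.
    case: i01 => ->.
    + by rewrite (col2E _ _).1.
    + by rewrite (col2E _ _).2.
  rewrite slow_indicator_flow; last by split; [exact: Xxs|].
  by rewrite /energy xE zE (col2E _ _).1 subrr add0r expr0n mul0r.
- move=> M; pose m := `|M|.
  exists (2 + 2 * gamma * m + (m + 1) ^+ 2) => xs Xxs Hr.
  have [/andP[e0 eV] zV] := en xs Xxs.
  have [m0 m1 m2] := max_ge (clock xs).
  rewrite leNgt; apply/negP => SM.
  have Mm : M <= m by exact: ler_norm.
  have m_ge0 : 0 <= m by exact: normr_ge0.
  have Vm : energy gamma (eta xs 0 0) (xi_err xs) <= m.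
    by move: SM; rewrite /slow_indicator; lra.
  have c2 : clock xs ^+ 2 <= (m + 1) ^+ 2.
    have cm : `|clock xs| <= m + 1.
      move: SM; rewrite /slow_indicator => SM.
      by rewrite ler_norml; apply/andP; split; lra.
    by rewrite -[X in X <= _]real_normK ?num_real // ler_pXn2r // nnegrE //; lra.
  have z2 : xi_err xs ^+ 2 <= 2 * gamma * m.
    by apply: (le_trans zV); rewrite ler_wpM2l // mulr_ge0 // ltW.
  have N : enorm xs ^+ 2 <= 1 + 2 * gamma * m + (m + 1) ^+ 2.
    rewrite enorm_fast sqr_sqrtr ?sqnorm4_ge0 // /sqnorm4.
    move/unit_circleP : Xxs; rewrite /eta => ->.
    by rewrite lerD // lerD2l.
  have gm : 0 <= 2 * gamma * m by rewrite !mulr_ge0 // ltW.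
  have := sqr_ge0 (m + 1) => mm.
  have n0 : 1 <= enorm xs by lra.
  have : enorm xs <= enorm xs ^+ 2 by rewrite expr2 ler_peMl //; lra.
  lra.
Qed.

(** The factor 3 is the ratio of the two constants in [lyap_energy], and the rate follows
    [mu = c / (5 + 3 * r)]. The absolute value keeps the denominator positive, so the function is
    continuous on the whole plane. *)
Definition decay (q r s : R) := 3 * r * expR (- (q / (5 + 3 * `|r|) * s)).

Lemma decay_KL (q : R) : 0 < q -> class_KL (decay q).
Proof.
move=> q0.
have den (r : R) : 0 < 5 + 3 * `|r| by rewrite ltr_pwDl // mulr_ge0.
split.
- apply: continuous_subspaceT => p.
  have c1 : {for p, continuous (fun p : R * R => p.1)} by exact: cvg_fst.
  have c2 : {for p, continuous (fun p : R * R => p.2)} by exact: cvg_snd.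
  have K (c : R) : {for p, continuous (fun _ : R * R => c)} by exact: cst_continuous.
  have cn : {for p, continuous (fun p : R * R => `|p.1|)}.
    by apply: continuous_comp => //; exact: norm_continuous.
  have cd : {for p, continuous (fun p : R * R => (5 + 3 * `|p.1|)^-1)}.
    apply: continuousV; first by rewrite gt_eqF.
    exact: (continuous_atD (K 5) (continuous_atM (K 3) cn)).
  have ce : {for p, continuous (fun p : R * R => expR (- (q / (5 + 3 * `|p.1|) * p.2)))}.
    apply: continuous_comp; last exact: continuous_expR.
    exact: (continuous_atN (continuous_atM (continuous_atM (K q) cd) c2)).
  exact: (continuous_atM (continuous_atM (K 3) c1) ce).
- by move=> s _; rewrite /decay mulr0 mul0r.
- move=> s s0 r r'; rewrite !in_itv /= !andbT => r0 r'0 rr'.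
  rewrite /decay; apply: (@le_lt_trans _ _ (3 * r * expR (- (q / (5 + 3 * `|r'|) * s)))).
    rewrite ler_wpM2l ?mulr_ge0 // ler_expR lerN2 ler_wpM2r // ler_wpM2l ?(ltW q0) //.
    by rewrite lef_pV2 ?posrE // lerD2l ler_wpM2l // !ger0_norm // ltW.
  by rewrite ltr_pM2r ?expR_gt0 // ltr_pM2l.
- move=> r r0 s s'; rewrite !in_itv /= !andbT => s0 s'0 ss'.
  rewrite /decay ler_wpM2l ?mulr_ge0 // ler_expR lerN2 ler_wpM2l //.
  by rewrite divr_ge0 // ltW.
- move=> r r0; rewrite /decay.
  have c0 : 0 < q / (5 + 3 * `|r|) by rewrite divr_gt0.
  have H : expR (- (q / (5 + 3 * `|r|) * s)) @[s --> +oo] --> (0 : R).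
    apply: (cvg_comp (fun s => q / (5 + 3 * `|r|) * s) (fun s => expR (- s))).
      exact: gt0_cvgMry.
    exact: cvgr_expR.
  rewrite -[X in _ --> X](mulr0 (3 * r)).
  by apply: cvgM => //; exact: cvg_cst.
Qed.

(** These are the conditions on [mu] with the energy bound set to 1. As [Rv = 3 * r + 4] is less
    than [5 + 3 * r], dividing [c] by [5 + 3 * r] gives the conditions at [Rv]. *)
Lemma gain_exists (gamma k Lambda chim : R) :
  0 < gamma -> 0 < k -> 0 < Lambda -> 0 < chim ->
  exists2 c, 0 < c &
    [/\ c * (2 + gamma) <= 1 / 2, c * (1 + 2 * gamma) <= 1,
        c * (4 * gamma + (k ^+ 2 + gamma + 9 + k)) <= k / 2 &
        c * Lambda <= chim * k / 2].
Proof.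
move=> g0 k0 La0 cm0; have k20 := sqr_ge0 k.
pose K := 4 * gamma + (k ^+ 2 + gamma + 9 + k).
have K0 : 0 < K by rewrite /K; lra.
pose c := Num.min (Num.min (1 / 2 / (2 + gamma)) (1 / (1 + 2 * gamma)))
                  (Num.min (k / 2 / K) (chim * k / 2 / Lambda)).
exists c.
  by rewrite !lt_min !divr_gt0 // ?mulr_gt0 //; lra.
split; rewrite -ler_pdivlMr //; try lra; rewrite /c !ge_min lexx ?orbT //.
Qed.

(** The order of choice matters: [D], [X], [Z], then [M1] and [C], depend only on the radii [Df] and
    [Ds], while [mu] depends on the actual initial energy [r]. The terms proportional to [eps] are
    then made small uniformly in [r <= Ds]. *)
Lemma tuned_exists (L k gamma Lambda xi chim chiM dM c l Df Ds dl : R) :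
  0 < L -> 0 < k -> 0 < gamma -> 0 < Lambda -> 0 < chim -> 0 <= chiM -> 0 <= dM ->
  0 < c -> c * (2 + gamma) <= 1 / 2 -> c * (1 + 2 * gamma) <= 1 ->
  c * (4 * gamma + (k ^+ 2 + gamma + 9 + k)) <= k / 2 -> c * Lambda <= chim * k / 2 ->
  0 < l -> 2 * l <= Lambda -> 2 * l <= chim * gamma ->
  0 < Df -> 0 < Ds -> 0 < dl ->
  exists2 eps_star, 0 < eps_star & exists M1 C, [/\ 0 < M1, 0 <= C &
    forall eps r U G, 0 < eps -> eps <= eps_star -> 0 <= r -> r <= Ds ->
      0 <= U -> 2 * U <= 3 * r -> G <= Df ->
    let mu := c / (5 + 3 * r) in
    exists Z X kap bb,
    [/\ tuned L k gamma Lambda xi eps chim chiM dM M1 mu (l * mu) (3 * r + 4) Z X C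
          (Df + 1) kap bb G (U + C * (Df + 1) * eps - bb),
        3 * (eps * M1) <= dl & 2 * (C * (Df + 1) * eps) + 2 * bb <= dl]].
Proof.
move=> L0 k0 g0 La0 cm0 cM0 dM0 c0 c1 c2 c3 c4 l0 l1 l2 Df0 Ds0 dl0.
pose D := Df + 1; pose X := D + 2; pose Z := 1 + 2 * gamma * (3 * Ds + 4).
have D0 : 0 < D by rewrite /D; lra.
have X0 : 0 < X by rewrite /X; lra.
have gD : 0 <= 2 * gamma * (3 * Ds + 4) by rewrite !mulr_ge0 // ?ltW //; lra.
have Z1 : 1 <= Z by rewrite /Z; lra.
have xi0 : 0 <= `|xi| by exact: normr_ge0.
pose F := dM + chiM * (chiM * (Z + k) + 2 * L * X * (`|xi| + Z + k)).
have Zk : 0 <= Z + k by lra.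
have xZk : 0 <= `|xi| + Z + k by lra.
have LX : 0 <= 2 * L * X by rewrite mulr_ge0 ?mulr_ge0 // ltW.
have F0 : 0 <= F.
  by rewrite /F addr_ge0 // mulr_ge0 // addr_ge0 //; exact: mulr_ge0.
pose M1 := F / L + 1.
have M10 : 0 < M1 by rewrite /M1 ltr_wpDl // divr_ge0 // ltW.
pose C := 2 * L * ((`|xi| + Z + k) * (4 + Z) + gamma * (Z / gamma + 1)).
have C0 : 0 <= C.
  have Z0 : 0 <= Z by clear - Z1; lra.
  have g0' := ltW g0.
  rewrite /C; apply: mulr_ge0; first by rewrite mulr_ge0 // ltW.
  apply: addr_ge0; first by rewrite mulr_ge0 //; clear - Z1 xi0 k0; lra.
  by rewrite mulr_ge0 // addr_ge0 // divr_ge0.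
pose kap1 := 25 * (2 * L * (2 * M1 + Lambda * D) / chim).
have kap10 : 0 <= kap1.
  have H : 0 <= 2 * M1 + Lambda * D by rewrite addr_ge0 // mulr_ge0 // ltW.
  by rewrite /kap1 mulr_ge0 // divr_ge0 ?(ltW cm0) // mulr_ge0 // mulr_ge0 // ltW.
pose lamD := l * (c / (5 + 3 * Ds)).
have dD0 : 0 < 5 + 3 * Ds by clear - Ds0; lra.
have lamD0 : 0 < lamD by rewrite /lamD mulr_gt0 // divr_gt0.
pose P := 2 * C * M1 + kap1 * Lambda.
have P0 : 0 <= P.
  have M1' := ltW M10; have La' := ltW La0.
  by rewrite /P addr_ge0 // mulr_ge0 // mulr_ge0.
have CD0 : 0 <= C * D by rewrite mulr_ge0 // ltW.
(* The ultimate bound will be [bb = eps * Kb]. Dividing by [lamD], the smallest rate over [r <= Ds],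
   makes [Kb] independent of [r]. *)
pose Kb := P / lamD + (C * D + kap1).
have Kb0 : 0 <= Kb.
  by rewrite /Kb addr_ge0 ?addr_ge0 // divr_ge0 // ltW.
(* Collects all multiples of [eps] that have to stay below 1 or below [dl]. *)
pose KA := 1 + 3 * M1 + 2 * (C * D) + 2 * Kb.
have KA0 : 0 < KA by rewrite /KA; clear - M10 CD0 Kb0; lra.
exists (Num.min 1 dl / KA); first by rewrite divr_gt0 // lt_min ltr01.
exists M1, C; split => // eps r U G eps0 epsS r0 rD U0 Ur GD mu.
have epsK : eps * KA <= Num.min 1 dl by rewrite -ler_pdivlMr.
have epsK1 : eps * KA <= 1 by apply: (le_trans epsK); rewrite ge_min lexx.
have epsKd : eps * KA <= dl by apply: (le_trans epsK); rewrite ge_min lexx orbT.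
have eM1 : 0 <= eps * M1 by rewrite mulr_ge0 // ltW.
have eCD : 0 <= eps * (C * D) by rewrite mulr_ge0 // ltW.
have eKb : 0 <= eps * Kb by rewrite mulr_ge0 // ltW.
have epsKA : eps * KA = eps + 3 * (eps * M1) + 2 * (eps * (C * D)) + 2 * (eps * Kb).
  by rewrite /KA; ring.
rewrite epsKA in epsK1 epsKd.
have dr0 : 0 < 5 + 3 * r by clear - r0; lra.
have mu0 : 0 < mu by rewrite /mu divr_gt0.
have muE : mu * (5 + 3 * r) = c by rewrite /mu divfK // gt_eqF.
have muc : mu <= c.
  by rewrite -muE ler_peMr ?(ltW mu0) //; clear - r0; lra.
have c_le1 : c <= 1.
  by apply: le_trans c2; rewrite ler_peMr ?(ltW c0) //; clear - g0; lra.
have lamDmu : lamD <= l * mu.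
  rewrite /lamD /mu ler_wpM2l ?(ltW l0) // ler_wpM2l ?(ltW c0) //.
  by rewrite lef_pV2 ?posrE //; clear - r0 rD; lra.
exists Z, X, (eps * kap1), (eps * Kb); split; last 2 first.
- by clear - epsKd eps0 eCD eKb; lra.
- have -> : C * D * eps = eps * (C * D) by ring.
  by clear - epsKd eps0 eM1 eKb; lra.
split => //; rewrite -/D.
- by rewrite (ltW mu0) (le_trans muc).
- by apply: le_trans c1; rewrite ler_wpM2r //; clear - g0; lra.
- apply: le_trans c2; rewrite -muE -[leRHS]mulrA ler_wpM2l ?(ltW mu0) //.
  by have := mulr_ge0 (ltW g0) r0; clear - r0 g0; lra.
- apply: le_trans c3; rewrite -muE -[leRHS]mulrA ler_wpM2l ?(ltW mu0) //.
  have K0 : 0 <= k ^+ 2 + gamma + 9 + k by have := sqr_ge0 k; clear - g0 k0; lra.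
  by have := mulr_ge0 (ltW g0) r0; have := mulr_ge0 K0 r0; clear - r0 g0 K0; lra.
- by apply: le_trans c4; rewrite ler_wpM2r // ltW.
- by rewrite mulr_ge0 // ltW.
- by rewrite mulrA mulrC ler_wpM2l // ltW.
- by rewrite mulrA mulrC ler_wpM2l // ltW.
- by clear - Z1; lra.
- have H : 2 * gamma * (3 * r + 4) <= 2 * gamma * (3 * Ds + 4).
    by rewrite ler_wpM2l ?mulr_ge0 ?(ltW g0) //; clear - rD; lra.
  apply: (le_trans H); rewrite /Z; set y := 2 * gamma * (3 * Ds + 4) in gD *.
  by have := sqr_ge0 y; rewrite sqrrD; clear - gD; lra.
- by rewrite -/F /M1 mulrDr mulr1 mulrCA divff ?gt_eqF // mulr1; clear - L0; lra.
- rewrite /kap1 le_eqVlt; apply/orP; left; apply/eqP; field.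
  by rewrite gt_eqF.
- exact: ltW.
- have lm0 : 0 <= l * mu by rewrite mulr_ge0 // ltW.
  have H : P <= l * mu * (P / lamD).
    by rewrite mulrCA ler_peMr // ler_pdivlMr // mul1r.
  have := ler_wpM2l (ltW eps0) H.
  have -> : l * mu * (eps * Kb) = eps * (l * mu * (P / lamD)) +
     l * mu * (C * D * eps + eps * kap1) by rewrite /Kb; ring.
  by rewrite /P; clear; lra.
- have -> : C * D * eps = eps * (C * D) by ring.
  by clear - U0 eCD epsK1 eM1 eps0; lra.
- have -> : C * D * eps = eps * (C * D) by ring.
  by clear - Ur epsK1 eM1 eKb eps0; lra.
- by rewrite /D; clear - GD; lra.
- by rewrite /X; clear - epsK1 eps0 eCD eKb M10; lra.
Qed.

End Comparison.

(** * Semiglobal practical asymptotic stability *)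

Theorem theorem1 (R : realType) (L k_eta gamma Lambda phi : R)
    (omega : R -> R) (omega_min omega_max : R) :
  0 < L -> 0 < k_eta -> 0 < gamma -> 0 < Lambda -> 0 < phi ->
  {within `[0, +oo[, continuous omega} ->
  piecewise_C1 omega ->
  0 < omega_min -> 0 < omega_max ->
  (forall t, 0 <= t -> omega_min <= `|omega t| <= omega_max) ->
  (exists M : R, forall t, 0 <= t ->
     (`|upper_right_dini omega t| <= M%:E)%E) ->
  let chi := fun t => phi * `|omega t| in
  (* omega is continuous without zeros, so its sign is that of omega 0 *)
  let xi := Num.sg (omega 0) / phi in
  exists (sigma_s : 'cV[R]_(2 + 2) -> R) (beta_s : R -> R -> R),
    [/\ proper_indicator (@slow_space R) (@slow_attractor R) sigma_s,
        class_KL beta_s &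
        forall Delta_f Delta_s delta : R,
          0 < Delta_f -> 0 < Delta_s -> 0 < delta ->
          exists2 eps_star : R, 0 < eps_star &
            forall eps : R, 0 < eps -> eps <= eps_star ->
            forall (E : set (R * nat)) (psif psis : R -> nat -> 'cV[R]_(2 + 2)),
              error_solution L k_eta gamma Lambda xi eps chi E psif psis ->
              clock (psis 0 0%N) = 0 ->
              enorm (psif 0 0%N) <= Delta_f ->
              sigma_s (psis 0 0%N) <= Delta_s ->
              forall (t : R) (j : nat), E (t, j) ->
                enorm (psif t j)
                  <= expR (- (t / eps)) * enorm (psif 0 0%N) + delta /\
                sigma_s (psis t j)
                  <= beta_s (sigma_s (psis 0 0%N)) (t + j%:R) + delta].
Proof.
move=> L0 k0 g0 La0 phi0 cw [B [fB HB]] wmin0 wmax0 Hw [M HM] chi xi.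
pose chim := phi * omega_min; pose chiM := phi * omega_max.
have cm0 : 0 < chim by rewrite mulr_gt0.
have cM0 : 0 <= chiM by rewrite mulr_ge0 // ltW.
have dM0 : 0 <= phi * `|M| by rewrite mulr_ge0 // ltW.
have chi_b t : 0 <= t -> chim <= chi t <= chiM.
  by move=> /Hw /andP[w1 w2]; rewrite /chim /chiM /chi !ler_wpM2l // ltW.
have chi_c t : 0 < t -> {for t, continuous chi}.
  move=> t0; apply: continuous_atM; first exact: continuous_at_cst.
  apply: continuous_comp; last exact: norm_continuous.
  apply: (@within_continuous_at R 0 (t + 1)); last by lra.
  by apply: continuous_subspaceW cw => x /=; rewrite !in_itv /= => /andP[->].
have Hw1 t : 0 <= t -> omega_min <= `|omega t| by move=> /Hw /andP[].
have chi_C1 T : exists Bs : seq R, forall t, 0 < t -> t <= T -> t \notin Bs ->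
    {for t, continuous (fun s => fine (upper_right_dini chi s))} /\
    `|fine (upper_right_dini chi t)| <= phi * `|M|.
  have /finite_seqP[Bs BsE] := fB T; exists Bs => t t0 tT tB.
  apply: (derive_input phi0 wmin0 cw fB HB Hw1 HM t0) => Bt.
  have : [set` Bs] t by rewrite -BsE; split => //=; rewrite in_itv /= tT ltW.
  by rewrite /= (negbTE tB).
have [c c0 [c1 c2 c3 c4]] := gain_exists g0 k0 La0 cm0.
pose l := Num.min Lambda (chim * gamma) / 2.
have l0 : 0 < l by rewrite divr_gt0 // lt_min La0 mulr_gt0.
have l2 : 2 * l = Num.min Lambda (chim * gamma) by rewrite /l mulrC divfK.
have l2a : 2 * l <= Lambda by rewrite l2 ge_min lexx.
have l2b : 2 * l <= chim * gamma by rewrite l2 ge_min lexx orbT.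
have La1 : 0 < 1 + Lambda by lra.
(* The rate in [t] is [l * mu]; the division by [1 + Lambda] accounts for
   [t + j <= (1 + Lambda) * t]. *)
exists (slow_indicator gamma), (decay (l * c / (1 + Lambda))); split.
- exact: slow_indicator_proper.
- by apply: decay_KL; rewrite divr_gt0 // mulr_gt0.
move=> Df Ds dl Df0 Ds0 dl0.
have [es es0 [M1 [C [M10 C0 H]]]] := tuned_exists xi L0 k0 g0 La0 cm0 cM0 dM0
  c0 c1 c2 c3 c4 l0 l2a l2b Df0 Ds0 dl0.
exists es => // eps eps0 epsS E psif psis sol clock0 nf0 sig0 t j Etj.
have S0 : slow_flow_set (psis 0 0%N).
  have [//|[u0 _]] := sol_init sol.
  by split => //; rewrite clock0 lexx ler01.
have eu0 : eta (psis 0 0%N) 0 0 ^+ 2 + eta (psis 0 0%N) 1 0 ^+ 2 = 1.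
  by have [/unit_circleP] := S0.
rewrite (slow_indicator_flow gamma S0) in sig0 *.
set r := energy gamma (eta (psis 0 0%N) 0 0) (xi_err (psis 0 0%N)) in sig0 *.
have [/andP[r0' rV] _] := energy_ge (xi_err (psis 0 0%N)) g0 eu0.
have r0 : 0 <= r by exact: le_trans r0' rV.
pose mu := c / (5 + 3 * r).
have dr0 : 0 < 5 + 3 * r by clear - r0; lra.
have mu0 : 0 <= mu by rewrite divr_ge0 // ltW.
have muc : mu * (2 + gamma) <= 1 / 2.
  apply: le_trans c1; rewrite ler_wpM2r //; first by clear - g0; lra.
  by rewrite /mu ler_pdivrMr // ler_peMr ?(ltW c0) //; clear - r0; lra.
pose U := lyap gamma mu (eta (psis 0 0%N) 0 0) (eta (psis 0 0%N) 1 0)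
  (xi_err (psis 0 0%N)) 0.
have [U1 U2] : r <= 2 * U /\ 2 * U <= 3 * r.
  by apply: lyap_energy => //; rewrite lexx ler01.
have U0 : 0 <= U by clear - U1 r0; lra.
have th0 : 0 < eps * M1 by rewrite mulr_gt0.
pose fs := fast_size (eps * M1) (usubmx (psif 0 0%N) 0 0) (usubmx (psif 0 0%N) 1 0)
  (dsubmx (psif 0 0%N) 0 0) (dsubmx (psif 0 0%N) 1 0).
have fs_le : fs <= enorm (psif 0 0%N) + eps * M1.
  by rewrite enorm_fast; apply: fast_size_le; exact: ltW.
pose G := fs - 2 * (eps * M1).
have GDf : G <= Df by rewrite /G; clear - fs_le nf0 th0; lra.
(* With [G] and [U] computed from the initial state, both barriers vanish at time 0, where the clock
   is 0. *)
have [Z [X [kap [bb [tun fd sd]]]]] := H eps r U G eps0 epsS r0 sig0 U0 U2 GDf.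
have := @tuned_inv_holds R _ _ _ _ _ _ _ _ _ _ _ _ _ _ _ _ _ _ _ _ _
  tun chi E psif psis sol chi_b chi_c chi_C1.
move=> /(_ _ t j Etj) [].
  split => //.
  - by rewrite /fast_barrier_at /fast_barrier mulr0 expR0 mulr1 subrr.
  - rewrite /slow_barrier_at /slow_barrier /slow_level clock0 !mulr0 expR0 !mulr1.
    by rewrite addr0 subrr.
  - by rewrite clock0 mulr0 addr0.
move=> St; rewrite /fast_barrier_at /slow_barrier_at fast_barrier_le slow_barrier_le.
rewrite !addr0 => ft st ct.
have [/unit_circleP eut rhot] := St.
have t0 : 0 <= t by have [P0 _ _] := sol_domain sol; exact: (P0 _ Etj).
have eE : - eps^-1 * t = - (t / eps) by rewrite mulNr mulrC.
split.
  rewrite enorm_fast; apply: (le_trans (fast_size_ge (eps * M1) _ _ _ _)).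
  apply: (le_trans ft); rewrite eE.
  have ex0 := expR_gt0 (- (t / eps)).
  have GE : G <= enorm (psif 0 0%N) by rewrite /G; clear - fs_le th0; lra.
  have := ler_wpM2r (ltW ex0) GE; clear - fd th0; lra.
rewrite (slow_indicator_flow gamma St).
have [V2 _] := lyap_energy (xi_err (psis t j)) g0 mu0 muc eut rhot.
apply: (le_trans V2).
have kap0 := tuned_kap_ge0 tun.
have ex0 := expR_gt0 (- eps^-1 * t).
have CD0 : 0 <= C * (Df + 1) * eps by rewrite mulr_ge0 ?mulr_ge0 ?(ltW eps0) //; clear - Df0 C0; lra.
have E0 := expR_gt0 (- (l * mu) * t); set e := expR _ in E0 st.
have lt0 : 0 <= l * mu * t by rewrite mulr_ge0 // mulr_ge0 // ltW.
have E1 : e <= 1 by rewrite /e expR_le1 mulNr oppr_le0.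
have Q1 : 0 <= C * (Df + 1) * eps * expR (- eps^-1 * t) by rewrite mulr_ge0 // ltW.
have Q2 : 0 <= kap * clock (psis t j) by rewrite mulr_ge0 //; clear - rhot kap0; lra.
have Q3 : C * (Df + 1) * eps * e <= C * (Df + 1) * eps * 1 by rewrite ler_wpM2l.
have Q4 : 0 <= bb * e by rewrite mulr_ge0 ?(tuned_bb_ge0 tun) // ltW.
have Q5 := ler_wpM2r (ltW E0) U2.
(* Here [ct], the jump-counting clause of the invariant, converts decay in [t] into decay in
   [t + j]. *)
have Q6 : 3 * r * e <= decay (l * c / (1 + Lambda)) r (t + j%:R).
  rewrite /decay ler_wpM2l ?mulr_ge0 // ler_expR mulNr lerN2 (ger0_norm r0).
  have -> : l * c / (1 + Lambda) / (5 + 3 * r) * (t + j%:R) =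
      l * mu * ((t + j%:R) / (1 + Lambda)).
    by rewrite /mu; field; rewrite !gt_eqF.
  have lm0 : 0 <= l * mu by rewrite mulr_ge0 // ltW.
  by rewrite ler_wpM2l // ler_pdivrMr // mulrC; clear - ct rhot; lra.
move: st; rewrite /slow_level; clear - Q1 Q2 Q3 Q4 Q5 Q6 sd; lra.
Qed.
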